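(* Let $F(\mathbf X,\bar{\mathbf X})$ and $G(\mathbf X,\bar{\mathbf X})$, $\mathbf X=(X_0,X_1,X_2)$, be strongly polar homogeneous mixed polynomials of polar degrees $d$ and $d'$ respectively, defining mixed projective curves $C=\{F=0\}$ and $C'=\{G=0\}$ in $\mathbb P^2$ whose mixed singularities are at worst isolated. Assume $C\cap C'\cap\{X_0=0\}=\emptyset$ and $C\cap C'=\{P_1,\dots,P_\mu\}$ is finite. Then \[ \sum_{j=1}^\mu I_{top}(C,C';P_j)=dd'. \]
   Context: A mixed polynomial $F(\mathbf X,\bar{\mathbf X})=\sum c_{\nu\mu}\mathbf X^\nu\bar{\mathbf X}^\mu$ is strongly polar homogeneous of radial degree $d_r$ and polar degree $q$ if every monomial with $c_{\nu\mu}\ne0$ satisfies $|\nu|+|\mu|=d_r$ and $|\nu|-|\mu|=q$; then its zero set is a well-defined subset of $\mathbb P^2$ (a mixed projective curve). Since $C\cap C'\subset\{X_0\ne0\}$, the local intersection numbers are computed in the affine chart $z_1=X_1/X_0$, $z_2=X_2/X_0$ using $f(\mathbf z,\bar{\mathbf z})=F(1,z_1,z_2,1,\bar z_1,\bar z_2)$ and $g(\mathbf z,\bar{\mathbf z})=G(1,z_1,z_2,1,\bar z_1,\bar z_2)$: identifying $\mathbb C^2$ with $\mathbb R^4$ via $z_j=x_j+iy_j$ (standard orientation), writing $f=f_{\mathbb R}+if_I$, $g=g_{\mathbb R}+ig_I$, $I_{top}(C,C';P)$ is the mapping degree of $\varphi/\|\varphi\|:S^3_\varepsilon(P)\to S^3$,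 $\varphi=(f_{\mathbb R},f_I,g_{\mathbb R},g_I)$, where $S^3_\varepsilon(P)$ is the boundary of a small ball around $P$ containing no other intersection point. A point is a mixed singularity of $\{f=0\}$ if the Jacobian of $(f_{\mathbb R},f_I)$ has rank $<2$ there. *)

(* Defs.v *)
From HB Require Import structures.
From mathcomp Require Import all_boot all_order all_algebra.
From mathcomp Require Import all_classical all_reals.
From mathcomp Require Import topology normedtype derive.
From mathcomp Require Import complex.

Set Implicit Arguments.
Unset Strict Implicit.
Unset Printing Implicit Defensive.

Import Order.TTheory GRing.Theory Num.Theory.
Import numFieldNormedType.Exports.
Local Open Scope ring_scope.

Section MixedCurves.
Variable R : realType.

Local Notation C := (R[i]).

(** A mixed monomial X^nu Xbar^mu : ((nu0,nu1,nu2),(mu0,mu1,mu2)). *)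
Definition mmono := ((nat * nat * nat) * (nat * nat * nat))%type.

Record mixed_poly := MixedPoly {
  mp_coef : mmono -> C ;
  mp_supp : seq mmono ;
  mp_suppP : forall m, mp_coef m != 0 -> m \in mp_supp }.

Definition nu_deg (m : mmono) : nat := m.1.1.1 + m.1.1.2 + m.1.2.
Definition mu_deg (m : mmono) : nat := m.2.1.1 + m.2.1.2 + m.2.2.

Definition mp_eval (F : mixed_poly) (x0 x1 x2 : C) : C :=
  \sum_(m <- undup (mp_supp F))
     mp_coef F m
     * x0 ^+ m.1.1.1 * x1 ^+ m.1.1.2 * x2 ^+ m.1.2
     * (conjc x0) ^+ m.2.1.1 * (conjc x1) ^+ m.2.1.2 * (conjc x2) ^+ m.2.2.

Definition strongly_polar_homogeneous (F : mixed_poly) (dr : nat) (q : int) :=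
  forall m, mp_coef F m != 0 ->
    (nu_deg m + mu_deg m)%N = dr /\ (nu_deg m)%:Z - (mu_deg m)%:Z = q.

Definition z1_of (v : 'rV[R]_4) : C := Complex (v ord0 0) (v ord0 1).
Definition z2_of (v : 'rV[R]_4) : C := Complex (v ord0 2) (v ord0 3).

Definition chart_eval (F : mixed_poly) (k : 'I_3) (v : 'rV[R]_4) : C :=
  if k == 0 :> nat then mp_eval F 1 (z1_of v) (z2_of v)
  else if k == 1 :> nat then mp_eval F (z1_of v) 1 (z2_of v)
  else mp_eval F (z1_of v) (z2_of v) 1.

Definition real_jacobian (f : 'rV[R]_4 -> C) (v : 'rV[R]_4) : 'M[R]_(2, 4) :=
  \matrix_(i < 2, j < 4)
    (if i == 0 :> nat then 'D_(delta_mx ord0 j) (fun w => complex.Re (f w)) v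
     else 'D_(delta_mx ord0 j) (fun w => complex.Im (f w)) v).

Definition mixed_singular (f : 'rV[R]_4 -> C) (v : 'rV[R]_4) :=
  f v = 0 /\ (\rank (real_jacobian f v) < 2)%N.

Definition enorm (v : 'rV[R]_4) : R := Num.sqrt (\sum_(j < 4) v ord0 j ^+ 2).

(** The mixed singularities of C = {F = 0} are at worst isolated: in every
    affine chart (these cover P^2) each mixed singular point is isolated. *)
Definition isolated_mixed_singularities (F : mixed_poly) :=
  forall (k : 'I_3) (v : 'rV[R]_4), mixed_singular (chart_eval F k) v ->
    exists2 r : R, 0 < r & forall w, w != v -> enorm (w - v) < r ->
      ~ mixed_singular (chart_eval F k) w.

Definition phi_map (F G : mixed_poly) (v : 'rV[R]_4) : 'rV[R]_4 :=
  \row_(j < 4)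
    (if j == 0 :> nat then complex.Re (chart_eval F 0 v)
     else if j == 1 :> nat then complex.Im (chart_eval F 0 v)
     else if j == 2 :> nat then complex.Re (chart_eval G 0 v)
     else complex.Im (chart_eval G 0 v)).

Definition jac4 (h : 'rV[R]_4 -> 'rV[R]_4) (x : 'rV[R]_4) : 'M[R]_4 :=
  \matrix_(i < 4, j < 4) ('D_(delta_mx ord0 j) h x) ord0 i.

(** Orientation sign of d(psi|S) : T_x S -> T_y S^3 where S = S_eps(p),
    both spheres oriented as boundaries (outward normal first).  With
    n the outward unit normal at x and M = D psi(x), the matrix
    M + (y - M n) n^T maps a positive orthonormal frame (n, v1, v2, v3) of
    R^4 to (y, M v1, M v2, M v3); its determinant's sign is the sign of
    d(psi|S)_x. *)
Definition sphere_det (psi : 'rV[R]_4 -> 'rV[R]_4) (p : 'rV[R]_4) (eps : R)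
    (x : 'rV[R]_4) : R :=
  let n := eps^-1 *: (x - p) in
  let M := jac4 psi x in
  let y := psi x in
  \det (M + (y^T - M *m n^T) *m n).

Definition on_sphere (p : 'rV[R]_4) (eps : R) (x : 'rV[R]_4) :=
  enorm (x - p) = eps.

(** Mapping degree (Milnor's definition via regular values) of
    psi : S_eps(p) -> S^3: for every regular value y, the signed count of
    preimages equals n. *)
Definition sphere_map_degree (psi : 'rV[R]_4 -> 'rV[R]_4) (p : 'rV[R]_4)
    (eps : R) (n : int) :=
  forall y : 'rV[R]_4, enorm y = 1 ->
    (forall x, on_sphere p eps x -> psi x = y -> sphere_det psi p eps x != 0) ->
    exists s : seq 'rV[R]_4,
      [/\ uniq s,
          (forall x, (on_sphere p eps x /\ psi x = y) <-> x \in s) &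
          \sum_(x <- s) (if 0 < sphere_det psi p eps x then 1 else -1 : int)
            = n].

(** I_top(C, C'; P) = n, P given by real coordinates p in the chart X0 = 1. *)
Definition Itop (F G : mixed_poly) (p : 'rV[R]_4) (n : int) :=
  exists2 eps : R, 0 < eps &
    (forall v, enorm (v - p) <= eps -> phi_map F G v = 0 -> v = p) /\
    sphere_map_degree
      (fun v => (enorm (phi_map F G v))^-1 *: phi_map F G v) p eps n.

End MixedCurves.

(* Main.v *)
Require Import Defs.
From HB Require Import structures.
From mathcomp Require Import all_boot all_order all_algebra.
From mathcomp Require Import fingroup perm separable zify ring lra.
From mathcomp Require Import all_classical all_reals interval_inference.
From mathcomp Require Import topology normedtype sequences landau derive realfun.
From mathcomp Require Import complex.

Set Implicit Arguments.
Unset Strict Implicit.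
Unset Printing Implicit Defensive.
Import Order.TTheory GRing.Theory Num.Theory.
Import numFieldNormedType.Exports.
Local Open Scope ring_scope.

(** Near infinity the affine map [(f, g)] is dominated by its leading part
    [h = (F(0, z1, z2), G(0, z1, z2))], so the sum of the local degrees of
    [(f, g)] is the degree of [h] on a large sphere.  Strong polar homogeneity
    gives [F(l X) = l^p (conj l)^q F(X)] with [p - q = d], and likewise for [G];
    hence a common zero of the segment from [h] to
    [(al z1^p (conj z1)^q, be z2^p' (conj z2)^q')] forces [(al, be)] into the
    image of a map of three real variables, and generic [(al, be)] avoid it by
    Sard's theorem.  The monomial map is deformed to [(z1^d - 1/2, z2^d' - 1/2)]
    (with conjugates for negative exponents), which has [|d d'|] regular zeros,
    all of sign [sgn (d d')].

    Degrees are counted combinatorially: label each vertex of a fine grid by the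
    first negative coordinate of the map, and add up the orientations of the
    fully labelled simplices of the Kuhn triangulation.  The count depends only
    on the boundary labels, whence homotopy invariance; fully labelled simplices
    lie near zeros, whence additivity.  *)

(** * Kuhn triangulation *)

Section FirstFalse.
Variable n : nat.
Implicit Types (P Q : pred 'I_n) (k : 'I_n.+1).

Definition first_false P : 'I_n.+1 :=
  [arg min_(k < ord_max | [forall i : 'I_n, (i == k :> nat) ==> ~~ P i]) (k : nat)].

Lemma first_falseP P k : first_false P = k <->
  (forall i : 'I_n, (i < k)%N -> P i) /\ (forall i : 'I_n, i = k :> nat -> ~~ P i).
Proof.
rewrite /first_false; case: arg_minnP => [|k0 /forallP k0P k0_min].
  by apply/forallP => i; rewrite /= ltn_eqF // ltn_ord.
have Pk0 (i : 'I_n) : i = k0 :> nat -> ~~ P i by move=> /eqP; exact/implyP.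
split=> [<-|[Plt Pk]].
  split=> // i ik; apply: contraLR ik => Pi; rewrite -leqNgt.
  by apply: (k0_min (widen_ord (leqnSn n) i)); apply/forallP => j;
    apply/implyP => /eqP/val_inj->.
apply/val_inj/eqP; rewrite eqn_leq k0_min /=; last first.
  by apply/forallP => i; apply/implyP => /eqP; exact: Pk.
rewrite leqNgt; apply/negP => k0k.
have k0n : (k0 < n)%N by rewrite (leq_trans k0k) // -ltnS.
by have := Pk0 (Ordinal k0n) erefl; rewrite Plt.
Qed.

Lemma eq_first_false P Q : P =1 Q -> first_false P = first_false Q.
Proof.
move=> PQ; have [Plt Pk] := (first_falseP P _).1 erefl.
by apply/esym/first_falseP; split=> i ik; rewrite -PQ; [exact: Plt|exact: Pk].
Qed.

Lemma homo_first_false P Q : subpred P Q -> (first_false P <= first_false Q)%N.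
Proof.
move=> PQ; rewrite leqNgt; apply/negP => QP.
have [_ Q_end] := (first_falseP Q _).1 erefl.
have [P_lt _] := (first_falseP P _).1 erefl.
have Qn : (first_false Q < n)%N by rewrite (leq_trans QP) // -ltnS.
by have := Q_end (Ordinal Qn) erefl; rewrite PQ // P_lt.
Qed.

End FirstFalse.

Lemma monotone_surj_ord_id n (f : 'I_n -> 'I_n) :
  {homo f : i j / (i <= j)%N} -> (forall j, exists i, f i = j) -> f =1 id.
Proof.
move=> f_homo f_surj.
have [g gK] := fin_all_exists f_surj.
have f_inj : injective f by exact: bij_inj (bij_can_bij (injF_bij (can_inj gK)) gK).
pose leo := fun i j : 'I_n => (i <= j)%N.
have enum_sorted : sorted leo (enum 'I_n).
  by rewrite -(@sorted_map _ _ val leq) val_enum_ord iota_sorted.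
suff fE : map f (enum 'I_n) = map id (enum 'I_n).
  by move=> i; have /eq_in_map := fE; apply; rewrite mem_enum.
rewrite map_id; apply: (@sorted_eq _ leo) => //.
- by move=> i j k; exact: leq_trans.
- by move=> i j /anti_leq/val_inj.
- exact: homo_sorted f_homo _ enum_sorted.
apply: uniq_perm; [by rewrite map_inj_uniq // enum_uniq|exact: enum_uniq|move=> j].
by rewrite mem_enum; apply/mapP; exists (g j); rewrite ?mem_enum.
Qed.

Lemma signed_sum_tperm_eq0 n (f : 'S_n -> int) (i j : 'I_n) : i != j ->
  (forall s, f (s * tperm i j)%g = f s) -> \sum_(s : 'S_n) (-1) ^+ s * f s = 0.
Proof.
move=> ij f_inv.
suff SN : \sum_(s : 'S_n) (-1) ^+ s * f s = - \sum_(s : 'S_n) (-1) ^+ s * f s by lia.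
rewrite {1}(reindex_inj (mulIg (tperm i j))) -sumrN; apply: eq_bigr => s _.
by rewrite f_inv odd_permM odd_tperm ij addbT signrN mulNr.
Qed.

Section KuhnDegree.
Variable m : nat.
Local Notation n := m.+1.
Local Notation vertex := {ffun 'I_n -> nat}.
Implicit Types (a : vertex) (s : 'S_n) (L : vertex -> 'I_n.+1) (K : nat).

(* The [k]-th vertex of the Kuhn simplex of the cell at [a]: coordinate [i] is
   raised at step [s i]. *)
Definition kuhn_vertex a s (k : nat) : vertex := [ffun i => (a i + (s i < k))%N].

Definition shift_vertex a (j : 'I_n) : vertex := [ffun i => (a i + (i == j))%N].

Lemma kuhn_vertex0 a s : kuhn_vertex a s 0 = a.
Proof. by apply/ffunP => i; rewrite !ffunE addn0. Qed.

Lemma kuhn_vertex_le a s k K : (forall i, a i < K)%N ->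
  forall i, (kuhn_vertex a s k i <= K)%N.
Proof. by move=> aK i; rewrite ffunE (leq_trans _ (aK i)) // -[(a i).+1]addn1 leq_add2l leq_b1. Qed.

Lemma kuhn_vertex_tperm a s (i j : 'I_n) k : (i < k)%N = (j < k)%N ->
  kuhn_vertex a (s * tperm i j)%g k = kuhn_vertex a s k.
Proof.
move=> ijk; apply/ffunP => x; rewrite !ffunE permM.
by case: tpermP => [->|->|//]; rewrite ijk.
Qed.

Definition cycle_step : 'S_n := lift_perm ord_max ord0 1%g.

Lemma kuhn_vertex_cycle_step a s k : (k < n)%N ->
  kuhn_vertex a (s * cycle_step)%g k.+1 =
  kuhn_vertex (shift_vertex a (s^-1%g ord_max)) s k.
Proof.
move=> kn; apply/ffunP => x; rewrite !ffunE permM.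
have [y sx|sx] := unliftP ord_max (s x); last first.
  have -> : x = (s^-1)%g ord_max by rewrite -sx permK.
  by rewrite permKV lift_perm_id eqxx ltn0Sn [(_ < k)%N]ltnNge -ltnS kn addn0.
have /negPf-> : x != (s^-1)%g ord_max.
  by rewrite -(canF_eq (permK s)) sx eq_sym neq_lift.
by rewrite addn0 sx lift_perm_lift perm1 lift0 lift_max.
Qed.

Definition label_sign (l : 'I_n.+1 -> 'I_n.+1) : int := \det (rowsub l 1%:M).

Definition face_sign (l : 'I_n -> 'I_n.+1) : int :=
  \det (mxsub l (lift ord_max) 1%:M).

Lemma eq_label_sign l l' : l =1 l' -> label_sign l = label_sign l'.
Proof. by move=> ll'; congr (\det _); exact: eq_rowsub. Qed.

Lemma eq_face_sign l l' : l =1 l' -> face_sign l = face_sign l'.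
Proof. by move=> ll'; congr (\det _); apply: eq_mxsub. Qed.

(* Every row of the label matrix sums to 1, so that its last column may be
   replaced by ones before expanding along it. *)
Lemma label_sign_faces l :
  label_sign l = \sum_(k < n.+1) (-1) ^+ (k + n) * face_sign (l \o lift k).
Proof.
pose T : 'M[int]_n.+1 := \matrix_(i, j) ((i == j) || (j == ord_max))%:R.
have detT : \det T = 1.
  rewrite -det_tr det_trig => [|]; first by rewrite big1 // => i _; rewrite !mxE eqxx.
  apply/is_trig_mxP => i j ij; rewrite !mxE -!val_eqE /= gtn_eqF //=.
  by rewrite ltn_eqF // (leq_trans ij) // -ltnS.
rewrite /label_sign -[LHS]mulr1 -[X in _ * X]detT -det_mulmx mul_rowsub_mx mul1mx.
rewrite (expand_det_col _ ord_max); apply: eq_bigr => k _.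
rewrite 2!mxE eqxx orbT mul1r /cofactor; congr (_ * \det _).
by apply/matrixP => i j; rewrite !mxE [lift _ _ == ord_max]eq_sym (negPf (neq_lift _ _)) orbF.
Qed.

Lemma label_sign_surj l : label_sign l != 0 -> forall j, exists k, l k = j.
Proof.
move=> l_neq0 j; apply/'exists_eqP; apply: contraNT l_neq0 => /existsPn l_neq.
by rewrite /label_sign (expand_det_col _ j) big1 // => k _; rewrite !mxE (negPf (l_neq k)) mul0r.
Qed.

Definition cell_sign L a : int :=
  \sum_(s : 'S_n) (-1) ^+ s * label_sign (fun k => L (kuhn_vertex a s k)).

Definition base_face_sign L s a : int :=
  face_sign (fun k : 'I_n => L (kuhn_vertex a s k)).

Lemma cell_sign_eq0 L a :
  (forall s, ~ forall j, exists k : 'I_n.+1, L (kuhn_vertex a s k) = j) -> cell_sign L a = 0.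
Proof.
move=> not_full; rewrite /cell_sign big1 // => s _.
by apply/eqP; rewrite mulf_eq0; apply/orP; right; apply/negPn/negP => /label_sign_surj/not_full.
Qed.

(* The inner faces cancel under the transposition of two consecutive steps; the
   first face for the cyclic shift of [s] is a translate of the last face for
   [s]. *)
Lemma cell_sign_boundary L a :
  cell_sign L a = \sum_(s : 'S_n) (-1) ^+ s *
    (base_face_sign L s a - base_face_sign L s (shift_vertex a (s^-1%g ord_max))).
Proof.
pose face s (k : 'I_n.+1) := face_sign (fun i : 'I_n => L (kuhn_vertex a s (lift k i))).
have cellE : cell_sign L a =
    \sum_(k < n.+1) (-1) ^+ (k + n) * \sum_(s : 'S_n) (-1) ^+ s * face s k.
  rewrite /cell_sign; under eq_bigr do rewrite label_sign_faces mulr_sumr.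
  by rewrite exchange_big; apply: eq_bigr => k _; rewrite mulr_sumr; apply: eq_bigr => s _;
    rewrite mulrCA.
have inner_face (k : 'I_m) :
    \sum_(s : 'S_n) (-1) ^+ s * face s (lift ord0 (widen_ord (leqnSn m) k)) = 0.
  apply: (@signed_sum_tperm_eq0 _ _ (widen_ord (leqnSn m) k) (lift ord0 k)) => [|s].
    by rewrite -val_eqE /= /bump /=; lia.
  by apply: eq_face_sign => i /=; rewrite kuhn_vertex_tperm //= /bump /=; lia.
have last_face s : face s ord_max = base_face_sign L s a.
  by apply: eq_face_sign => i; rewrite lift_max.
have first_face : \sum_(s : 'S_n) (-1) ^+ s * face s ord0 = (-1) ^+ m *
    \sum_(s : 'S_n) (-1) ^+ s * base_face_sign L s (shift_vertex a (s^-1%g ord_max)).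
  rewrite (reindex_inj (mulIg cycle_step)) mulr_sumr; apply: eq_bigr => s _.
  rewrite odd_permM odd_lift_perm odd_perm1 addbF /= addbF signr_addb signr_odd -mulrA mulrCA.
  by congr (_ * (_ * _)); apply: eq_face_sign => i; rewrite lift0 kuhn_vertex_cycle_step.
rewrite cellE big_ord_recl big_ord_recr /= [X in _ + (X + _)]big1 => [|k _]; last first.
  by rewrite inner_face mulr0.
rewrite /= add0r addrC [lift ord0 ord_max](_ : _ = ord_max); last exact: val_inj.
rewrite first_face mulrA add0n (exprS _ m) mulN1r mulNr -expr2 sqrr_sign mulN1r.
rewrite -signr_odd (_ : odd _ = false); last by rewrite /bump /=; lia.
rewrite mul1r -sumrB; apply: eq_bigr => s _.
by rewrite mulrBr last_face.
Qed.

Definition kuhn_degree K L : int :=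
  \sum_(a : {ffun 'I_n -> 'I_K}) cell_sign L [ffun i => val (a i)].

Lemma eq_kuhn_degree K L L' : (forall a, (forall i, a i <= K)%N -> L a = L' a) ->
  kuhn_degree K L = kuhn_degree K L'.
Proof.
move=> LL'; apply: eq_bigr => a _; apply: eq_bigr => s _; congr (_ * _).
by apply: eq_label_sign => k; apply: LL'; apply: kuhn_vertex_le => i; rewrite ffunE ltn_ord.
Qed.

Lemma sum_shift_vertex K (g : vertex -> int) (j : 'I_n) :
  (forall a, a j = 0%N \/ a j = K -> g a = 0) ->
  \sum_(a : {ffun 'I_n -> 'I_K}) g (shift_vertex [ffun i => val (a i)] j) =
  \sum_(a : {ffun 'I_n -> 'I_K}) g [ffun i => val (a i)].
Proof.
move=> g0.
pose cyclic_shift (a : {ffun 'I_n -> 'I_K}) : {ffun 'I_n -> 'I_K} :=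
  [ffun i => if i == j then ordS (a i) else a i].
have cyclic_shift_inj : injective cyclic_shift.
  move=> a b /ffunP ab; apply/ffunP => i; have := ab i; rewrite !ffunE.
  by case: eqP => // _ /(can_inj (@ordSK _)).
rewrite [RHS](reindex_inj cyclic_shift_inj); apply: eq_bigr => a _.
have [ajK|Kaj] := ltnP (a j).+1 K.
  congr g; apply/ffunP => i; rewrite !ffunE; case: eqP => [->|_]; last by rewrite addn0.
  by rewrite /= modn_small ?addn1.
have aj : (a j).+1 = K by apply/eqP; rewrite eqn_leq Kaj ltn_ord.
rewrite !g0 //; first by left; rewrite !ffunE eqxx /= aj modnn.
by right; rewrite !ffunE eqxx addn1.
Qed.

Definition boundary_vertex K a := [exists j, (a j == 0%N) || (a j == K)].

Lemma kuhn_degree_boundary K L L' :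
  (forall a, boundary_vertex K a -> L a = L' a) -> kuhn_degree K L = kuhn_degree K L'.
Proof.
move=> LL'; pose g s a := base_face_sign L s a - base_face_sign L' s a.
have g0 s a : a (s^-1%g ord_max) = 0%N \/ a (s^-1%g ord_max) = K -> g s a = 0.
  move=> aj; apply/eqP; rewrite subr_eq0; apply/eqP/eq_face_sign => k.
  apply: LL'; apply/existsP; exists (s^-1%g ord_max).
  rewrite ffunE permKV /= ltnNge -ltnS ltn_ord addn0.
  by case: aj => ->; rewrite eqxx ?orbT.
apply/eqP; rewrite -subr_eq0 -sumrB; apply/eqP.
transitivity (\sum_(a : {ffun 'I_n -> 'I_K}) \sum_(s : 'S_n) (-1) ^+ s *
    (g s [ffun i => val (a i)] - g s (shift_vertex [ffun i => val (a i)] (s^-1%g ord_max)))).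
  apply: eq_bigr => a _; rewrite !cell_sign_boundary -sumrB; apply: eq_bigr => s _.
  by rewrite -mulrBr /g; congr (_ * _); ring.
rewrite exchange_big big1 //= => s _.
by rewrite -mulr_sumr sumrB sum_shift_vertex ?subrr ?mulr0 //; exact: g0.
Qed.

Lemma kuhn_degree_perm K L (t : 'S_n) :
  kuhn_degree K (fun a => L [ffun i => a (t i)]) = (-1) ^+ t * kuhn_degree K L.
Proof.
pose precomp (a : {ffun 'I_n -> 'I_K}) : {ffun 'I_n -> 'I_K} := [ffun i => a (t i)].
have precomp_inj : injective precomp.
  move=> a b /ffunP ab; apply/ffunP => i.
  by have := ab ((t^-1)%g i); rewrite !ffunE permKV.
rewrite /kuhn_degree [in RHS](reindex_inj precomp_inj) mulr_sumr; apply: eq_bigr => a _.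
rewrite /cell_sign [in RHS](reindex_inj (mulgI t)) mulr_sumr; apply: eq_bigr => s _.
rewrite odd_permM signr_addb mulrA mulrA -expr2 sqrr_sign mul1r; congr (_ * _).
apply: eq_label_sign => k; congr L; apply/ffunP => i.
by rewrite !ffunE permM.
Qed.

Definition threshold_label c a : 'I_n.+1 := first_false (fun i => (c <= a i)%N).

Lemma threshold_label_full c a s : (0 < c)%N ->
  (forall j, exists k : 'I_n.+1, threshold_label c (kuhn_vertex a s k) = j) ->
  s = 1%g /\ forall i, a i = c.-1.
Proof.
move=> c0 full.
have labelE (k : 'I_n.+1) : threshold_label c (kuhn_vertex a s k) = k.
  apply: (monotone_surj_ord_id (f := fun k : 'I_n.+1 => threshold_label c (kuhn_vertex a s k))).
    move=> k1 k2 k12; apply: homo_first_false => i; rewrite !ffunE.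
    case: (ltnP _ k1) => [/leq_trans/(_ k12)->//|_]; rewrite addn0 => /leq_trans; apply.
    exact: leq_addr.
  exact: full.
have step (i : 'I_n) : s i = i /\ a i = c.-1.
  have [_ /(_ i erefl)] := (first_falseP _ _).1 (labelE (widen_ord (leqnSn n) i)).
  have [/(_ i)] := (first_falseP _ _).1 (labelE (lift ord0 i)).
  rewrite lift0 ltnSn => /(_ isT); rewrite !ffunE /= ltnS -ltnNge => c_le _ c_gt.
  by split; [apply/val_inj => /=|]; move: c_le c_gt; case: ltnP; case: leqP; lia.
by split=> [|i]; [apply/permP => i; rewrite perm1|]; have [] := step i.
Qed.

Lemma kuhn_degree_threshold K c : (0 < c <= K)%N -> kuhn_degree K (threshold_label c) = 1.
Proof.
move=> /andP[c0 cK]; have c1K : (c.-1 < K)%N by rewrite prednK.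
rewrite /kuhn_degree (bigD1 [ffun=> Ordinal c1K]) //= [X in _ + X]big1 ?addr0; last first.
  move=> a /eqP a_neq; apply: cell_sign_eq0 => s /(threshold_label_full c0)[_ aE].
  by case: a_neq; apply/ffunP => i; apply/val_inj; have := aE i; rewrite !ffunE.
rewrite /cell_sign (bigD1 1%g) //= [X in _ + X]big1 ?addr0; last first.
  move=> s s_neq1; apply/eqP; rewrite mulf_eq0; apply/orP; right.
  by apply: contraNT s_neq1 => /label_sign_surj/(threshold_label_full c0)[-> _].
rewrite odd_perm1 mul1r -[RHS](det1 _ n.+1); congr (\det _).
apply/matrixP => k j; rewrite !mxE; congr (_ == _)%:R.
by apply/first_falseP; split=> i; rewrite !ffunE perm1 /= => ik; rewrite ?ik ?ltnn; lia.
Qed.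

End KuhnDegree.

(** * Grid degree of a continuous map *)

Local Open Scope classical_set_scope.
Local Open Scope ring_scope.

Lemma near_seq (T : eqType) (U : Type) (F : set_system U) (s : seq T) (P : T -> U -> Prop) :
  Filter F -> (forall x, x \in s -> \forall u \near F, P x u) ->
  \forall u \near F, forall x, x \in s -> P x u.
Proof.
move=> FF; elim: s => [|y s IH] sP; first by near=> u.
have yP := sP y (mem_head _ _).
have {}IH : \forall u \near F, forall x, x \in s -> P x u.
  by apply: IH => x xs; apply: sP; rewrite in_cons xs orbT.
near=> u => x; rewrite in_cons => /orP[/eqP->|]; first by near: u.
by move: x; near: u.
Unshelve. all: by end_near. Qed.

Section NormedModules.
Variable R : realType.

Lemma near_natSinv_lt (e : R) : 0 < e -> \forall N \near \oo, N.+1%:R^-1 < e.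
Proof. by move=> e0; exact: (near_infty_natSinv_lt (PosNum e0)). Qed.

Lemma near_right_ball (V : normedModType R) (p : V) (P : set V) :
  (\forall x \near p, P x) -> \forall r \near 0^'+, forall x, `|x - p| <= r -> P x.
Proof.
move=> /nbhs_normP[d /= d0 dP]; near=> r => x xr.
by apply: dP; rewrite /= distrC (le_lt_trans xr) //; near: r; exact: nbhs_right_lt.
Unshelve. all: by end_near. Qed.

Lemma compact_norm_lbound (T : topologicalType) (V : normedModType R) (X : set T) (f : T -> V) :
  compact X -> continuous f -> (forall x, X x -> f x != 0) ->
  exists2 e : R, 0 < e & forall x, X x -> e <= `|f x|.
Proof.
move=> cX cf f_neq0; have [->|X0] := eqVneq X set0; first by exists 1.
have cnf : {within X, continuous (fun x => `|f x|)}.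
  by apply: continuous_subspaceT => x; exact: (cvg_norm (cf x)).
have [c] := compact_EVT_min ((set0P _).1 X0) cX cnf.
rewrite inE => Xc c_min; exists `|f c|; first by rewrite normr_gt0 f_neq0.
by move=> x Xx; apply: c_min; rewrite inE.
Qed.

Lemma compact_near_diagonal (V : normedModType R) (X : set V) (P : nat -> V -> V -> Prop) :
  compact X ->
  (forall x0, X x0 -> \forall r \near (0 : R)^'+, \forall N \near \oo,
     forall x y, `|x - x0| <= r -> `|y - x0| <= r -> P N x y) ->
  \forall N \near \oo, forall x y, X x -> `|y - x| <= N.+1%:R^-1 -> P N x y.
Proof.
move=> /compact_near_coveringP cX P_near.
suff : \forall N \near \oo, X `<=` (fun x => forall y, `|y - x| <= N.+1%:R^-1 -> P N x y).
  by apply: filterS => N NP x y /NP; exact.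
apply: cX => x0 Xx0; near (0 : R)^'+ => r; have r2 : 0 < r / 2 by rewrite divr_gt0.
have P_r : \forall N \near \oo, forall x y, `|x - x0| <= r -> `|y - x0| <= r -> P N x y.
  by near: r; exact: P_near.
near=> x N.
have Nr : N.+1%:R^-1 < r / 2 by near: N; exact: near_natSinv_lt.
have P_N y z : `|y - x0| <= r -> `|z - x0| <= r -> P N y z by move: y z; near: N.
have xx0 : `|x - x0| < r / 2.
  by rewrite distrC; near: x; apply/nbhs_normP; exists (r / 2).
move=> y yx; apply: P_N; first by rewrite (le_trans (ltW xx0)) // ler_pdivrMr // ler_peMr // ler1n.
rewrite (le_trans (ler_distD x _ _)) // (splitr r) lerD // ltW //.
exact: le_lt_trans Nr.
Unshelve. all: by end_near. Qed.

Lemma heine (V W : normedModType R) (X : set V) (f : V -> W) (e : R) :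
  compact X -> continuous f -> 0 < e ->
  \forall N \near \oo, forall x y, X x -> `|y - x| <= N.+1%:R^-1 -> `|f x - f y| < e.
Proof.
move=> cX cf e0; apply: (compact_near_diagonal (P := fun _ x y => `|f x - f y| < e)) => // x0 _.
have e2 : 0 < e / 2 by rewrite divr_gt0.
have /cvgr_dist_lt/(_ _ e2)/near_right_ball near_close := cf x0.
near=> r; apply: nearW => _ x y xr yr.
have close z : `|z - x0| <= r -> `|f x0 - f z| < e / 2 by move: z; near: r.
rewrite (le_lt_trans (ler_distD (f x0) _ _)) // (splitr e) ltrD ?close //.
by rewrite distrC close.
Unshelve. all: by end_near. Qed.

Lemma segment_neq0 (V : normedModType R) (v w : V) (l t : R) :
  `|w - l *: v| < l * `|v| -> 0 <= t <= 1 -> (1 - t) *: v + t *: w != 0.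
Proof.
move=> wlv /andP[t0 t1]; apply/eqP => vw0.
have lv : 0 < l * `|v| := le_lt_trans (normr_ge0 _) wlv.
have v0 : 0 < `|v|.
  by rewrite normr_gt0; apply: contraTneq lv => ->; rewrite normr0 mulr0 ltxx.
have l0 : 0 < l by rewrite -(pmulr_lgt0 _ v0).
have vE : (1 - t + t * l) *: v = - (t *: (w - l *: v)).
  apply/eqP; rewrite -addr_eq0 -vw0; apply/eqP.
  by rewrite scalerDl scalerBr scalerA addrACA subrr addr0.
have := congr1 (fun u : V => `|u|) vE.
have coef_ge0 : 0 <= 1 - t + t * l.
  by apply: addr_ge0; [rewrite subr_ge0|rewrite mulr_ge0 // ltW].
rewrite normrN !normrZ (ger0_norm coef_ge0) (ger0_norm t0) => tE.
have : t * `|w - l *: v| <= t * (l * `|v|) by rewrite ler_wpM2l // ltW.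
rewrite -tE mulrDl -mulrA gerDr pmulr_lle0 // subr_le0 => t1'.
have tE1 : t = 1 by apply/le_anti; rewrite t1.
by move: tE; rewrite tE1 subrr add0r !mul1r => tE; rewrite -tE ltxx in wlv.
Qed.

Lemma rV_norm_leP n (x : 'rV[R]_n) (r : R) : 0 <= r ->
  (`|x| <= r) <-> (forall i, `|x ord0 i| <= r).
Proof.
move=> r0; rewrite [`|x|]mx_normrE; split=> [x_le i|x_le].
  by apply: le_trans x_le; apply: (le_bigmax _ (fun ij => `|x ij.1 ij.2|) (ord0, i)).
by apply/bigmax_leP; split=> //= -[i j] _ /=; rewrite ord1.
Qed.

Lemma rV_norm_ltP n (x : 'rV[R]_n) (r : R) : 0 < r ->
  (`|x| < r) <-> (forall i, `|x ord0 i| < r).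
Proof.
move=> r0; rewrite [`|x|]mx_normrE; split=> [x_lt i|x_lt].
  by apply: le_lt_trans x_lt; apply: (le_bigmax _ (fun ij => `|x ij.1 ij.2|) (ord0, i)).
by apply/bigmax_ltP; split=> //= -[i j] _ /=; rewrite ord1.
Qed.

Lemma coord_le_norm n (x : 'rV[R]_n) i : `|x ord0 i| <= `|x|.
Proof. exact: (rV_norm_leP x (normr_ge0 x)).1. Qed.

Lemma continuous_coord (T : topologicalType) n (f : T -> 'rV[R]_n) x i :
  {for x, continuous f} -> {for x, continuous (fun y => f y ord0 i)}.
Proof. by move=> cf; exact: continuous_comp cf (@coord_continuous R 1 n ord0 i (f x)). Qed.

Lemma continuous_rV (T : topologicalType) n (f : T -> 'rV[R]_n) x :
  (forall i, {for x, continuous (fun y => f y ord0 i)}) -> {for x, continuous f}.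
Proof.
move=> cf; apply/cvgrPdist_lt => e e0.
have : \forall y \near x, forall i, `|f x ord0 i - f y ord0 i| < e.
  by apply: filter_forall => i; have /cvgr_dist_lt/(_ _ e0) := cf i.
by apply: filterS => y fxy; apply/rV_norm_ltP => // i; rewrite !mxE; exact: fxy.
Qed.

Definition cube n (M : R) : set 'rV[R]_n := [set x | `|x| <= M].
Definition cube_boundary n (M : R) : set 'rV[R]_n := [set x | `|x| = M].

Lemma closed_norm_preimage (V : normedModType R) (p : V) (A : set R) :
  closed A -> closed [set x : V | A `|x - p|].
Proof.
move=> cA; apply: (preimage_closed _ cA) => x _.
by apply: cvg_norm; apply: cvgB; [exact: cvg_id|exact: cvg_cst].
Qed.

Lemma compact_sub_cube n (A : set 'rV[R]_n) M : closed A -> A `<=` cube M -> compact A.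
Proof.
move=> cA AM; apply: bounded_closed_compact => //.
exists M; split; first by rewrite num_real.
by move=> M' MM' x /AM/le_trans; apply; exact: ltW.
Qed.

Lemma closed_cube n M : closed (@cube n M).
Proof. by apply: (preimage_closed _ (@closed_le _ M)) => x _; exact: norm_continuous. Qed.

Lemma compact_cube n M : compact (@cube n M).
Proof. by apply: (@compact_sub_cube _ _ M) => //; exact: closed_cube. Qed.

Lemma compact_cube_boundary n M : compact (@cube_boundary n M).
Proof.
apply: (@compact_sub_cube _ _ M) => [|x]; last by rewrite /cube /= => ->.
by apply: (preimage_closed _ (@closed_eq _ M)) => x _; exact: norm_continuous.
Qed.

End NormedModules.

Section GridDegree.
Variables (R : realType) (m : nat).
Local Notation n := m.+1.
Local Notation V := 'rV[R]_n.
Implicit Types (phi psi : V -> V) (M N : nat) (d : int) (a : {ffun 'I_n -> nat}).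

Definition label (y : V) : 'I_n.+1 := first_false (fun i => 0 <= y ord0 i).

Lemma full_label_norm_lt (y : 'I_n.+1 -> V) (c : V) (d : R) :
  (forall k, `|c - y k| < d) -> (forall j, exists k, label (y k) = j) -> `|c| < d.
Proof.
move=> cy full; have d0 : 0 < d := le_lt_trans (normr_ge0 _) (cy ord0).
have {}cy k i : `|c ord0 i - y k ord0 i| < d.
  by have := (rV_norm_ltP _ d0).1 (cy k) i; rewrite !mxE.
apply/rV_norm_ltP => // i.
have [k /first_falseP[/(_ i (ltn_ord i)) yk_ge0 _]] := full ord_max.
have [k' /first_falseP[_ /(_ i erefl)]] := full (widen_ord (leqnSn n) i).
rewrite -ltNge => yk'_lt0.
have := cy k i; have := cy k' i; rewrite !ltr_norml; lra.
Qed.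

Definition grid_size M N : nat := 2 * M * N.+1.

Definition grid_point M N a : V :=
  \row_i ((a i)%:R / N.+1%:R - M%:R).

Lemma norm_grid_point M N a : (forall i, a i <= grid_size M N)%N ->
  `|grid_point M N a| <= M%:R.
Proof.
move=> aK; apply/rV_norm_leP => // i; rewrite mxE ler_norml.
have ai_ge0 : 0 <= (a i)%:R / N.+1%:R :> R by rewrite divr_ge0.
have ai_le : (a i)%:R / N.+1%:R <= 2 * M%:R :> R.
  by rewrite ler_pdivrMr // -!natrM ler_nat.
by move: ai_ge0 ai_le; set q := _ / _ => *; apply/andP; split; lra.
Qed.

Lemma norm_grid_point_boundary M N a : (forall i, a i <= grid_size M N)%N ->
  boundary_vertex (grid_size M N) a -> cube_boundary M%:R (grid_point M N a).
Proof.
move=> aK /existsP[j aj]; apply/eqP; rewrite eq_le norm_grid_point //=.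
apply: le_trans (coord_le_norm _ j); rewrite mxE; case/orP: aj => /eqP->.
  by rewrite mul0r sub0r normrN ger0_norm.
rewrite natrM mulfK ?pnatr_eq0 // natrM ger0_norm; last by have := ler0n R M; lra.
by lra.
Qed.

Lemma grid_point_dist M N a s k k' :
  `|grid_point M N (kuhn_vertex a s k) - grid_point M N (kuhn_vertex a s k')|
    <= N.+1%:R^-1.
Proof.
apply/rV_norm_leP => [|i]; first by rewrite invr_ge0.
rewrite !mxE !ffunE opprB addrA subrK -mulrBl normrM.
rewrite (ger0_norm (_ : 0 <= N.+1%:R^-1)) ?invr_ge0 // ler_piMl ?invr_ge0 //.
by case: (_ < k)%N; case: (_ < k')%N; rewrite ?addn0 ?addn1 -?natr1 ler_norml;
  apply/andP; split; lra.
Qed.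

Definition grid_label M N phi a : 'I_n.+1 :=
  label (phi (grid_point M N a)).

Definition grid_degree M N phi : int := kuhn_degree (grid_size M N) (grid_label M N phi).

Definition has_degree M phi d := \forall N \near \oo, grid_degree M N phi = d.

(* Relabelling the boundary vertices by [psi] destroys or creates no fully
   labelled simplex, and the degree only depends on the boundary labels. *)
Lemma grid_degree_step M N phi psi (e : R) :
  (forall x, cube_boundary M%:R x -> e <= `|phi x|) ->
  (forall x x', cube_boundary M%:R x -> `|x' - x| <= N.+1%:R^-1 ->
     `|phi x - phi x'| < e /\ `|phi x - psi x'| < e) ->
  grid_degree M N phi = grid_degree M N psi.
Proof.
move=> phi_ge close; set K := grid_size M N.
pose L a := grid_label M N (if boundary_vertex K a then psi else phi) a.
transitivity (kuhn_degree K L); last first.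
  by apply: kuhn_degree_boundary => a aK; rewrite /L aK.
apply: eq_bigr => a _; apply: eq_bigr => s _; congr (_ * _).
set v := fun k : 'I_n.+1 => kuhn_vertex [ffun i => val (a i)] s k.
case: (boolP [exists k, boundary_vertex K (v k)]) => [/existsP[k0 k0_bd]|/existsPn inner];
    last by apply: eq_label_sign => k; rewrite /L (negPf (inner k)).
have vk0M : cube_boundary M%:R (grid_point M N (v k0)).
  apply: norm_grid_point_boundary k0_bd.
  by apply: kuhn_vertex_le => i; rewrite ffunE ltn_ord.
have not_full (f : {ffun 'I_n -> nat} -> V -> V) : (forall b, f b = phi \/ f b = psi) ->
    label_sign (fun k => grid_label M N (f (v k)) (v k)) = 0.
  move=> fP; apply/eqP/negPn/negP => /label_sign_surj full.
  have : `|phi (grid_point M N (v k0))| < e.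
    apply: full_label_norm_lt full => k.
    have [] := close _ (grid_point M N (v k)) vk0M (grid_point_dist _ _ _ _ _ _).
    by case: (fP (v k)) => ->.
  by rewrite ltNge phi_ge.
rewrite (not_full (fun=> phi)); last by left.
by rewrite -[LHS](not_full (fun b => if boundary_vertex K b then psi else phi)) // => b;
  case: ifP; auto.
Qed.

Lemma has_degree_homotopy M (H : V * R -> V) d : continuous H ->
  (forall x (t : R), cube_boundary M%:R x -> 0 <= t <= 1 -> H (x, t) != 0) ->
  has_degree M (fun x => H (x, 0)) d -> has_degree M (fun x => H (x, 1)) d.
Proof.
move=> cH H_neq0 H0_deg; pose X : set (V * R) := cube_boundary M%:R `*` `[0, 1].
have cX : compact X.
  by apply: compact_setX; [exact: compact_cube_boundary|exact: segment_compact].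
have [e e0 H_ge] : exists2 e : R, 0 < e & forall p, X p -> e <= `|H p|.
  apply: compact_norm_lbound => // -[x t] [/= xM].
  by rewrite in_itv /=; exact: H_neq0.
have H_heine := heine cX cH e0.
rewrite /has_degree; near=> N.
have H_unif p q : X p -> `|q - p| <= N.+1%:R^-1 -> `|H p - H q| < e.
  by move: p q; near: N.
have <- : grid_degree M N (fun x => H (x, 0)) = d by near: N.
pose time j : R := j%:R / N.+1%:R.
suff H_time j : (j <= N.+1)%N ->
    grid_degree M N (fun x => H (x, time j)) = grid_degree M N (fun x => H (x, 0)).
  have <- : time N.+1 = 1 by rewrite /time divff ?pnatr_eq0.
  exact: H_time.
elim: j => [|j IH] jN; first by rewrite /time mul0r.
have time_in : `[0, 1]%classic (time j).
  by rewrite /= in_itv /= divr_ge0 //= ler_pdivrMr // mul1r ler_nat ltnW.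
rewrite -(IH (ltnW jN)); apply/esym/(@grid_degree_step _ _ _ _ e) => [x xM|x x' xM xx'].
  exact: H_ge.
have time_step : `|time j.+1 - time j| <= N.+1%:R^-1.
  by rewrite -mulrBl -natr1 addrC addKr mul1r ger0_norm ?invr_ge0.
have Xx : X (x, time j) by split.
by split; apply: (H_unif _ _ Xx); rewrite prod_normE /= ge_max xx' ?time_step
  ?subrr ?normr0 ?invr_ge0 ?ler0n.
Unshelve. all: by end_near. Qed.

Lemma has_degree_segment M phi psi d : continuous phi -> continuous psi ->
  (forall x (t : R), cube_boundary M%:R x -> 0 <= t <= 1 -> (1 - t) *: phi x + t *: psi x != 0) ->
  has_degree M phi d -> has_degree M psi d.
Proof.
move=> cphi cpsi seg_neq0 phi_deg.
pose H (p : V * R) := (1 - p.2) *: phi p.1 + p.2 *: psi p.1.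
have cH : continuous H.
  move=> p; apply: cvgD; apply: cvgZ.
  - by apply: cvgB; [exact: cvg_cst|exact: cvg_snd].
  - by apply: continuous_comp; [exact: cvg_fst|exact: cphi].
  - exact: cvg_snd.
  - by apply: continuous_comp; [exact: cvg_fst|exact: cpsi].
have -> : psi = fun x => H (x, 1).
  by apply/funext => x; rewrite /H /= subrr scale0r scale1r add0r.
apply: has_degree_homotopy => //.
have -> // : (fun x => H (x, 0)) = phi.
by apply/funext => x; rewrite /H /= subr0 scale0r scale1r addr0.
Qed.

Lemma has_degree_rouche M phi psi (l : V -> R) d : continuous phi -> continuous psi ->
  (forall x, cube_boundary M%:R x -> `|psi x - l x *: phi x| < l x * `|phi x|) ->
  has_degree M phi d -> has_degree M psi d.
Proof.
move=> cphi cpsi close; apply: has_degree_segment => // x t /close.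
exact: segment_neq0.
Qed.

Lemma has_degree_unique M phi d d' : has_degree M phi d -> has_degree M phi d' -> d = d'.
Proof.
move=> phi_d phi_d'; have [N [<- <-//]] : exists N, grid_degree M N phi = d /\
    grid_degree M N phi = d'.
  by near \oo => N; exists N; split; near: N.
Unshelve. all: by end_near. Qed.

End GridDegree.

Arguments grid_point {R m} M N a.

Lemma near_right_separated (R : realType) (V : normedModType R) (ps : seq V) :
  \forall r \near 0^'+, forall p, p \in ps -> forall p', p' \in ps ->
    p != p' -> r <= `|p' - p|.
Proof.
apply: near_seq => p _; apply: near_seq => p' _.
have [->|pp'] := eqVneq p p'; first by near=> r.
by near=> r => _; near: r; apply: nbhs_right_le; rewrite normr_gt0 subr_eq0 eq_sym.
Unshelve. all: by end_near. Qed.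

Section Additivity.
Variables (R : realType) (m : nat).
Local Notation n := m.+1.
Local Notation V := 'rV[R]_n.
Implicit Types (phi psi : V -> V) (ps : seq V) (M N : nat) (a : {ffun 'I_n -> nat}).

Lemma cell_sign_neq0_near_zero phi (X : set V) M : compact X -> continuous phi ->
  (forall x, X x -> phi x != 0) ->
  \forall N \near \oo, forall a, X (grid_point M N a) -> cell_sign (grid_label M N phi) a = 0.
Proof.
move=> cX cphi phi_neq0.
have [e e0 phi_ge] := compact_norm_lbound cX cphi phi_neq0.
have phi_heine := heine cX cphi e0.
near=> N => a Xa; apply: cell_sign_eq0 => s full.
suff : `|phi (grid_point M N a)| < e by rewrite ltNge phi_ge.
apply: full_label_norm_lt full => k.
have phi_unif x y : X x -> `|y - x| <= N.+1%:R^-1 -> `|phi x - phi y| < e.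
  by move: x y; near: N.
by apply: phi_unif => //; rewrite -{2}(kuhn_vertex0 a s); exact: grid_point_dist.
Unshelve. all: by end_near. Qed.

Definition away M ps (r : R) : set V :=
  cube M%:R `&` \bigcap_(p in [set` ps]) [set x | r <= `|x - p|].

Lemma compact_away M ps r : compact (away M ps r).
Proof.
apply: (@compact_sub_cube _ _ _ M%:R) => [|x []//].
apply: closedI; first exact: closed_cube.
apply: closed_bigI => p _.
exact: closed_norm_preimage (@closed_ge _ r).
Qed.

Lemma cell_sign_away phi ps M r : continuous phi -> 0 < r ->
  (forall x, `|x| <= M%:R -> phi x = 0 -> x \in ps) ->
  \forall N \near \oo, forall a, away M ps r (grid_point M N a) ->
    cell_sign (grid_label M N phi) a = 0.
Proof.
move=> cphi r0 phi_zeros; apply: cell_sign_neq0_near_zero => //; first exact: compact_away.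
move=> x [xM x_far]; apply/eqP => /(phi_zeros x xM) x_ps.
by have := x_far x x_ps; rewrite /= subrr normr0 leNgt r0.
Qed.

Lemma eq_cell_sign phi psi p (r : R) M N a :
  (forall x, `|x - p| <= r -> phi x = psi x) ->
  N.+1%:R^-1 < r / 2 -> `|grid_point M N a - p| < r / 2 ->
  cell_sign (grid_label M N phi) a = cell_sign (grid_label M N psi) a.
Proof.
move=> phi_psi Nr ar; apply: eq_bigr => s _; congr (_ * _).
apply: eq_label_sign => k; congr label; apply/phi_psi/ltW.
rewrite (le_lt_trans (ler_distD (grid_point M N a) _ _)) // (splitr r) ltrD //.
by apply: le_lt_trans Nr; rewrite -{2}(kuhn_vertex0 a s); exact: grid_point_dist.
Qed.

Lemma cell_sign_sum phi ps (f : V -> V -> V) (r : R) M N a : uniq ps ->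
  (forall p, p \in ps -> forall p', p' \in ps -> p != p' -> r <= `|p' - p|) ->
  (forall p, p \in ps -> forall x, `|x - p| <= r -> phi x = f p x) ->
  N.+1%:R^-1 < r / 2 -> `|grid_point M N a : V| <= M%:R ->
  (away M ps (r / 2) (grid_point M N a) -> cell_sign (grid_label M N phi) a = 0) ->
  (forall p, p \in ps -> away M [:: p] (r / 2) (grid_point M N a) ->
     cell_sign (grid_label M N (f p)) a = 0) ->
  cell_sign (grid_label M N phi) a = \sum_(p <- ps) cell_sign (grid_label M N (f p)) a.
Proof.
move=> ps_uniq ps_sep phi_f Nr aM phi_away f_away.
have away1 p : r / 2 <= `|grid_point M N a - p| -> away M [:: p] (r / 2) (grid_point M N a).
  by move=> ap; split => // q /=; rewrite inE => /eqP->.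
have [/hasP[p pps pa]|/hasPn far] := boolP (has (fun p => `|grid_point M N a - p| < r / 2) ps).
  rewrite (bigD1_seq p) //= big_seq_cond big1 ?addr0 => [|p' /andP[p'ps p'p]].
    exact: eq_cell_sign (phi_f p pps) Nr pa.
  apply: f_away => //; apply: away1.
  have := le_trans (ps_sep _ pps _ p'ps _) (ler_distD (grid_point M N a) _ _).
  rewrite eq_sym => /(_ p'p); rewrite (distrC p').
  by move: pa; set u := `|_ - p|; set v := `|_ - p'|; lra.
rewrite phi_away => [|]; last by split => // p /= /far; rewrite -leNgt.
by rewrite big_seq big1 // => p pps; apply: f_away => //; apply: away1; rewrite leNgt far.
Qed.

Lemma has_degree_sum M phi ps (f : V -> V -> V) (dg : V -> int) :
  continuous phi -> uniq ps -> (forall x, `|x| <= M%:R -> phi x = 0 -> x \in ps) ->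
  (forall p, p \in ps -> [/\ continuous (f p), forall x, f p x = 0 -> x = p,
     \forall x \near p, phi x = f p x & has_degree M (f p) (dg p)]) ->
  has_degree M phi (\sum_(p <- ps) dg p).
Proof.
move=> cphi ps_uniq phi_zeros fP.
have phi_f_near : \forall r \near 0^'+, forall p, p \in ps ->
    forall x, `|x - p| <= r -> phi x = f p x.
  by apply: near_seq => p /fP[_ _ phi_f _]; exact: near_right_ball.
near (0 : R)^'+ => r; have r2 : 0 < r / 2 by rewrite divr_gt0.
have phi_f p : p \in ps -> forall x, `|x - p| <= r -> phi x = f p x by move: p; near: r.
have ps_sep p : p \in ps -> forall p', p' \in ps -> p != p' -> r <= `|p' - p|.
  by move: p; near: r; exact: near_right_separated.
have f_away_near : \forall N \near \oo, forall p, p \in ps -> forall a,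
    away M [:: p] (r / 2) (grid_point M N a) -> cell_sign (grid_label M N (f p)) a = 0.
  apply: near_seq => p /fP[cf f_zero _ _]; apply: cell_sign_away => // x _ /f_zero->.
  exact: mem_head.
have f_deg : \forall N \near \oo, forall p, p \in ps -> grid_degree M N (f p) = dg p.
  by apply: near_seq => p /fP[].
have phi_away_near := cell_sign_away cphi r2 phi_zeros.
rewrite /has_degree; near=> N.
rewrite [RHS](eq_big_seq (fun p => grid_degree M N (f p))) => [|p pps]; last first.
  by apply/esym; move: p pps; near: N.
rewrite /grid_degree /kuhn_degree [RHS]exchange_big /=; apply: eq_bigr => a _.
apply: (cell_sign_sum (r := r)) => //.
- by near: N; exact: near_natSinv_lt.
- by apply: norm_grid_point => i; rewrite ffunE ltnW ?ltn_ord.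
- by move: [ffun i => val (a i)]; near: N.
- by move=> p pps; move: p pps [ffun i => val (a i)]; near: N.
Unshelve. all: by end_near. Qed.

Section Retraction.
Variable nu : V -> R.
Hypothesis continuous_nu : continuous nu.
Hypothesis nuZ : forall c x, nu (c *: x) = `|c| * nu x.

Definition retraction (p : V) (r : R) (x : V) : V :=
  p + (r / Num.max r (nu (x - p))) *: (x - p).

Lemma nu_sub_center (p : V) : nu (p - p) = 0.
Proof. by rewrite subrr -(scale0r 0) nuZ normr0 mul0r. Qed.

Lemma retraction_subE p r x : retraction p r x - p = (r / Num.max r (nu (x - p))) *: (x - p).
Proof. by rewrite /retraction addrC addKr. Qed.

Lemma retraction_coef_gt0 p r x : 0 < r -> 0 < r / Num.max r (nu (x - p)).
Proof. by move=> r0; rewrite divr_gt0 // lt_max r0. Qed.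

Lemma continuous_retraction p r : 0 < r -> continuous (retraction p r).
Proof.
move=> r0 x; have cxp : (fun y : V => y - p) @ x --> x - p.
  exact: (cvgB cvg_id (cvg_cst p)).
have nu_cvg : nu (y - p) @[y --> x] --> nu (x - p) by exact: cvg_comp cxp (@continuous_nu _).
have max_neq0 : Num.max r (nu (x - p)) != 0 by rewrite gt_eqF // lt_max r0.
have max_cvg : Num.max r (nu (y - p)) @[y --> x] --> Num.max r (nu (x - p)).
  exact: (continuous_max (cvg_cst r) nu_cvg).
have coef_cvg : r / Num.max r (nu (y - p)) @[y --> x] --> r / Num.max r (nu (x - p)).
  exact: (cvgM (cvg_cst r) (cvgV max_neq0 max_cvg)).
exact: (cvgD (cvg_cst p) (cvgZ coef_cvg cxp)).
Qed.

Lemma nu_retraction_le p r x : 0 < r -> nu (retraction p r x - p) <= r.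
Proof.
move=> r0; rewrite retraction_subE nuZ gtr0_norm ?retraction_coef_gt0 //.
by rewrite mulrAC ler_pdivrMr ?lt_max ?r0 // ler_pM2l // le_max lexx orbT.
Qed.

Lemma retraction_id p r x : 0 < r -> nu (x - p) <= r -> retraction p r x = x.
Proof.
move=> r0 xr; rewrite /retraction max_l // divff ?gt_eqF // scale1r.
by rewrite addrC subrK.
Qed.

Lemma near_retraction_id p r : 0 < r -> \forall x \near p, retraction p r x = x.
Proof.
move=> r0; near=> x; apply: retraction_id => //.
near: x; apply: (@cvgr_le _ _ _ _ (fun x => nu (x - p)) (nu (p - p))).
  apply: continuous_comp; last exact: continuous_nu.
  exact: (cvgB cvg_id (cvg_cst p)).
by rewrite nu_sub_center.
Unshelve. all: by end_near. Qed.

Lemma retraction_eq_center p r x : 0 < r -> retraction p r x = p -> x = p.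
Proof.
move=> r0 /eqP; rewrite -subr_eq0 retraction_subE scaler_eq0.
by rewrite gt_eqF ?retraction_coef_gt0 //= subr_eq0 => /eqP.
Qed.

Lemma has_degree_sum_retraction M phi ps (eps : V -> R) (dg : V -> int) :
  continuous phi -> uniq ps -> (forall x, `|x| <= M%:R -> phi x = 0 -> x \in ps) ->
  (forall p, p \in ps -> [/\ 0 < eps p,
     forall x, nu (x - p) <= eps p -> phi x = 0 -> x = p &
     has_degree M (phi \o retraction p (eps p)) (dg p)]) ->
  has_degree M phi (\sum_(p <- ps) dg p).
Proof.
move=> cphi ps_uniq phi_zeros ps_eps.
apply: (has_degree_sum (f := fun p => phi \o retraction p (eps p)) cphi ps_uniq phi_zeros) => p.
move=> /ps_eps[e0 p_zero p_deg].
split; [move=> x|move=> x /(p_zero _ (nu_retraction_le p x e0))| |exact: p_deg].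
- by apply: continuous_comp; [exact: continuous_retraction|exact: cphi].
- exact: retraction_eq_center.
- by near=> x; congr phi; apply/esym; near: x; exact: near_retraction_id.
Unshelve. all: by end_near. Qed.

End Retraction.

End Additivity.

(** * Regular zeros *)

Section Determinants.
Variables (F : fieldType) (n : nat).
Implicit Types A : 'M[F]_n.

Lemma mulmx_det_eq0 k (x : 'M[F]_(k, n)) A : \det A != 0 -> (x *m A == 0) = (x == 0).
Proof. by move=> A0; rewrite mulmx_free_eq0 // row_free_unit unitmxE unitfE. Qed.

Lemma det_neq0_inj A : (forall x : 'rV[F]_n, x *m A = 0 -> x = 0) -> \det A != 0.
Proof. by move=> A_inj; apply/det0P => -[x x0 /A_inj xE]; rewrite xE eqxx in x0. Qed.

Lemma det_utrig A : is_trig_mx A^T -> \det A = \prod_i A i i.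
Proof. by move=> A_trig; rewrite -det_tr det_trig //; apply: eq_bigr => i _; rewrite mxE. Qed.

Lemma det_unitrig A : (forall i j : 'I_n, (i <= j)%N -> A i j = (i == j)%:R) -> \det A = 1.
Proof.
move=> A_unitrig; rewrite det_trig => [|].
  by rewrite big1 // => i _; rewrite A_unitrig // eqxx.
by apply/is_trig_mxP => i j ij; rewrite A_unitrig 1?ltnW // -val_eqE /= ltn_eqF.
Qed.

End Determinants.

Section LinearDegree.
Variables (R : realType) (m : nat).
Local Notation n := m.+2.
Local Notation V := 'rV[R]_n.
Implicit Types (A B E : 'M[R]_n) (p x : V) (t : R).

Lemma continuous_mulmx B : continuous (fun x : V => x *m B).
Proof.
move=> x; apply: continuous_rV => j.
have -> : (fun y : V => (y *m B) ord0 j) = (fun y => \sum_i y ord0 i * B i j).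
  by apply/funext => y; rewrite mxE.
apply: (@continuous_big _ _ +%R 0 xpredT add_continuous _ _ (fun i (y : V) => y ord0 i * B i j)).
by move=> i _ y; exact: (cvgM (@coord_continuous R 1 n ord0 i y) (cvg_cst _)).
Qed.

Lemma continuous_affine p B : continuous (fun x : V => (x - p) *m B).
Proof.
move=> x; exact: cvg_comp (cvgB cvg_id (cvg_cst p)) (@continuous_mulmx B _).
Qed.

Variable M : nat.
Hypothesis M_gt0 : (0 < M)%N.

Lemma cube_boundary_neq0 x : cube_boundary M%:R x -> x != 0.
Proof.
rewrite /cube_boundary /= => xM; rewrite -normr_eq0 xM pnatr_eq0 -lt0n //.
Qed.

Definition has_det_degree B := has_degree M (fun x : V => x *m B) (sgz (\det B)).

Lemma has_det_degree1 : has_det_degree 1%:M.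
Proof.
apply: nearW => N; rewrite det1 sgz1 -(@kuhn_degree_threshold m.+1 (grid_size M N) (M * N.+1)).
  apply: eq_kuhn_degree => a _; apply: eq_first_false => i.
  by rewrite mulmx1 mxE subr_ge0 ler_pdivlMr // -natrM ler_nat.
by rewrite muln_gt0 M_gt0 /= /grid_size -mulnA leq_pmull.
Qed.

Lemma has_det_degree_perm s B : has_det_degree B -> has_det_degree (perm_mx s *m B).
Proof.
apply: filterS => N; rewrite det_mulmx det_perm sgzM.
have -> : sgz ((-1) ^+ (s : bool) : R) = (-1) ^+ s.
  by case: (odd_perm s); rewrite ?expr1 ?expr0 ?sgzN ?sgz1.
move=> <-; rewrite -odd_permV -kuhn_degree_perm; apply: eq_kuhn_degree => a _.
congr label; rewrite mulmxA; congr (_ *m _).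
by rewrite -{1}(invgK s) -col_permE; apply/rowP => j; rewrite !mxE ffunE.
Qed.

Lemma has_det_degree_segment E E' B : \det B != 0 ->
  (forall t, 0 <= t <= 1 -> \det ((1 - t) *: E + t *: E') != 0) ->
  sgz (\det E) = sgz (\det E') -> has_det_degree (E *m B) -> has_det_degree (E' *m B).
Proof.
move=> B0 seg_det sgE; rewrite /has_det_degree !det_mulmx !sgzM sgE.
apply: has_degree_segment; try exact: continuous_mulmx.
move=> x t /cube_boundary_neq0 x0 /seg_det seg_t.
have -> : (1 - t) *: (x *m (E *m B)) + t *: (x *m (E' *m B)) =
    x *m (((1 - t) *: E + t *: E') *m B).
  by rewrite mulmxDl mulmxDr -!scalemxAl -!scalemxAr.
by rewrite mulmx_det_eq0 // det_mulmx mulf_neq0.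
Qed.

Definition reflection_mx (l : seq 'I_n) : 'M[R]_n := diag_mx (\row_i (-1) ^+ (i \in l)).

Lemma det_reflection_mx l : \det (reflection_mx l) = \prod_i (-1) ^+ (i \in l).
Proof. by rewrite det_diag; apply: eq_bigr => i _; rewrite mxE. Qed.

Lemma det_reflection_mx_neq0 l : \det (reflection_mx l) != 0.
Proof. by rewrite det_reflection_mx; apply/prodf_neq0 => i _; rewrite signr_eq0. Qed.

Lemma det_reflection_mx1 j : \det (reflection_mx [:: j]) = -1.
Proof.
rewrite det_reflection_mx (bigD1 j) //= big1 ?mulr1 ?mem_head // => i ij.
by rewrite inE (negPf ij).
Qed.

Lemma reflection_mx_cons j l :
  j \notin l -> reflection_mx (j :: l) = reflection_mx [:: j] *m reflection_mx l.
Proof.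
move=> jl; rewrite /reflection_mx mulmx_diag; congr diag_mx; apply/rowP => i.
rewrite !mxE !inE; have [->|_] := eqVneq i j; last by rewrite mul1r.
by rewrite (negPf jl) mulr1.
Qed.

Lemma det_tperm_reflection_segment i j t : i != j ->
  \det ((1 - t) *: tperm_mx i j + t *: reflection_mx [:: j]) != 0.
Proof.
move=> ij; apply: det_neq0_inj => x /rowP xE.
have {}xE k : (1 - t) * x ord0 (tperm i j k) + t * (x ord0 k * (-1) ^+ (k == j)) = 0.
  have tpermE : tperm_mx i j = perm_mx (tperm i j)^-1 :> 'M[R]_n by rewrite tpermV.
  transitivity ((x *m ((1 - t) *: tperm_mx i j + t *: reflection_mx [:: j])) ord0 k).
    by rewrite mulmxDr -!scalemxAr mul_mx_diag tpermE -col_permE !mxE inE.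
  by rewrite xE mxE.
have := xE i; rewrite tpermL (negPf ij) expr0 mulr1 => xi_eq.
have := xE j; rewrite tpermR eqxx expr1 mulrN1 => xj_eq.
have sq_gt0 : (1 - t) ^+ 2 + t ^+ 2 != 0.
  rewrite paddr_eq0 ?sqr_ge0 // !sqrf_eq0 subr_eq0.
  by apply/negP => /andP[/eqP<-]; rewrite oner_eq0.
have xi : x ord0 i = 0.
  apply: (mulfI sq_gt0); rewrite mulr0.
  transitivity (t * ((1 - t) * x ord0 j + t * x ord0 i) +
    (1 - t) * ((1 - t) * x ord0 i + t * - x ord0 j)); first by ring.
  by rewrite xi_eq xj_eq !mulr0 addr0.
have xj : x ord0 j = 0.
  apply: (mulfI sq_gt0); rewrite mulr0.
  transitivity ((1 - t) * ((1 - t) * x ord0 j + t * x ord0 i) -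
    t * ((1 - t) * x ord0 i + t * - x ord0 j)); first by ring.
  by rewrite xi_eq xj_eq !mulr0 subr0.
apply/rowP => k; rewrite mxE; have [->//|ki] := eqVneq k i; have [->//|kj] := eqVneq k j.
have := xE k; rewrite (negPf kj) expr0 mulr1 tpermD 1?eq_sym //.
by rewrite -mulrDl subrK mul1r.
Qed.

Lemma has_det_degree_reflection1 j B :
  \det B != 0 -> has_det_degree B -> has_det_degree (reflection_mx [:: j] *m B).
Proof.
move=> B0 degB; have [i ij] : exists i : 'I_n, i != j.
  by exists (if j == 0 then 1 else 0); case: (eqVneq j 0) => [->|//]; rewrite eq_sym.
apply: (@has_det_degree_segment (tperm_mx i j)) => //; last exact: has_det_degree_perm.
  by move=> t _; exact: det_tperm_reflection_segment.
by rewrite det_reflection_mx1 det_perm odd_tperm ij expr1.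
Qed.

Lemma has_det_degree_reflection l : uniq l -> has_det_degree (reflection_mx l).
Proof.
elim: l => [_|j l IH /= /andP[jl l_uniq]].
  suff -> : reflection_mx [::] = 1%:M by exact: has_det_degree1.
  by apply/matrixP => i j; rewrite !mxE.
rewrite reflection_mx_cons //; apply: has_det_degree_reflection1; last exact: IH.
exact: det_reflection_mx_neq0.
Qed.

Lemma has_det_degree_utrig A : is_trig_mx A^T -> \det A != 0 -> has_det_degree A.
Proof.
move=> A_trig A0; pose l := [seq i <- enum 'I_n | A i i < 0].
have Aii i : A i i != 0.
  by move: A0; rewrite det_utrig // => /prodf_neq0/(_ i isT).
have lE i : (i \in l) = (A i i < 0) by rewrite mem_filter mem_enum andbT.
rewrite -[A]mulmx1; apply: (@has_det_degree_segment (reflection_mx l)).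
- by rewrite det1 oner_eq0.
- move=> t /andP[t0 t1]; rewrite det_utrig => [|].
    apply/prodf_neq0 => i _; rewrite !mxE eqxx mulr1n lE.
    case: ltgtP (Aii i) => // Ai _; rewrite ?expr1 ?expr0.
      by rewrite lt_eqF //; nra.
    by rewrite gt_eqF //; nra.
  apply/is_trig_mxP => i j ij; have /is_trig_mxP/(_ i j ij) := A_trig.
  by rewrite !mxE => ->; rewrite mulr0 addr0 -val_eqE gtn_eqF // mulr0n mulr0.
- rewrite det_reflection_mx det_utrig //.
  apply: (big_ind2 (fun x y : R => sgz x = sgz y)) => // [x1 x2 y1 y2 xE yE|i _].
    by rewrite !sgzM xE yE.
  rewrite lE; case: ltgtP (Aii i) => // Ai _; first by rewrite expr1 sgzN1 ltr0_sgz.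
  by rewrite expr0 sgz1 gtr0_sgz.
- by rewrite mulmx1; apply: has_det_degree_reflection; rewrite filter_uniq // enum_uniq.
Qed.

Lemma has_det_degree_unit A : \det A != 0 -> has_det_degree A.
Proof.
move=> A0.
have := cormen_lup_correct A; have := cormen_lup_perm A; have := cormen_lup_detL A.
have := @cormen_lup_lower _ _ A; have := @cormen_lup_upper _ _ A.
case: (cormen_lup A) => [[P L] U] /= U_upper L_lower detL /is_perm_mxP[s ->] PA.
have AE : A = perm_mx s^-1 *m (L *m U).
  by rewrite -[L *m U]PA mulmxA -perm_mxM mulVg perm_mx1 mul1mx.
have U0 : \det U != 0.
  by move: A0; rewrite AE !det_mulmx detL mul1r mulf_eq0 negb_or => /andP[].
rewrite AE; apply: has_det_degree_perm.
apply: (@has_det_degree_segment 1%:M) => // [t _||].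
- rewrite det_unitrig ?oner_eq0 // => i j ij.
  by rewrite !mxE L_lower // -mulrDl subrK mul1r.
- by rewrite det1 detL.
rewrite mul1mx; apply: has_det_degree_utrig => //.
by apply/is_trig_mxP => i j ij; rewrite mxE U_upper.
Qed.

Lemma has_degree_affine A p : \det A != 0 -> `|p| < M%:R ->
  has_degree M (fun x : V => (x - p) *m A) (sgz (\det A)).
Proof.
move=> A0 pM; apply: has_degree_segment (has_det_degree_unit A0).
- exact: continuous_mulmx.
- exact: continuous_affine.
move=> x t xM /andP[t0 t1].
have -> : (1 - t) *: (x *m A) + t *: ((x - p) *m A) = (x - t *: p) *m A.
  by rewrite !mulmxBl scalerBr -scalemxAl addrA -scalerDl subrK scale1r.
rewrite mulmx_det_eq0 // subr_eq0; apply/eqP => xE.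
have : t * `|p| <= `|p| by rewrite ler_piMl.
by rewrite -[t in t * _]ger0_norm // -normrZ -xE xM leNgt pM.
Qed.

End LinearDegree.

Section RegularZeros.
Variables (R : realType) (m : nat).
Local Notation n := m.+2.
Local Notation V := 'rV[R]_n.
Implicit Types (A : 'M[R]_n) (p x : V) (phi : V -> V).

Lemma mulmx_norm_lbound A : \det A != 0 ->
  exists2 c, 0 < c & forall x : V, c * `|x| <= `|x *m A|.
Proof.
move=> A0; have [|c c0 cP] :=
  compact_norm_lbound (@compact_cube_boundary R n 1) (@continuous_mulmx R m A).
  move=> x x1; rewrite mulmx_det_eq0 // -normr_eq0.
  by move: x1; rewrite /cube_boundary /= => ->; rewrite oner_eq0.
exists c => // x; have [->|x0] := eqVneq x 0; first by rewrite mul0mx !normr0 mulr0.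
have nx : 0 < `|x| by rewrite normr_gt0.
have := cP (`|x|^-1 *: x); rewrite /cube_boundary /= -scalemxAl !normrZ normfV normr_id.
by rewrite mulVf ?gt_eqF // => /(_ erefl); rewrite ler_pdivlMl // mulrC.
Qed.

Lemma near_jacobian_approx phi p : phi p = 0 -> differentiable phi p ->
  \det ('J phi p) != 0 -> \forall r \near 0^'+, forall x, `|x - p| <= r -> x != p ->
  `|phi x - (x - p) *m 'J phi p| < `|(x - p) *m 'J phi p|.
Proof.
move=> phip0 dphi J0; have [c c0 cP] := mulmx_norm_lbound J0.
have c2 : 0 < c / 2 by rewrite divr_gt0.
have /diff_locally/eqaddoP/(_ _ c2)/near_right_ball phi_approx := dphi.
near=> r => x xr xp; have xp0 : 0 < `|x - p| by rewrite normr_gt0 subr_eq0.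
have approx h : `|h - 0| <= r -> `|(phi \o shift p - (cst (phi p) + 'd phi p)) h| <= c / 2 * `|h|.
  by move: h; near: r.
have := approx (x - p); rewrite subr0 => /(_ xr) /=.
rewrite !fctE /= subrK phip0 add0r /jacobian mul_rV_lin1 => /le_lt_trans; apply.
apply: lt_le_trans (_ : c * `|x - p| <= _).
  by rewrite ltr_pM2r // ltr_pdivrMr // ltr_pMr // ltr1n.
by have := cP (x - p); rewrite /jacobian mul_rV_lin1.
Unshelve. all: by end_near. Qed.

Lemma has_degree_local_affine M phi p (r : R) A : continuous phi -> 0 < r -> `|p| < M%:R ->
  \det A != 0 ->
  (forall x, `|x - p| <= r -> x != p -> `|phi x - (x - p) *m A| < `|(x - p) *m A|) ->
  has_degree M (phi \o retraction (fun y : V => `|y|) p r) (sgz (\det A)).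
Proof.
move=> cphi r0 pM A0 close.
have M0 : (0 < M)%N by rewrite -(ltr_nat R) (le_lt_trans _ pM).
pose l x : R := r / Num.max r `|x - p|.
apply: (has_degree_rouche (l := l) _ _ _ (has_degree_affine M0 A0 pM)).
- exact: continuous_affine.
- move=> x; apply: continuous_comp; last exact: cphi.
  exact: (continuous_retraction (@norm_continuous R V) r0).
move=> x xM; have l0 : 0 < l x by rewrite divr_gt0 // lt_max r0.
have retr_le : `|retraction (fun y : V => `|y|) p r x - p| <= r.
  by apply: nu_retraction_le => // c y; exact: normrZ.
have retr_neq : retraction (fun y : V => `|y|) p r x != p.
  by apply: contraTneq pM => /(retraction_eq_center r0) xp; rewrite -xp xM ltxx.
have := close _ retr_le retr_neq.
by rewrite retraction_subE -/(l x) -scalemxAl normrZ gtr0_norm.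
Qed.

Lemma has_degree_regular M phi (ps : seq V) : continuous phi -> uniq ps ->
  (forall x, `|x| <= M%:R -> phi x = 0 -> x \in ps) ->
  (forall p, p \in ps -> [/\ `|p| < M%:R, phi p = 0, differentiable phi p &
     \det ('J phi p) != 0]) ->
  has_degree M phi (\sum_(p <- ps) sgz (\det ('J phi p))).
Proof.
move=> cphi ps_uniq phi_zeros ps_reg.
have approx_near : \forall r \near 0^'+, forall p, p \in ps -> forall x, `|x - p| <= r -> x != p ->
    `|phi x - (x - p) *m 'J phi p| < `|(x - p) *m 'J phi p|.
  by apply: near_seq => p /ps_reg[_ ? ? ?]; exact: near_jacobian_approx.
near (0 : R)^'+ => r; have r0 : 0 < r by [].
have approx p : p \in ps -> forall x, `|x - p| <= r -> x != p ->
    `|phi x - (x - p) *m 'J phi p| < `|(x - p) *m 'J phi p| by move: p; near: r.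
apply: (has_degree_sum_retraction (@norm_continuous R V) (@normrZ R V) (eps := fun=> r)) => //.
move=> p pps; have [pM phip0 dphi J0] := ps_reg p pps; split => // [x xr phix0|].
  apply/eqP; apply: contraT => /(approx p pps x xr).
  by rewrite phix0 sub0r normrN ltxx.
exact: has_degree_local_affine (approx p pps).
Unshelve. all: by end_near. Qed.

End RegularZeros.

(** * Continuously differentiable functions *)

Section C1.
Variable R : realType.

(* Directional continuity of the differential is the right notion only for a
   finite-dimensional [V]. *)
Definition C1 (V W : normedModType R) (f : V -> W) (x : V) :=
  (\forall y \near x, differentiable f y) /\ forall v, {for x, continuous (fun y => 'd f y v)}.

Section Basic.
Variables V W : normedModType R.
Implicit Types (f g : V -> W) (x : V).

Lemma C1_is_diff f (df : V -> V -> W) x :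
  (\forall y \near x, is_diff y f (df y)) -> (forall v, {for x, continuous (df ^~ v)}) -> C1 f x.
Proof.
move=> f_diff df_cont; split; first by apply: filterS f_diff => y [].
move=> v; have df_eq : \forall y \near x, df y v = 'd f y v.
  by apply: filterS f_diff => y [_ ->].
rewrite /prop_for /continuous_at /= -(nbhs_singleton df_eq).
exact: cvg_trans (near_eq_cvg df_eq) (df_cont v).
Qed.

Lemma C1_differentiable f x : C1 f x -> differentiable f x.
Proof. by case=> /nbhs_singleton. Qed.

Lemma C1_near_is_diff f x : C1 f x -> \forall y \near x, is_diff y f ('d f y).
Proof. by case=> f_diff _; apply: filterS f_diff => y; exact: differentiableP. Qed.

Lemma C1_continuous f x : C1 f x -> {for x, continuous f}.
Proof. by move=> /C1_differentiable/differentiable_continuous. Qed.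

Lemma C1_constant_diff f (df : V -> W) x : (forall y, is_diff y f df) -> C1 f x.
Proof.
move=> f_diff; apply: (C1_is_diff (df := fun=> df)); first exact: nearW.
by move=> v; exact: cst_continuous.
Qed.

Lemma C1_linear (f : {linear V -> W}) x : continuous f -> C1 f x.
Proof.
move=> cf; apply: (C1_constant_diff (df := f)) => y.
by split; [exact: linear_differentiable|exact: diff_lin].
Qed.

Lemma C1_cst (c : W) x : C1 (fun=> c) x.
Proof. by apply: (C1_constant_diff (df := 0)) => y; exact: is_diff_cst. Qed.

Lemma C1D f g x : C1 f x -> C1 g x -> C1 (fun y => f y + g y) x.
Proof.
move=> Cf Cg; apply: (C1_is_diff (df := fun y => ('d f y : V -> W) + 'd g y)).
  apply: filterS2 (C1_near_is_diff Cf) (C1_near_is_diff Cg) => y df dg.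
  exact: is_diffD.
by move=> v; apply: continuousD; [exact: Cf.2|exact: Cg.2].
Qed.

End Basic.

Section Scalar.
Variable V : normedModType R.
Implicit Types (f g : V -> R) (x : V).

Lemma C1M f g x : C1 f x -> C1 g x -> C1 (fun y => f y * g y) x.
Proof.
move=> Cf Cg.
apply: (C1_is_diff (df := fun y => f y *: ('d g y : V -> R) + g y *: ('d f y : V -> R))).
  apply: filterS2 (C1_near_is_diff Cf) (C1_near_is_diff Cg) => y df dg.
  exact: is_diffM.
move=> v; apply: continuousD.
  exact: continuousM (C1_continuous Cf) (Cg.2 v).
exact: continuousM (C1_continuous Cg) (Cf.2 v).
Qed.

Lemma is_derive1_diff (k : R -> R) (t dk : R) : is_derive t 1 k dk -> is_diff t k (fun h => dk * h).
Proof.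
move=> [k_derivable dkE]; split; first exact/derivable1_diffP.
by rewrite deriv1E //; apply/funext => h; rewrite derive1E dkE; exact: mulrC.
Qed.

Lemma C1_derive1_comp (k k' : R -> R) f x : C1 f x ->
  (\forall t \near f x, is_derive (t : R) 1 k (k' t)) -> {for f x, continuous k'} ->
  C1 (fun y => k (f y)) x.
Proof.
move=> Cf k_diff ck'; have cf := C1_continuous Cf.
apply: (C1_is_diff (df := fun y v => k' (f y) *: 'd f y v)).
  have k_diff_near : \forall y \near x, is_derive (f y : R) 1 k (k' (f y)) := cf _ k_diff.
  apply: filterS2 (C1_near_is_diff Cf) k_diff_near => y df /is_derive1_diff dk.
  exact: is_diff_comp.
by move=> v; apply: continuousM; [exact: continuous_comp cf ck'|exact: Cf.2].
Qed.

Lemma C1V f x : C1 f x -> f x != 0 -> C1 (fun y => (f y)^-1) x.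
Proof.
move=> Cf fx0; apply: (C1_derive1_comp (k' := fun t => - t ^- 2)) => //.
  near=> t; have t0 : t != 0 by near: t; exact: cvgr_neq0 cvg_id fx0.
  split; first exact: derivableV.
  by rewrite deriveV // derive_id; exact: mulr1.
by apply: continuousN; apply: continuousV; [rewrite expf_neq0|exact: exprn_continuous].
Unshelve. all: by end_near. Qed.

Lemma C1_sqrt f x : C1 f x -> 0 < f x -> C1 (fun y => Num.sqrt (f y)) x.
Proof.
move=> Cf fx0; apply: (C1_derive1_comp (k' := fun t => (2 * Num.sqrt t)^-1)) => //.
  near=> t; apply: is_derive1_sqrt; near: t; apply: cvgr_gt fx0; exact: cvg_id.
apply: continuousV; first by rewrite mulf_neq0 // ?gt_eqF ?sqrtr_gt0.
by apply: continuousM; [exact: cst_continuous|exact: sqrt_continuous].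
Unshelve. all: by end_near. Qed.

End Scalar.

Lemma linear_row_sum (W : normedModType R) n (g : {linear 'rV[R]_n -> W}) v :
  g v = \sum_i v ord0 i *: g (delta_mx ord0 i).
Proof.
rewrite {1}[v]row_sum_delta linear_sum; apply: eq_bigr => i _.
by rewrite linearZ.
Qed.

Lemma is_diff_entry n (x : 'rV[R]_n) i :
  is_diff x (fun y : 'rV[R]_n => y ord0 i : R) (fun v => v ord0 i).
Proof.
have entry_linear : linear (fun y : 'rV[R]_n => y ord0 i : R) by move=> c u v; rewrite !mxE.
pose entry : {linear 'rV[R]_n -> R} :=
  HB.pack (fun y : 'rV[R]_n => y ord0 i : R) (GRing.isLinear.Build R _ _ _ _ entry_linear).
by split; [exact: differentiable_coord|apply: (diff_lin (f := entry)); exact: coord_continuous].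
Qed.

Lemma C1_coord n (x : 'rV[R]_n) i : C1 (fun y : 'rV[R]_n => y ord0 i : R) x.
Proof. by apply: C1_constant_diff => y; exact: is_diff_entry. Qed.

Section RowVectors.
Variables (V W : normedModType R) (n : nat).
Implicit Types (f df : V -> 'rV[R]_n) (x : V).

Lemma is_diff_coord f x i : differentiable f x ->
  is_diff x (fun y => f y ord0 i) (fun v => 'd f x v ord0 i).
Proof.
move=> f_diff; have := is_diff_entry (f x) i; have := differentiableP f_diff.
exact: is_diff_comp.
Qed.

Lemma differentiable_rV f x : (forall i, differentiable (fun y => f y ord0 i) x) ->
  differentiable f x.
Proof.
move=> f_diff.
have -> : f = \sum_(i < n) (fun y => f y ord0 i *: delta_mx ord0 i).
  by apply/funext => y; rewrite fct_sumE [LHS]row_sum_delta.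
by apply: differentiable_sum => i; exact: differentiableZl.
Qed.

Lemma is_diff_rV f df x :
  (forall i, is_diff x (fun y => f y ord0 i : R) (fun v => df v ord0 i)) -> is_diff x f df.
Proof.
move=> coord_diff; have f_diff : differentiable f x.
  by apply: differentiable_rV => i; have [] := coord_diff i.
split => //; apply/funext => v; apply/rowP => i.
have [_ coordE] := coord_diff i; have [_] := is_diff_coord i f_diff.
by rewrite coordE => /(congr1 (fun g => g v)) <-.
Qed.

Lemma C1_rV f x : (forall i, C1 (fun y => f y ord0 i) x) -> C1 f x.
Proof.
move=> Cf; have f_diff : \forall y \near x, differentiable f y.
  have : \forall y \near x, forall i, differentiable (fun z => f z ord0 i) y.
    by apply: filter_forall => i; exact: (Cf i).1.
  by apply: filterS => y; exact: differentiable_rV.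
apply: (C1_is_diff (df := fun y v => \row_i 'd (fun z => f z ord0 i) y v)).
  apply: filterS f_diff => y f_diff; split => //; apply/funext => v.
  apply/rowP => i; rewrite mxE.
  by have [_ ->] := is_diff_coord i f_diff.
move=> v; apply: continuous_rV => i.
have -> : (fun y => (\row_i 'd (fun z => f z ord0 i) y v) ord0 i) =
    (fun y => 'd (fun z => f z ord0 i) y v) by apply/funext => y; rewrite mxE.
exact: (Cf i).2.
Qed.

Lemma C1_rV_coord f x i : C1 f x -> C1 (fun y => f y ord0 i : R) x.
Proof.
move=> Cf; apply: (C1_is_diff (df := fun y v => 'd f y v ord0 i)).
  by apply: filterS Cf.1 => y; exact: is_diff_coord.
by move=> v; apply: continuous_coord; exact: Cf.2.
Qed.

Lemma C1_comp (g : 'rV[R]_n -> W) f x : C1 f x -> C1 g (f x) -> C1 (fun y => g (f y)) x.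
Proof.
move=> Cf Cg; have cf := C1_continuous Cf.
apply: (C1_is_diff (df := fun y v => \sum_i 'd f y v ord0 i *: 'd g (f y) (delta_mx ord0 i))).
  have g_diff : \forall y \near x, differentiable g (f y) := cf _ Cg.1.
  apply: filterS2 Cf.1 g_diff => y f_diff g_diff.
  split; first exact: differentiable_comp.
  by rewrite [LHS](diff_comp f_diff g_diff); apply/funext => v; exact: linear_row_sum.
move=> v; apply: (@cvg_big _ _ +%R 0 xpredT add_continuous) => i _.
have dg_cvg : {for x, continuous (fun y => 'd g (f y) (delta_mx ord0 i))}.
  exact: (continuous_comp cf (Cg.2 _)).
have df_cvg : {for x, continuous (fun y => 'd f y v ord0 i)}.
  by apply: continuous_coord; exact: Cf.2.
exact: cvgZ df_cvg dg_cvg.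
Qed.

End RowVectors.

Section StrictDifferentiability.
Variable n : nat.
Local Notation V := 'rV[R]_n.
Implicit Types (x y z v : V) (e r : R).

Lemma near_diff_close (W : normedModType R) (f : V -> W) x e : C1 f x -> 0 < e ->
  \forall y \near x, forall v, `|'d f y v - 'd f x v| <= e * `|v|.
Proof.
move=> Cf e0; have en : 0 < e / n.+1%:R by rewrite divr_gt0.
have : \forall y \near x, forall i,
    `|'d f x (delta_mx ord0 i) - 'd f y (delta_mx ord0 i)| < e / n.+1%:R.
  apply: (@filter_forall _ _ _ (nbhs x)) => i.
  by have /cvgr_dist_lt/(_ _ en) := Cf.2 (delta_mx ord0 i).
apply: (@filterS _ (nbhs x)) => y fxy v; rewrite distrC.
have -> : 'd f x v - 'd f y v =
    \sum_i v ord0 i *: ('d f x (delta_mx ord0 i) - 'd f y (delta_mx ord0 i)).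
  by under [RHS]eq_bigr do rewrite scalerBr; rewrite sumrB; congr (_ - _); exact: linear_row_sum.
apply: (@le_trans _ _ (\sum_(i < n) `|v| * (e / n.+1%:R))).
  apply: le_trans (ler_norm_sum _ _ _) _; apply: ler_sum => i _.
  by rewrite normrZ; apply: ler_pM => //; [exact: coord_le_norm|exact: ltW].
rewrite sumr_const card_ord -mulrnAr mulrC ler_wpM2r // -[_ *+ n]mulr_natr.
by rewrite mulrAC ler_pdivrMr // ler_wpM2l ?ler_nat // ltW.
Qed.

Lemma segment_in_ball (W : normedModType R) (x y z : W) r (t : R) :
  `|y - x| <= r -> `|z - x| <= r -> 0 <= t <= 1 -> `|y + t *: (z - y) - x| <= r.
Proof.
move=> yr zr /andP[t0 t1].
have -> : y + t *: (z - y) - x = (1 - t) *: (y - x) + t *: (z - x).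
  have -> : z - y = (z - x) - (y - x) by rewrite opprB addrA subrK.
  by rewrite addrAC (scalerBr t) (scalerBl 1) scale1r -[RHS]addrA [- _ + _]addrC.
apply: le_trans (ler_normD _ _) _; rewrite !normrZ (ger0_norm t0) ger0_norm ?subr_ge0 //.
have -> : r = (1 - t) * r + t * r by ring.
by apply: lerD; apply: ler_wpM2l; rewrite ?subr_ge0.
Qed.

Lemma is_derive_segment (W : normedModType R) (f : V -> W) y v (t : R) :
  differentiable f (y + t *: v) ->
  is_derive t 1 (fun s : R => f (y + s *: v)) ('d f (y + t *: v) v).
Proof.
move=> f_diff.
have line_diff : is_diff t (fun s : R => y + s *: v) (fun s => s *: v).
  exact: is_diff_eq (is_diffD (is_diff_cst y t) (is_diff_scalel t v)) (add0r _).
have [fline_diff dE] := is_diff_comp line_diff (differentiableP f_diff).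
split; first exact: diff_derivable.
by rewrite deriveE // dE /= scale1r.
Qed.

Lemma mean_value_segment (f : V -> R) y v :
  (forall t : R, 0 <= t <= 1 -> differentiable f (y + t *: v)) ->
  exists2 t : R, 0 <= t <= 1 & f (y + v) - f y = 'd f (y + t *: v) v.
Proof.
move=> f_diff; pose g (t : R) : R := f (y + t *: v); pose dg (t : R) : R := 'd f (y + t *: v) v.
have g_derive (t : R) : t \in `[0, 1]%R -> is_derive t 1 g (dg t).
  by rewrite in_itv => t01; apply: is_derive_segment; exact: f_diff.
have g_derive_oo (t : R) : t \in `]0, 1[%R -> is_derive t 1 g (dg t).
  by move=> /subset_itv_oo_cc; exact: g_derive.
have g_cont : {within `[0, 1]%classic, continuous g}.
  by apply: derivable_within_continuous => t /g_derive[].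
have [t t01 gE] := MVT_segment ler01 g_derive_oo g_cont.
exists t; first by move: t01; rewrite in_itv.
by move: gE; rewrite /g scale1r scale0r addr0 subr0 mulr1.
Qed.

Lemma C1_strict_scalar (f : V -> R) x e : C1 f x -> 0 < e ->
  \forall r \near 0^'+, forall y z, `|y - x| <= r -> `|z - x| <= r ->
    `|f z - f y - 'd f y (z - y)| <= e * `|z - y|.
Proof.
move=> Cf e0; have e2 : 0 < e / 2 by rewrite divr_gt0.
have f_diff_near := near_right_ball Cf.1.
have close_near := near_right_ball (near_diff_close Cf e2).
near=> r => y z yr zr.
have f_diff u : `|u - x| <= r -> differentiable f u by move: u; near: r.
have close u : `|u - x| <= r -> forall v, `|'d f u v - 'd f x v| <= e / 2 * `|v|.
  by move: u; near: r.
have in_ball (t : R) : 0 <= t <= 1 -> `|y + t *: (z - y) - x| <= r by exact: segment_in_ball.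
have [t t01] := mean_value_segment (fun t t01 => f_diff _ (in_ball t t01)).
rewrite [y + (z - y)]addrC subrK => ->.
rewrite (le_trans (ler_distD ('d f x (z - y)) _ _)) // (splitr e) mulrDl lerD //.
  exact: close (in_ball t t01) _.
by rewrite distrC; exact: close.
Unshelve. all: by end_near. Qed.

Lemma C1_strict k (f : V -> 'rV[R]_k) x e : C1 f x -> 0 < e ->
  \forall r \near 0^'+, forall y z, `|y - x| <= r -> `|z - x| <= r ->
    `|f z - f y - 'd f y (z - y)| <= e * `|z - y|.
Proof.
move=> Cf e0; have f_diff_near := near_right_ball Cf.1.
have strict_near : \forall r \near 0^'+, forall i, forall y z, `|y - x| <= r -> `|z - x| <= r ->
    `|f z ord0 i - f y ord0 i - 'd (fun u => f u ord0 i : R) y (z - y)| <= e * `|z - y|.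
  by apply: filter_forall => i; apply: C1_strict_scalar => //; exact: C1_rV_coord.
near=> r => y z yr zr.
have f_diff : differentiable f y by move: (y) yr; near: r.
apply/rV_norm_leP => [|i]; first by rewrite mulr_ge0 // ltW.
have strict u w : `|u - x| <= r -> `|w - x| <= r ->
    `|f w ord0 i - f u ord0 i - 'd (fun u => f u ord0 i : R) u (w - u)| <= e * `|w - u|.
  by move: i u w; near: r.
by have := strict y z yr zr; have [_ ->] := is_diff_coord i f_diff; rewrite !mxE.
Unshelve. all: by end_near. Qed.

End StrictDifferentiability.

End C1.

(** * Sard's theorem *)

Section UniformDifferentiability.
Variables (R : realType) (n k : nat).
Implicit Types (X : set 'rV[R]_n) (f : 'rV[R]_n -> 'rV[R]_k) (e : R).

Lemma C1_uniform_strict X f e : compact X -> (forall x, X x -> C1 f x) -> 0 < e ->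
  \forall N \near \oo, forall x y, X x -> `|y - x| <= N.+1%:R^-1 ->
    `|f y - f x - 'd f x (y - x)| <= e * `|y - x|.
Proof.
move=> cX Cf e0.
apply: (compact_near_diagonal
  (P := fun _ x y => `|f y - f x - 'd f x (y - x)| <= e * `|y - x|)) => // x0 /Cf Cfx0.
by apply: filterS (C1_strict Cfx0 e0) => r strict; apply: nearW => _; exact: strict.
Qed.

Lemma C1_uniform_lipschitz X f : compact X -> (forall x, X x -> C1 f x) ->
  \forall N \near \oo, forall x y, X x -> `|y - x| <= N.+1%:R^-1 ->
    `|f y - f x| <= N%:R * `|y - x|.
Proof.
move=> cX Cf.
apply: (compact_near_diagonal (P := fun N x y => `|f y - f x| <= N%:R * `|y - x|)) => // x0.
move=> /Cf Cfx0.
have [K K0 KP] := linear_lipschitz (diff_continuous (C1_differentiable Cfx0)).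
have strict_near := C1_strict Cfx0 (@ltr01 R).
have diff_near := near_right_ball (near_diff_close Cfx0 (@ltr01 R)).
near=> r; near=> N => x y xr yr.
have strict : `|f y - f x - 'd f x (y - x)| <= 1 * `|y - x|.
  by move: (x) (y) xr yr; near: r.
have diff_close v : `|'d f x v - 'd f x0 v| <= 1 * `|v|.
  by move: v; move: (x) xr; near: r.
have NK : K + 2 <= N%:R by near: N; exact: nbhs_infty_ger.
apply: le_trans (_ : (K + 2) * `|y - x| <= _); last by rewrite ler_wpM2r.
have -> : (K + 2) * `|y - x| = 1 * `|y - x| + (1 * `|y - x| + K * `|y - x|) by ring.
rewrite -(subrK ('d f x (y - x)) (f y - f x)).
apply: le_trans (ler_normD _ _) (lerD strict _).
rewrite -(subrK ('d f x0 (y - x)) ('d f x (y - x))).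
exact: le_trans (ler_normD _ _) (lerD (diff_close _) (KP _)).
Unshelve. all: by end_near. Qed.

End UniformDifferentiability.

Section GridCells.
Variables (R : realType) (n B N : nat).
Implicit Types x y : 'rV[R]_n.

Definition grid_cell x : {ffun 'I_n -> 'I_(2 * B * N).+1} :=
  [ffun j => inord (Num.truncn ((x ord0 j + B%:R) * N%:R))].

Lemma grid_cell_close x y : (0 < N)%N -> `|x| <= B%:R -> `|y| <= B%:R ->
  grid_cell x = grid_cell y -> `|x - y| <= N%:R^-1.
Proof.
move=> N0 xB yB /ffunP xy; have NR : 0 < N%:R :> R by rewrite ltr0n.
apply/rV_norm_leP => [|j]; first by rewrite invr_ge0.
have coord_itv (z : 'rV[R]_n) : `|z| <= B%:R -> 0 <= (z ord0 j + B%:R) * N%:R <= (2 * B * N)%:R.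
  move=> /(le_trans (coord_le_norm z j)); rewrite ler_norml => /andP[z_ge z_le].
  rewrite !natrM ler_pM2r // mulr_ge0 //=; first by move: z_le; lra.
  by move: z_ge; lra.
have cell_lt (z : 'rV[R]_n) : `|z| <= B%:R ->
    (Num.truncn ((z ord0 j + B%:R) * N%:R) < (2 * B * N).+1)%N.
  by move=> /coord_itv/andP[_ z_le]; rewrite ltnS truncn_le_nat (le_lt_trans z_le) // ltr_nat.
have := congr1 (@nat_of_ord _) (xy j).
rewrite !ffunE (inordK (cell_lt _ xB)) (inordK (cell_lt _ yB)) => cell_eq.
have [/andP[x_ge _] /andP[y_ge _]] := (coord_itv _ xB, coord_itv _ yB).
have := truncn_itv x_ge; have := truncn_itv y_ge; rewrite cell_eq -natr1.
move=> /andP[ly uy] /andP[lx ux].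
rewrite !mxE -(ler_pM2r NR) mulVf ?gt_eqF //.
rewrite -[in `|_| * _](gtr0_norm NR) -normrM mulrBl ler_norml.
by apply/andP; split; lra.
Qed.

End GridCells.

(* Within a cell a point is determined by its coordinates off the pivot, and
   these are confined to a window of width [2 * D]. *)
Lemma card_grid_le m M D (T : finType) (cell : {ffun 'I_m.+1 -> 'I_M} -> T)
    (pivot : {ffun 'I_m.+1 -> 'I_M} -> 'I_m.+1) :
  (forall s t j, cell s = cell t -> (s j <= t j + D)%N) ->
  (forall q s t, cell s = cell q -> cell t = cell q ->
     (forall j, j != pivot q -> s j = t j) -> s = t) ->
  (M ^ m.+1 <= #|T| * (2 * D).+1 ^ m)%N.
Proof.
move=> cell_window cell_pivot.
have [M0|M_gt0] := posnP M; first by rewrite M0 exp0n.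
pose rep c : {ffun 'I_m.+1 -> 'I_M} := odflt [ffun=> Ordinal M_gt0] [pick s | cell s == c].
have repP s : cell (rep (cell s)) = cell s.
  by rewrite /rep; case: pickP => [t /eqP//|/(_ s)]; rewrite eqxx.
pose offset (s : {ffun 'I_m.+1 -> 'I_M}) j := (s j + D - rep (cell s) j)%N.
have offset_lt s j : (offset s j < (2 * D).+1)%N.
  by have := cell_window s _ j (esym (repP s)); rewrite /offset; lia.
pose code s : T * {ffun 'I_m -> 'I_(2 * D).+1} :=
  (cell s, [ffun k => Ordinal (offset_lt s (lift (pivot (rep (cell s))) k))]).
suff code_inj : injective code.
  by have := leq_card _ code_inj; rewrite card_prod !card_ffun !card_ord.
move=> s t [st /ffunP offset_eq].
apply: (cell_pivot (rep (cell s))) => [||j]; rewrite ?repP // eq_sym.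
move=> /unlift_some[k jE _].
have := congr1 val (offset_eq k); rewrite !ffunE /= /offset -st -jE.
have := cell_window _ s j (repP s).
have := cell_window _ t j (etrans (repP s) st).
by move=> *; apply/val_inj => /=; lia.
Qed.

Lemma card_cells_lt m B T u D : (0 < B)%N -> (0 < T)%N -> (0 < u)%N ->
  ((3 * (B * T)) ^ m.+1 * 3 ^ m < D)%N ->
  ((2 * B * (T * u)).+1 ^ m.+1 * (2 * D).+1 ^ m < (D * u) ^ m.+1)%N.
Proof.
move=> B0 T0 u0 D_gt; have BTu : (0 < B * (T * u))%N by rewrite !muln_gt0 B0 T0.
have D0 : (0 < D)%N by apply: leq_ltn_trans D_gt.
have exp_homo k l e : (k <= l)%N -> (k ^ e <= l ^ e)%N by case: e => // e; rewrite leq_exp2r.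
have cells_le : ((2 * B * (T * u)).+1 <= 3 * (B * T) * u)%N by lia.
have window_le : ((2 * D).+1 <= 3 * D)%N by lia.
apply: leq_ltn_trans (leq_mul (exp_homo _ _ _ cells_le) (exp_homo _ _ _ window_le)) _.
rewrite (expnMn _ u) (expnMn 3 D) mulnACA (expnMn D) (expnS D).
rewrite -[ltnRHS]mulnA [(D ^ m * _)%N]mulnC.
by rewrite ltn_pmul2r // muln_gt0 !expn_gt0 u0 D0.
Qed.

Section CriticalValues.
Variables (R : realType) (m : nat).
Local Notation n := m.+1.
Local Notation V := 'rV[R]_n.
Implicit Types (u v x y w : V) (X : set V) (f : V -> V).

Definition dot u v : R := \sum_i u ord0 i * v ord0 i.

Lemma dot_norm_le u v : `|dot u v| <= n%:R * `|u| * `|v|.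
Proof.
apply: le_trans (ler_norm_sum _ _ _) _.
apply: (@le_trans _ _ (\sum_(i < n) `|u| * `|v|)).
  by apply: ler_sum => i _; rewrite normrM; apply: ler_pM => //; exact: coord_le_norm.
by rewrite sumr_const card_ord -[_ *+ _]mulr_natl mulrA.
Qed.

Lemma dotDr u v w : dot u (v + w) = dot u v + dot u w.
Proof. by rewrite -big_split /=; apply: eq_bigr => i _; rewrite mxE mulrDr. Qed.

Lemma dotZr (c : R) u v : dot u (c *: v) = c * dot u v.
Proof. by rewrite mulr_sumr; apply: eq_bigr => i _; rewrite mxE mulrCA. Qed.

Lemma dotZl (c : R) u v : dot (c *: u) v = c * dot u v.
Proof. by rewrite mulr_sumr; apply: eq_bigr => i _; rewrite mxE mulrA. Qed.

Lemma dotBr u v w : dot u (v - w) = dot u v - dot u w.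
Proof. by rewrite dotDr -scaleN1r dotZr mulN1r. Qed.

Lemma dot_mulmx w v (A : 'M[R]_n) : dot w (v *m A) = (v *m (A *m w^T)) ord0 ord0.
Proof. by rewrite mulmxA [RHS]mxE; apply: eq_bigr => i _; rewrite [w^T _ _]mxE mulrC. Qed.

Lemma max_coord v : exists i, `|v ord0 i| = `|v|.
Proof.
have [->|v0] := eqVneq v 0; first by exists ord0; rewrite mxE !normr0.
have /mx_norm_neq0[[i j] /= vij] : `|v| != 0 by rewrite normr_eq0.
by exists j; rewrite [RHS]vij (ord1 i).
Qed.

Lemma critical_covector (A : 'M[R]_n) : \det A = 0 -> exists w : V * 'I_n,
  [/\ w.1 ord0 w.2 = 1, `|w.1| = 1 & forall v, dot w.1 (v *m A) = 0].
Proof.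
move=> A0; have /det0P[v v0 vA] : \det A^T == 0 by rewrite det_tr A0.
have [i vi] := max_coord v; have vi0 : v ord0 i != 0 by rewrite -normr_eq0 vi normr_eq0.
exists ((v ord0 i)^-1 *: v, i); split => /= [||u].
- by rewrite mxE mulVf.
- by rewrite normrZ normfV vi mulVf // normr_eq0.
rewrite dot_mulmx linearZ /= -scalemxAr -[A]trmxK -trmx_mul vA.
by rewrite trmx0 scaler0 mulmx0 mxE.
Qed.

Section CriticalGrid.
Variables (X : set V) (f : V -> V) (c : V) (B K D M N : nat) (e eta : R).
Hypothesis N_gt0 : (0 < N)%N.
Hypothesis X_bounded : forall x, X x -> `|x| <= B%:R.
Hypothesis f_lipschitz : forall x y, X x -> `|y - x| <= N%:R^-1 ->
  `|f y - f x| <= K%:R * `|y - x|.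
Hypothesis f_strict : forall x y, X x -> `|y - x| <= N%:R^-1 ->
  `|f y - f x - 'd f x (y - x)| <= e * `|y - x|.
Hypothesis e_ge0 : 0 <= e.
Hypothesis eta_gt0 : 0 < eta.
Hypothesis lipschitz_eta : K%:R / N%:R <= D%:R * eta.
Hypothesis strict_eta : 2 * (n%:R * (e / N%:R)) < eta.

Definition value_grid (s : {ffun 'I_n -> 'I_M}) : V :=
  c + eta *: \row_j (s j)%:R.

Hypothesis grid_critical : forall s, exists x,
  [/\ X x, f x = value_grid s & \det ('J f x) = 0].

Lemma value_gridB s t j : (value_grid s - value_grid t) ord0 j = eta * ((s j)%:R - (t j)%:R).
Proof. by rewrite !mxE; ring. Qed.

Lemma critical_slab w x y : X x -> `|y - x| <= N%:R^-1 -> `|w| = 1 ->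
  (forall v, dot w (v *m 'J f x) = 0) -> `|dot w (f y - f x)| <= n%:R * (e / N%:R).
Proof.
move=> Xx xy w1 w_ker.
have -> : dot w (f y - f x) = dot w (f y - f x - 'd f x (y - x)).
  by have := w_ker (y - x); rewrite /jacobian mul_rV_lin1 => w_df; rewrite [RHS]dotBr w_df subr0.
apply: le_trans (dot_norm_le _ _) _; rewrite w1 mulr1 ler_pM2l ?ltr0n //.
by apply: le_trans (f_strict Xx xy) _; rewrite ler_wpM2l.
Qed.

(* A cell of side [1/N] is mapped into a slab, of width [K/N] along the critical
   hyperplane and of width [n e / N] across it. *)
Lemma critical_grid_card : (M ^ n <= (2 * B * N).+1 ^ n * (2 * D).+1 ^ m)%N.
Proof.
have [x_ x_P] := choice grid_critical.
pose cell s := grid_cell B N (x_ s).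
have cell_close s t : cell s = cell t -> `|x_ s - x_ t| <= N%:R^-1.
  by have [/X_bounded ? _ _] := x_P s; have [/X_bounded ? _ _] := x_P t;
    exact: grid_cell_close.
have value_dist s t : cell s = cell t -> f (x_ s) - f (x_ t) = value_grid s - value_grid t.
  by have [_ -> _] := x_P s; have [_ -> _] := x_P t.
have /choice[w_ w_P] : forall s, exists w : V * 'I_n,
    [/\ w.1 ord0 w.2 = 1, `|w.1| = 1 & forall v, dot w.1 (v *m 'J f (x_ s)) = 0].
  by move=> s; have [_ _ /critical_covector] := x_P s.
have card_cells : #|{ffun 'I_n -> 'I_(2 * B * N).+1}| = ((2 * B * N).+1 ^ n)%N.
  by rewrite card_ffun !card_ord.
rewrite -card_cells; apply: (@card_grid_le _ _ _ _ cell (fun s => (w_ s).2)).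
  move=> s t j st; have [Xt _ _] := x_P t.
  have := le_trans (f_lipschitz Xt (cell_close s t st)) (ler_wpM2l (ler0n _ K) (cell_close s t st)).
  rewrite value_dist // => /(le_trans (coord_le_norm _ j))/le_trans/(_ lipschitz_eta).
  rewrite value_gridB normrM gtr0_norm // mulrC ler_pM2r // => /(le_trans (ler_norm _)).
  by rewrite lerBlDl -natrD ler_nat.
move=> q s t sq tq st; have [Xq _ _] := x_P q; have [w_pivot w1 w_ker] := w_P q.
have slab s' : cell s' = cell q ->
    `|dot (w_ q).1 (value_grid s' - value_grid q)| <= n%:R * (e / N%:R).
  by move=> s'q; rewrite -value_dist //; apply: critical_slab => //; exact: cell_close.
have st_close : `|dot (w_ q).1 (value_grid s - value_grid t)| < eta.
  apply: le_lt_trans strict_eta; rewrite -(subrKA (value_grid q)) dotDr mulr2n mulrDl mul1r.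
  apply: le_trans (ler_normD _ _) (lerD (slab s sq) _).
  by rewrite -opprB -scaleN1r dotZr mulN1r normrN slab.
have st_pivot : dot (w_ q).1 (value_grid s - value_grid t) =
    eta * ((s (w_ q).2)%:R - (t (w_ q).2)%:R).
  rewrite /dot (bigD1 (w_ q).2) //= w_pivot mul1r value_gridB big1 ?addr0 // => j /st st_j.
  by rewrite value_gridB st_j subrr !mulr0.
apply/ffunP => j; have [->|/st //] := eqVneq j (w_ q).2.
move: st_close; rewrite st_pivot normrM gtr0_norm // gtr_pMr //.
rewrite ltr_distl ltrBlDr !natr1 !ltr_nat !ltnS => ts; apply/val_inj.
by apply/anti_leq; rewrite andbC.
Qed.

End CriticalGrid.

Definition regular_value X f (y : V) := forall x, X x -> f x = y -> \det ('J f x) != 0.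

(* Pigeonhole: the images of the [(2 B N)^n] cells of side [1/N] contain too few
   points of a grid of mesh [K / (D N)] when [D] is large. *)
Lemma sard X f (c : V) (r : R) : compact X -> (forall x, X x -> C1 f x) -> 0 < r ->
  exists2 y, `|y - c| < r & regular_value X f y.
Proof.
move=> cX Cf r0; apply: contrapT => no_regular.
have critical y : `|y - c| < r -> exists x, [/\ X x, f x = y & \det ('J f x) = 0].
  move=> yr; apply: contrapT => no_critical; apply: no_regular; exists y => // x Xx fx.
  by apply/eqP => J0; apply: no_critical; exists x.
have [B B0 X_bounded] : exists2 B : nat, (0 < B)%N & forall x, X x -> `|x| <= B%:R.
  have [B [_ X_B]] := compact_bounded cX; exists (Num.truncn `|B|).+1 => // x Xx.
  by apply: X_B => //; rewrite (le_lt_trans (ler_norm _)) // truncnS_gt.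
have [N0 _ /(_ N0.+1 (leqnSn _)) lipschitz] := C1_uniform_lipschitz cX Cf.
pose K := N0.+1.
have [T T0 KT] : exists2 T : nat, (0 < T)%N & K%:R / T%:R < r.
  exists (Num.truncn (K%:R / r)).+1 => //.
  by rewrite ltr_pdivrMr // mulrC -ltr_pdivrMr // truncnS_gt.
pose D := ((3 * (B * T)) ^ n * 3 ^ m).+1.
pose e : R := K%:R / (3 * n%:R * D%:R).
have e0 : 0 < e by rewrite !divr_gt0 ?mulr_gt0 ?ltr0n.
have [N1 _ /(_ N1 (leqnn _)) strict] := C1_uniform_strict cX Cf e0.
pose u := (N0 + N1).+2; pose N := (T * u)%N.
pose eta : R := K%:R / (D%:R * N%:R).
have N_gt0 : (0 < N)%N by rewrite muln_gt0 T0.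
have NR : 0 < N%:R :> R by rewrite ltr0n.
have eta0 : 0 < eta by rewrite divr_gt0 ?mulr_gt0 //; rewrite ltr0n.
have scale k : (k <= (N0 + N1).+1)%N -> N%:R^-1 <= k.+1%:R^-1 :> R.
  move=> kN; have Nk : (k.+1 <= N)%N by rewrite /N /u; nia.
  by rewrite lef_pV2 ?posrE ?ler_nat ?ltr0n ?N_gt0.
have : ((D * u) ^ n <= (2 * B * N).+1 ^ n * (2 * D).+1 ^ m)%N.
  apply: (@critical_grid_card X f c B K D (D * u) N e eta) => //.
  - move=> x y Xx xy; apply: lipschitz => //; apply: le_trans xy (scale _ _).
    by rewrite ltnS leq_addr.
  - by move=> x y Xx xy; apply: strict => //; apply: le_trans xy (scale _ (leqW (leq_addl _ _))).
  - exact: ltW.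
  - by rewrite /eta invfM mulrCA mulVKf // pnatr_eq0.
  - have -> : 2 * (n%:R * (e / N%:R)) = 2 / 3 * eta.
      by rewrite /e /eta; field; rewrite nat1r (gt_eqF NR) !pnatr_eq0.
    by rewrite gtr_pMl // ltr_pdivrMr // mul1r ltr_nat.
  move=> s; apply: critical; rewrite /value_grid addrC addKr; apply/rV_norm_ltP => // j.
  rewrite !mxE normrM gtr0_norm // ger0_norm //; apply: le_lt_trans KT.
  apply: (@le_trans _ _ (eta * (D * u)%:R)); first by rewrite ler_pM2l // ler_nat ltnW.
  rewrite /eta /N !natrM le_eqVlt; apply/orP; left; apply/eqP; field.
  by rewrite !pnatr_eq0 -!lt0n T0.
by rewrite leqNgt card_cells_lt.
Qed.

End CriticalValues.

Section CriticalImage.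
Variables (R : realType) (m : nat).
Local Notation n := m.+1.
Local Notation V := 'rV[R]_n.
Implicit Types (f : V -> V) (v x y c : V) (r : R).

Lemma derive_invariant_direction f v x : (forall x (t : R), f (x + t *: v) = f x) ->
  'D_v f x = 0.
Proof.
move=> f_inv; apply: (@cvg_lim _ _ _ (0 : R)^'); first exact: norm_hausdorff.
have -> : (fun h : R => h^-1 *: ((f \o shift x) (h *: v) - f x)) = cst 0.
  by apply/funext => h; rewrite /= [_ + x]addrC f_inv subrr scaler0.
exact: cvg_cst.
Qed.

Lemma det_jacobian_invariant_direction f v x : v != 0 -> differentiable f x ->
  (forall x (t : R), f (x + t *: v) = f x) -> \det ('J f x) = 0.
Proof.
move=> v0 f_diff f_inv; apply/eqP/det0P; exists v => //.
by rewrite -deriveEjacobian // derive_invariant_direction.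
Qed.

Lemma critical_image_avoids f c r : (forall x, C1 f x) -> (forall x, \det ('J f x) = 0) ->
  0 < r -> exists2 y, `|y - c| < r & forall x, f x <> y.
Proof.
move=> Cf J0 r0.
have cf : continuous f by move=> x; exact: C1_continuous.
pose avoid (k : nat) : set V := ~` (f @` cube k%:R).
have dense_avoid : dense (\bigcap_k avoid k).
  pose U : completeNormedModType R := HB.pack V.
  apply: (@Baire R U) => k; split.
    apply: closed_openC; apply: compact_closed; first exact: norm_hausdorff.
    apply: continuous_compact; last exact: compact_cube.
    exact: continuous_subspaceT.
  move=> O [c' Oc'] oO.
  have /nbhs_normP[s /= s0 sO] : nbhs (c' : V) O by exact: open_nbhs_nbhs.
  have [y yc y_regular] := sard c' (@compact_cube R n k%:R) (fun x _ => Cf x) s0.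
  exists y; split; first by apply: sO; rewrite /ball_ /= distrC.
  by move=> [x xk fx]; have := y_regular x xk fx; rewrite J0 eqxx.
have open_ball : open [set y : V | `|y - c| < r].
  have -> : [set y : V | `|y - c| < r] = ball c r.
    by rewrite mx_norm_ball; apply/seteqP; split => y /=; rewrite /ball_ /= distrC.
  exact: ball_open.
have [|y [yr y_avoid]] := dense_avoid [set y : V | `|y - c| < r] _ open_ball.
  by exists c; rewrite /= subrr normr0.
exists y => // x fx; apply: (y_avoid (Num.truncn `|x|).+1 I); exists x => //.
by rewrite /cube /= ltW // truncnS_gt.
Qed.

End CriticalImage.

(** * Local intersection numbers *)

Section DiffSums.
Variables (R : realType) (V W : normedModType R).

Lemma is_diff_sum (I : finType) (f df : I -> V -> W) x : (forall i, is_diff x (f i) (df i)) ->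
  is_diff x (\sum_i f i) (\sum_i df i).
Proof.
move=> f_diff; elim/big_ind2 : _ => [|f1 df1 f2 df2|i _]; first exact: is_diff_cst.
  exact: is_diffD.
exact: f_diff.
Qed.

Lemma C1_sum (I : finType) (f : I -> V -> W) x : (forall i, C1 (f i) x) ->
  C1 (fun y => \sum_i f i y) x.
Proof.
move=> Cf; suff : C1 (\sum_i f i) x by congr C1; apply/funext => y; rewrite fct_sumE.
by elim/big_ind : _ => [|f1 f2|i _]; [exact: C1_cst|exact: C1D|exact: Cf].
Qed.

End DiffSums.

Lemma is_diff_shift (R : realType) (V : normedModType R) (p x : V) :
  is_diff x (fun y => y - p) id.
Proof. by apply: is_diff_eq (is_diffB (is_diff_id x) (is_diff_cst p x)) _; rewrite subr0. Qed.

Lemma C1_scale (R : realType) (V : normedModType R) n (s : V -> R) (f : V -> 'rV[R]_n) x :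
  C1 s x -> C1 f x -> C1 (fun y => s y *: f y) x.
Proof.
move=> Cs Cf; apply: C1_rV => i.
have -> : (fun y => (s y *: f y) ord0 i) = (fun y => s y * f y ord0 i).
  by apply/funext => y; rewrite mxE.
exact: C1M Cs (C1_rV_coord i Cf).
Qed.

Lemma is_diff_scale (R : realType) (V : normedModType R) n (s ds : V -> R)
    (f df : V -> 'rV[R]_n) x : is_diff x s ds -> is_diff x f df ->
  is_diff x (fun y => s y *: f y) (fun v => s x *: df v + ds v *: f x).
Proof.
move=> s_diff [f_diff <-]; apply: is_diff_rV => i.
have -> : (fun y => (s y *: f y) ord0 i : R) = s * (fun y => f y ord0 i).
  by apply/funext => y; rewrite mxE.
apply: is_diff_eq (is_diffM s_diff (is_diff_coord i f_diff)) _.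
by apply/funext => v; rewrite !mxE; congr (_ + _); exact: mulrC.
Qed.

Section EuclideanNorm.
Variable R : realType.
Local Notation V := 'rV[R]_4.
Implicit Types x v : V.

Lemma sumsq_ge0 x : 0 <= \sum_(j < 4) x ord0 j ^+ 2.
Proof. by apply: sumr_ge0 => j _; rewrite sqr_ge0. Qed.

Lemma sqr_enorm x : enorm x ^+ 2 = dot x x.
Proof. by rewrite sqr_sqrtr ?sumsq_ge0 //; apply: eq_bigr => j _; rewrite expr2. Qed.

Lemma enorm_ge0 x : 0 <= enorm x.
Proof. exact: sqrtr_ge0. Qed.

Lemma norm_le_enorm x : `|x| <= enorm x.
Proof.
apply/rV_norm_leP => [|i]; first exact: enorm_ge0.
rewrite -[leLHS]sqrtr_sqr; apply: ler_wsqrtr; rewrite (bigD1 i) //=.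
by rewrite lerDl; apply: sumr_ge0 => j _; rewrite sqr_ge0.
Qed.

Lemma enorm_le_norm x : enorm x <= 2 * `|x|.
Proof.
rewrite -[leRHS]ger0_norm ?mulr_ge0 // -sqrtr_sqr; apply: ler_wsqrtr.
apply: (@le_trans _ _ (\sum_(j < 4) `|x| ^+ 2)).
  apply: ler_sum => j _; rewrite -real_normK ?num_real //.
  by rewrite lerXn2r ?nnegrE // coord_le_norm.
by rewrite sumr_const card_ord exprMn -natrX mulr_natl.
Qed.

Lemma enormZ c x : enorm (c *: x) = `|c| * enorm x.
Proof.
rewrite /enorm -[`|c|]sqrtr_sqr -sqrtrM ?sqr_ge0 //; congr Num.sqrt.
by rewrite mulr_sumr; apply: eq_bigr => j _; rewrite mxE exprMn.
Qed.

Lemma enorm0 : enorm (0 : V) = 0.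
Proof. by rewrite -(scale0r 0) enormZ normr0 mul0r. Qed.

Lemma enorm_eq0 x : (enorm x == 0) = (x == 0).
Proof.
apply/eqP/eqP => [x0|->]; last exact: enorm0.
by apply/eqP; rewrite -normr_eq0 eq_le normr_ge0 andbT -x0 norm_le_enorm.
Qed.

Lemma enorm_gt0 x : (0 < enorm x) = (x != 0).
Proof. by rewrite lt_neqAle enorm_ge0 andbT eq_sym enorm_eq0. Qed.

Lemma enorm_normalize x : x != 0 -> enorm ((enorm x)^-1 *: x) = 1.
Proof.
by rewrite -enorm_gt0 => x0; rewrite enormZ gtr0_norm ?invr_gt0 // mulVf // gt_eqF.
Qed.

Lemma sumsq_gt0 x : x != 0 -> 0 < \sum_(j < 4) x ord0 j ^+ 2.
Proof. by move=> x0; rewrite -sqrtr_gt0; rewrite -enorm_gt0 in x0. Qed.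

Lemma continuous_enorm : continuous (@enorm R).
Proof.
move=> x; apply: (@continuous_comp _ _ _ (fun y : V => \sum_(j < 4) y ord0 j ^+ 2)); last first.
  exact: sqrt_continuous.
apply: (@continuous_big _ _ +%R 0 xpredT add_continuous _ _ (fun j (y : V) => y ord0 j ^+ 2)).
by move=> j _ y; exact: cvg_comp (@coord_continuous R 1 4 ord0 j y) (@exprn_continuous _ 2 _).
Qed.

Lemma C1_enorm x : x != 0 -> C1 (@enorm R) x.
Proof.
move=> /sumsq_gt0; apply: C1_sqrt; apply: C1_sum => j.
exact: C1M (C1_coord x j) (C1_coord x j).
Qed.

Lemma is_diff_enorm x : x != 0 -> is_diff x (@enorm R) (fun v => (enorm x)^-1 * dot x v).
Proof.
move=> x0; have sumsq_diff : is_diff x (\sum_(j < 4) (fun y : V => y ord0 j) ^+ 2)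
    (\sum_(j < 4) (2 * x ord0 j *: (fun v : V => v ord0 j))).
  apply: is_diff_sum => j; apply: is_diff_eq (is_diffX 1 (is_diff_entry x j)) _.
  by rewrite expr1.
have sumsqE y : (\sum_(j < 4) (fun y : V => y ord0 j) ^+ 2) y = \sum_(j < 4) y ord0 j ^+ 2.
  by rewrite fct_sumE; apply: eq_bigr => j _; rewrite exprfctE.
have sumsq_pos : 0 < (\sum_(j < 4) (fun y : V => y ord0 j) ^+ 2) x by rewrite sumsqE sumsq_gt0.
have sqrt_diff := is_derive1_diff (is_derive1_sqrt sumsq_pos).
have -> : @enorm R = Num.sqrt \o \sum_(j < 4) (fun y : V => y ord0 j) ^+ 2.
  by apply/funext => y; rewrite /= sumsqE.
apply: is_diff_eq (is_diff_comp sumsq_diff sqrt_diff) _; apply/funext => v /=.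
rewrite sumsqE fct_sumE -/(enorm x) invfM -mulrA mulrCA; congr (_ * _).
rewrite /dot mulr_sumr; apply: eq_bigr => j _.
by rewrite mulrA mulrA mulVf ?mul1r // pnatr_eq0.
Qed.

End EuclideanNorm.

Section RankOne.
Variables (F : comUnitRingType) (n : nat).

Lemma det_rank_one (u : 'cV[F]_n) (v : 'rV[F]_n) :
  \det (1%:M + u *m v) = 1 + (v *m u) ord0 ord0.
Proof.
have block_lu : block_mx 1%:M (- v) u 1%:M =
    block_mx 1%:M 0 u 1%:M *m block_mx (1%:M : 'M_1) (- v) 0 (1%:M + u *m v).
  rewrite mulmx_block ?mul1mx ?mul0mx ?mulmx0 ?mulmx1 ?addr0.
  by rewrite mulmxN addrCA addNr addr0.
have block_ul : block_mx 1%:M (- v) u 1%:M =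
    block_mx (1%:M + v *m u) (- v) 0 1%:M *m block_mx (1%:M : 'M_1) 0 u 1%:M.
  rewrite mulmx_block ?mulmx1 ?mulmx0 ?mul0mx ?mul1mx ?add0r.
  by rewrite mulNmx addrK.
have := congr1 determinant block_lu; rewrite block_ul !det_mulmx !det_ublock !det_lblock !det1.
by rewrite !mul1r !mulr1 => <-; rewrite det_mx11 !mxE eqxx.
Qed.

End RankOne.

Section Cone.
Variables (R : realType) (psi : 'rV[R]_4 -> 'rV[R]_4) (p : 'rV[R]_4) (eps : R).
Local Notation V := 'rV[R]_4.
Implicit Types x y v : V.
Hypothesis eps_gt0 : 0 < eps.
Hypothesis psi_C1 : forall x, on_sphere p eps x -> C1 psi x.
Hypothesis psi_sphere : forall x, on_sphere p eps x -> enorm (psi x) = 1.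

Definition radius x : R := enorm (x - p).
Definition direction x : V := (radius x)^-1 *: (x - p).
Definition sphere_proj x : V := p + eps *: direction x.
(* The extension of [psi] from the sphere, homogeneous of degree 1 around [p]. *)
Definition cone x : V := (radius x / eps) *: psi (sphere_proj x).

Lemma radius_gt0 x : x != p -> 0 < radius x.
Proof. by move=> xp; rewrite enorm_gt0 subr_eq0. Qed.

Lemma on_sphere_neq x : on_sphere p eps x -> x != p.
Proof.
by rewrite /on_sphere => xe; apply: contraTneq eps_gt0 => xp; rewrite -xe xp subrr enorm0 ltxx.
Qed.

Lemma enorm_direction x : x != p -> enorm (direction x) = 1.
Proof. by rewrite -subr_eq0; exact: enorm_normalize. Qed.

Lemma on_sphere_proj x : x != p -> on_sphere p eps (sphere_proj x).
Proof.
move=> xp; rewrite /on_sphere /sphere_proj addrC addKr enormZ enorm_direction //.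
by rewrite mulr1 gtr0_norm.
Qed.

Lemma sphere_proj_id x : on_sphere p eps x -> sphere_proj x = x.
Proof.
rewrite /on_sphere /sphere_proj /direction /radius => ->.
by rewrite scalerA divff ?gt_eqF // scale1r addrC subrK.
Qed.

Lemma cone_sphere x : on_sphere p eps x -> cone x = psi x.
Proof.
by move=> xe; rewrite /cone sphere_proj_id // /radius xe divff ?gt_eqF // scale1r.
Qed.

Lemma cone_center : cone p = 0.
Proof. by rewrite /cone /radius subrr enorm0 mul0r scale0r. Qed.

Lemma enorm_cone x : enorm (cone x) = radius x / eps.
Proof.
have [->|xp] := eqVneq x p; first by rewrite cone_center /radius subrr enorm0 mul0r.
rewrite enormZ psi_sphere ?mulr1; last exact: on_sphere_proj.
by rewrite gtr0_norm // divr_gt0 // radius_gt0.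
Qed.

Lemma is_diff_radius x : x != p -> is_diff x radius (dot (direction x)).
Proof.
rewrite -subr_eq0 => xp.
apply: is_diff_eq (is_diff_comp (is_diff_shift p x) (is_diff_enorm xp)) _.
by apply/funext => v; rewrite /= /direction dotZl.
Qed.

Lemma is_diff_direction x : x != p -> is_diff x direction
  (fun v => (radius x)^-1 *: (v - dot (direction x) v *: direction x)).
Proof.
move=> xp; have r0 : radius x != 0 by rewrite gt_eqF // radius_gt0.
have [radius_diff radiusE] := is_diff_radius xp.
have inv_diff : is_diff x (fun y => (radius y)^-1)
    (fun v => - radius x ^- 2 * dot (direction x) v).
  by split; [exact: differentiableV|rewrite diffV // radiusE].
apply: is_diff_eq (is_diff_scale inv_diff (is_diff_shift p x)) _.
apply/funext => v /=; rewrite [RHS]scalerBr; congr (_ + _).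
by rewrite [in RHS]scalerA -scaleNr {3}/direction scalerA; congr (_ *: _); field.
Qed.

Lemma is_diff_sphere_proj x : x != p -> is_diff x sphere_proj
  (fun v => (eps / radius x) *: (v - dot (direction x) v *: direction x)).
Proof.
move=> /is_diff_direction dir_diff.
apply: is_diff_eq (is_diffD (is_diff_cst p x) (is_diffZ eps dir_diff)) _.
by apply/funext => v; rewrite -scalerA -[RHS]add0r.
Qed.

Lemma is_diff_cone x : x != p -> is_diff x cone (fun v =>
  'd psi (sphere_proj x) (v - dot (direction x) v *: direction x) +
  (dot (direction x) v / eps) *: psi (sphere_proj x)).
Proof.
move=> xp; have r0 : radius x != 0 by rewrite gt_eqF // radius_gt0.
have psi_diff := differentiableP (C1_differentiable (psi_C1 (on_sphere_proj xp))).
have proj_diff := is_diff_comp (is_diff_sphere_proj xp) psi_diff.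
have scale_diff : is_diff x (fun y => radius y / eps) (fun v => dot (direction x) v / eps).
  apply: is_diff_eq (is_diffM (is_diff_radius xp) (is_diff_cst eps^-1 x)) _.
  by apply/funext => v; rewrite scaler0 add0r; exact: mulrC.
apply: is_diff_eq (is_diff_scale scale_diff proj_diff) _.
apply/funext => v /=; congr (_ + _); rewrite linearZ scalerA -[RHS]scale1r; congr (_ *: _).
by field; rewrite r0 gt_eqF.
Qed.

Lemma C1_radius x : x != p -> C1 radius x.
Proof.
rewrite -subr_eq0 => /C1_enorm; apply: (C1_comp (f := fun y : V => y - p)).
exact: C1_constant_diff (is_diff_shift p).
Qed.

Lemma C1_sphere_proj x : x != p -> C1 sphere_proj x.
Proof.
move=> xp; apply: C1D; first exact: C1_cst.
apply: C1_scale; first exact: C1_cst.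
apply: C1_scale; last exact: C1_constant_diff (is_diff_shift p).
by apply: C1V; [exact: C1_radius|rewrite gt_eqF // radius_gt0].
Qed.

Lemma C1_cone x : x != p -> C1 cone x.
Proof.
move=> xp; apply: C1_scale; first by apply: C1M; [exact: C1_radius|exact: C1_cst].
by apply: C1_comp; [exact: C1_sphere_proj|apply: psi_C1; exact: on_sphere_proj].
Qed.

Lemma jacobian_cone x : x != p -> let n := direction x in
  'J cone x = (1%:M - n^T *m n) *m 'J psi (sphere_proj x) +
              n^T *m (eps^-1 *: psi (sphere_proj x)).
Proof.
move=> xp n; have [_ coneE] := is_diff_cone xp.
have dotE (v w : V) : v *m n^T *m w = dot n v *: w.
  rewrite [v *m _]mx11_scalar mul_scalar_mx mxE; congr (_ *: _).
  by apply: eq_bigr => j _; rewrite [n^T _ _]mxE mulrC.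
apply/row_matrixP => i; rewrite rowE [RHS]rowE {1}/jacobian mul_rV_lin1 coneE.
rewrite mulmxDr [_ *m (n^T *m _)]mulmxA dotE; congr (_ + _); last by rewrite scalerA.
by rewrite mulmxA mulmxBr mulmx1 mulmxA dotE mul_rV_lin1.
Qed.

Lemma direction_mul_tr x : x != p -> direction x *m (direction x)^T = 1%:M.
Proof.
move=> /enorm_direction n1; rewrite [LHS]mx11_scalar; congr (_%:M).
rewrite mxE -[RHS](expr1n _ 2) -n1 sqr_enorm.
by apply: eq_bigr => j _; rewrite [_^T _ _]mxE.
Qed.

Lemma jac4_tr x : on_sphere p eps x -> jac4 psi x = ('J psi x)^T.
Proof.
move=> /psi_C1/C1_differentiable psi_diff.
by apply/matrixP => i j; rewrite mxE deriveEjacobian // -rowE mxE [RHS]mxE.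
Qed.

(* With [S] the matrix in [sphere_det], the radial direction [n] satisfies
   [n S^T = psi], so the Jacobian of the cone is [(1 + (eps^-1 - 1) n^T n) S^T]. *)
Lemma det_jacobian_cone x : x != p ->
  \det ('J cone x) = eps^-1 * sphere_det psi p eps (sphere_proj x).
Proof.
move=> xp; have nE : eps^-1 *: (sphere_proj x - p) = direction x.
  by rewrite /sphere_proj addrC addKr scalerA mulVf ?scale1r // gt_eqF.
rewrite jacobian_cone // /sphere_det nE jac4_tr; last exact: on_sphere_proj.
have := direction_mul_tr xp; set n := direction x => nn.
set J := 'J psi _; set y := psi _; set S := J^T + _.
have SE : S^T = (1%:M - n^T *m n) *m J + n^T *m y.
  rewrite /S linearD /= trmxK trmx_mul linearB /= trmx_mul !trmxK mulmxBr mulmxBl mul1mx.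
  by rewrite mulmxA addrA addrAC.
have nS : n *m S^T = y.
  by rewrite SE mulmxDr !mulmxA mulmxBr mulmx1 mulmxA nn !mul1mx subrr mul0mx add0r.
have -> : (1%:M - n^T *m n) *m J + n^T *m (eps^-1 *: y) =
    (1%:M + n^T *m ((eps^-1 - 1) *: n)) *m S^T.
  rewrite [RHS]mulmxDl mul1mx -[in RHS]mulmxA -[_ *: n *m _]scalemxAl nS SE -addrA -mulmxDr.
  by congr (_ + _ *m _); rewrite scalerBl scale1r addrC subrK.
rewrite det_mulmx det_tr det_rank_one -scalemxAl nn !mxE eqxx mulr1.
by rewrite addrC subrK.
Qed.

Lemma continuous_radius : continuous radius.
Proof.
move=> x; apply: (@continuous_comp _ _ _ (fun y => y - p)); last exact: continuous_enorm.
exact: (cvgB cvg_id (cvg_cst p)).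
Qed.

Lemma continuous_cone : continuous cone.
Proof.
move=> x; have [->|xp] := eqVneq x p; last exact: C1_continuous (C1_cone xp).
have radius_cvg0 : radius y / eps @[y --> p] --> (0 : R).
  have -> : 0 = radius p / eps by rewrite /radius subrr enorm0 mul0r.
  exact: (cvgM (@continuous_radius p) (cvg_cst eps^-1)).
have cone_le : \forall y \near p, 0 <= `|cone y| <= radius y / eps.
  apply: (@filterE _ (nbhs p)) => y; rewrite normr_ge0 -enorm_cone; exact: norm_le_enorm.
rewrite /prop_for /continuous_at cone_center; apply: (@norm_cvg0P _ _ _ (nbhs p) _ cone).1.
exact: (squeeze_cvgr cone_le (cvg_cst 0) radius_cvg0).
Qed.

Lemma sphere_proj_dilation (s : R) x : on_sphere p eps x -> 0 < s ->
  sphere_proj (p + s *: (x - p)) = x.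
Proof.
rewrite /on_sphere => xe s0.
rewrite /sphere_proj /direction /radius [p + s *: _]addrC addrK.
rewrite enormZ xe gtr0_norm // !scalerA.
have -> : eps * (s * eps)^-1 * s = 1 by field; rewrite !gt_eqF.
by rewrite scale1r addrC subrK.
Qed.

Lemma radius_dilation (s : R) x : on_sphere p eps x -> 0 < s ->
  radius (p + s *: (x - p)) = s * eps.
Proof. by rewrite /on_sphere /radius [p + _]addrC addrK enormZ => -> s0; rewrite gtr0_norm. Qed.

Lemma compact_annulus (r s : R) : compact [set x | r <= radius x <= s].
Proof.
apply: (@compact_sub_cube _ _ _ (`|p| + s)) => [|x /= /andP[_ xs]].
  have -> : [set x | r <= radius x <= s] = radius @^-1` `[r, s].
    by apply/seteqP; split => x /=; rewrite in_itv.
  by apply: preimage_closed => [x _|]; [exact: continuous_radius|exact: interval_closed].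
rewrite /cube /= -(subrK p x) addrC; apply: le_trans (ler_normD _ _) _.
by rewrite lerD2l; apply: le_trans (norm_le_enorm _) xs.
Qed.

Lemma exists_unit_regular_value : exists2 y : V, enorm y = 1 &
  forall x, on_sphere p eps x -> psi x = y -> sphere_det psi p eps x != 0.
Proof.
have annulus_neq x : eps / 2 <= radius x <= 3 * eps -> x != p.
  move=> /andP[x_ge _]; apply: contraTneq x_ge => ->.
  by rewrite /radius subrr enorm0 -ltNge divr_gt0.
have fourth_gt0 : 0 < 4^-1 :> R by rewrite invr_gt0.
have [z z_near z_regular] := sard (delta_mx ord0 0) (@compact_annulus (eps / 2) (3 * eps))
  (fun x x_annulus => C1_cone (annulus_neq x x_annulus)) fourth_gt0.
pose s := enorm z; have delta1 : `|delta_mx ord0 0 : V| = 1.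
  apply/eqP; rewrite eq_le; apply/andP; split.
    by apply/rV_norm_leP => // i; rewrite mxE normr_nat; case: (_ && _).
  by apply: le_trans (coord_le_norm _ 0); rewrite mxE !eqxx normr1.
have [s_ge s_le] : 1 / 2 <= s /\ s <= 3.
  have := norm_le_enorm z; have := enorm_le_norm z; rewrite -/s => s_ub s_lb.
  have := ler_normD (z - delta_mx ord0 0) (delta_mx ord0 0); rewrite subrK.
  have := ler_distD z (delta_mx ord0 0 : V) 0; rewrite !subr0 [`|_ - z|]distrC.
  by move: z_near; rewrite delta1; lra.
have s0 : 0 < s by lra.
exists (s^-1 *: z) => [|x xe xz]; first by rewrite enormZ gtr0_norm ?invr_gt0 // mulVf // gt_eqF.
pose x' := p + s *: (x - p).
have x'_annulus : eps / 2 <= radius x' <= 3 * eps.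
  by rewrite radius_dilation // ler_pM2r // mulrC ler_pM2r // s_le andbT -div1r.
have /(z_regular x' x'_annulus) : cone x' = z.
  rewrite /cone radius_dilation // sphere_proj_dilation // mulfK ?gt_eqF // xz.
  by rewrite scalerA divff ?scale1r // gt_eqF.
rewrite det_jacobian_cone ?annulus_neq // sphere_proj_dilation // mulf_eq0 negb_or.
by case/andP.
Qed.

End Cone.

Section Jacobian.
Variables (R : realType) (m n : nat).
Implicit Types f df : 'rV[R]_m.+1 -> 'rV[R]_n.+1.

Lemma mul_jacobian f df x v : is_diff x f df -> v *m 'J f x = df v.
Proof. by move=> [_ <-]; rewrite /jacobian mul_rV_lin1. Qed.

Lemma jacobian_subr f c x : differentiable f x -> 'J (fun y => f y - c) x = 'J f x.
Proof.
move=> /differentiableP f_diff; apply/row_matrixP => i; rewrite [LHS]rowE [RHS]rowE.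
have fc_diff := is_diffB f_diff (is_diff_cst c x).
by rewrite [LHS](mul_jacobian _ fc_diff) [RHS](mul_jacobian _ f_diff) [LHS]subr0.
Qed.

End Jacobian.

Section LocalDegree.
Variables (R : realType) (psi : 'rV[R]_4 -> 'rV[R]_4) (p : 'rV[R]_4) (eps : R).
Variables (M : nat) (d : int).
Local Notation V := 'rV[R]_4.
Hypothesis eps_gt0 : 0 < eps.
Hypothesis psi_C1 : forall x, on_sphere p eps x -> C1 psi x.
Hypothesis psi_sphere : forall x, on_sphere p eps x -> enorm (psi x) = 1.
Hypothesis psi_degree : sphere_map_degree psi p eps d.
Hypothesis ball_in_cube : `|p| + eps < M%:R.
Local Notation cone := (cone psi p eps).

Lemma cube_boundary_far (x : V) : cube_boundary M%:R x -> eps < radius p x.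
Proof.
move=> xM; rewrite ltNge; apply/negP => x_le.
move: ball_in_cube; rewrite -xM ltNge => /negP; apply.
rewrite -{1}(subrK p x) addrC; apply: le_trans (ler_normD _ _) _.
by rewrite lerD2l; apply: le_trans (norm_le_enorm _) x_le.
Qed.

Lemma cone_eq_unit (x y : V) : enorm y = 1 -> (cone x = y) <-> (on_sphere p eps x /\ psi x = y).
Proof.
move=> y1; split=> [xy|[xe <-]]; last exact: cone_sphere.
have xe : on_sphere p eps x.
  have := enorm_cone eps_gt0 psi_sphere x; rewrite xy y1 => /(congr1 (fun r => r * eps)).
  by rewrite mul1r divfK ?gt_eqF.
by split; rewrite // -xy cone_sphere.
Qed.

Lemma has_degree_cone : has_degree M cone d.
Proof.
have cont_cone := continuous_cone eps_gt0 psi_C1 psi_sphere.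
have [y y1 y_regular] := exists_unit_regular_value eps_gt0 psi_C1.
have [s [s_uniq s_fiber <-]] := psi_degree y1 y_regular.
have cont_cone_sub : continuous (fun x => cone x - y).
  by move=> x; exact: (cvgB (cont_cone x) (cvg_cst y)).
apply: (has_degree_segment cont_cone_sub cont_cone) => [x t xM /andP[t0 t1]|].
  rewrite scalerBr addrAC -scalerDl subrK scale1r subr_eq0.
  apply: contraTneq (cube_boundary_far xM) => cone_x.
  have := enorm_cone eps_gt0 psi_sphere x; rewrite cone_x enormZ y1 mulr1 => radius_x.
  rewrite -leNgt -[leRHS]mul1r -ler_pdivrMr // -radius_x ger0_norm ?subr_ge0 //.
  by rewrite gerBl.
have s_jacobian x : x \in s -> [/\ x != p, on_sphere p eps x &
    'J (fun x => cone x - y) x = 'J cone x].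
  move=> /s_fiber[xe _]; have xp := on_sphere_neq eps_gt0 xe.
  have cone_diff := C1_differentiable (C1_cone eps_gt0 psi_C1 xp).
  by split; [exact: xp|exact: xe|exact: jacobian_subr cone_diff].
have -> : \sum_(x <- s) (if 0 < sphere_det psi p eps x then 1 else -1 : int) =
    \sum_(x <- s) sgz (\det ('J (fun x => cone x - y) x)).
  apply: eq_big_seq => x /[dup]/s_fiber[xe xy] /s_jacobian[xp _ ->].
  rewrite det_jacobian_cone // sphere_proj_id // sgzM gtr0_sgz ?invr_gt0 // mul1r.
  have := y_regular x xe xy; case: ltgtP => // det_x _.
    by rewrite gtr0_sgz.
  by rewrite ltr0_sgz.
apply: (has_degree_regular cont_cone_sub s_uniq) => [x _ /eqP|x x_s].
  by rewrite subr_eq0 => /eqP/(cone_eq_unit _ y1)/s_fiber.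
have [xp _ ->] := s_jacobian x x_s; have [xe xy] := (s_fiber x).2 x_s; split.
- apply: le_lt_trans ball_in_cube; rewrite -{1}(subrK p x) addrC.
  by apply: le_trans (ler_normD _ _) _; rewrite lerD2l -xe; exact: norm_le_enorm.
- by rewrite cone_sphere // xy subrr.
- by apply: differentiableB => //; apply: C1_differentiable; exact: C1_cone.
- by rewrite det_jacobian_cone // sphere_proj_id // mulf_neq0 ?y_regular // invr_eq0 gt_eqF.
Qed.

End LocalDegree.

Section SumOfLocalDegrees.
Variables (R : realType) (phi : 'rV[R]_4 -> 'rV[R]_4) (M : nat).
Local Notation V := 'rV[R]_4.
Local Notation normalize := (fun v : V => (enorm v)^-1 *: v).
Hypothesis phi_C1 : forall x, C1 phi x.

Lemma has_degree_local (p : V) (eps : R) (d : int) : 0 < eps -> `|p| + eps < M%:R ->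
  (forall x, on_sphere p eps x -> phi x != 0) ->
  sphere_map_degree (normalize \o phi) p eps d ->
  has_degree M (phi \o retraction (@enorm R) p eps) d.
Proof.
move=> eps0 ball_M phi_neq0 phi_deg; set psi := normalize \o phi in phi_deg.
have psi_C1 x : on_sphere p eps x -> C1 psi x.
  move=> /phi_neq0 phi0; apply: C1_scale; last exact: phi_C1.
  apply: C1V; last by rewrite enorm_eq0.
  by apply: C1_comp; [exact: phi_C1|exact: C1_enorm].
have psi_sphere x : on_sphere p eps x -> enorm (psi x) = 1.
  by move=> /phi_neq0; exact: enorm_normalize.
have cone_deg := has_degree_cone eps0 psi_C1 psi_sphere phi_deg ball_M.
pose l x := enorm (phi (sphere_proj p eps x)) * (radius p x / eps)^-1.
apply: (has_degree_rouche (l := l) (continuous_cone eps0 psi_C1 psi_sphere) _ _ cone_deg) => x.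
  apply: continuous_comp; last exact: C1_continuous.
  exact: (continuous_retraction (@continuous_enorm R)).
move=> xM; have x_far := cube_boundary_far ball_M xM.
have radius0 : 0 < radius p x by apply: lt_trans x_far.
have xp : x != p by apply: contraTneq radius0 => ->; rewrite /radius subrr enorm0 ltxx.
have x_proj := on_sphere_proj eps0 xp.
have -> : (phi \o retraction (@enorm R) p eps) x = l x *: cone psi p eps x.
  rewrite /= /retraction max_r ?(ltW x_far) // -scalerA -/(direction p x) -/(sphere_proj p eps x).
  rewrite scalerA mulfVK ?mulf_neq0 ?invr_eq0 ?gt_eqF // scalerA divff ?scale1r //.
  by rewrite enorm_eq0 phi_neq0.
rewrite subrr normr0 mulr_gt0 //.
  by rewrite mulr_gt0 ?enorm_gt0 ?phi_neq0 // invr_gt0 divr_gt0.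
by rewrite normr_gt0 -enorm_eq0 enorm_cone // mulf_neq0 ?invr_eq0 ?gt_eqF.
Qed.

Lemma has_degree_sum_local (ps : seq V) (eps : V -> R) (d : V -> int) : uniq ps ->
  (forall x, `|x| <= M%:R -> phi x = 0 -> x \in ps) ->
  (forall p, p \in ps -> [/\ 0 < eps p, `|p| + eps p < M%:R,
     forall x, enorm (x - p) <= eps p -> phi x = 0 -> x = p &
     sphere_map_degree (normalize \o phi) p (eps p) (d p)]) ->
  has_degree M phi (\sum_(p <- ps) d p).
Proof.
move=> ps_uniq phi_zeros ps_local.
have phi_cont : continuous phi by move=> x; exact: C1_continuous.
apply: (has_degree_sum_retraction (@continuous_enorm R) (@enormZ R) (eps := eps)) => // p.
move=> /ps_local[eps0 ball_M p_zero p_deg]; split=> //.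
apply: (has_degree_local eps0 ball_M _ p_deg) => x xe; have := on_sphere_neq eps0 xe.
by apply: contra_neq => /(p_zero x) -> //; rewrite -xe.
Qed.

End SumOfLocalDegrees.

(** * Mixed polynomials *)

Local Open Scope complex_scope.

Section ComplexParts.
Variable R : realType.
Local Notation C := (R[i]).
Local Notation Re := (@complex.Re R).
Local Notation Im := (@complex.Im R).
Implicit Types z w : C.

Lemma ReD z w : Re (z + w) = Re z + Re w.
Proof. by case: z; case: w. Qed.

Lemma ImD z w : Im (z + w) = Im z + Im w.
Proof. by case: z; case: w. Qed.

Lemma ReM z w : Re (z * w) = Re z * Re w - Im z * Im w.
Proof. by case: z; case: w. Qed.

Lemma ImM z w : Im (z * w) = Re z * Im w + Im z * Re w.
Proof. by case: z; case: w. Qed.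

Lemma ReJ z : Re (conjc z) = Re z.
Proof. by case: z. Qed.

Lemma ImJ z : Im (conjc z) = - Im z.
Proof. by case: z. Qed.

Lemma complex_partsP z w : z = w <-> Re z = Re w /\ Im z = Im w.
Proof. by split=> [->//|]; case: z => a b; case: w => c d /= [-> ->]. Qed.

Lemma realc_eq0 (r : R) : (r%:C == 0) = (r == 0).
Proof. exact: (inj_eq (@complexI R) r 0). Qed.

Definition sqnorm z : R := Re z ^+ 2 + Im z ^+ 2.

Lemma sqnorm_ge0 z : 0 <= sqnorm z.
Proof. by rewrite addr_ge0 ?sqr_ge0. Qed.

Lemma mul_conjc z : z * conjc z = (sqnorm z)%:C.
Proof. by rewrite -sqr_normc -add_Re2_Im2. Qed.

Lemma sqnorm_eq0 z : (sqnorm z == 0) = (z == 0).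
Proof. by rewrite -realc_eq0 -mul_conjc mulf_eq0 conjc_eq0 orbb. Qed.

Lemma sqnorm_gt0 z : z != 0 -> 0 < sqnorm z.
Proof. by rewrite -sqnorm_eq0 => z0; rewrite lt_neqAle eq_sym z0 sqnorm_ge0. Qed.

Lemma sqnorm_real (r : R) : sqnorm r%:C = r ^+ 2.
Proof. by rewrite /sqnorm /= expr0n addr0. Qed.

Lemma sqnormM z w : sqnorm (z * w) = sqnorm z * sqnorm w.
Proof. by rewrite /sqnorm ReM ImM; ring. Qed.

Lemma sqnormX z k : sqnorm (z ^+ k) = sqnorm z ^+ k.
Proof.
elim: k => [|k IH]; first by rewrite !expr0 (sqnorm_real 1) expr1n.
by rewrite !exprS sqnormM IH.
Qed.

End ComplexParts.

Section ComplexC1.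
Variables (R : realType) (V : normedModType R).
Local Notation C := (R[i]).
Implicit Types z w : V -> C.

Definition C1_complex z := forall x,
  C1 (fun y => complex.Re (z y)) x /\ C1 (fun y => complex.Im (z y)) x.

Lemma C1_complex_cst c : C1_complex (fun=> c).
Proof. by move=> x; split; exact: C1_cst. Qed.

Lemma C1_complexD z w : C1_complex z -> C1_complex w -> C1_complex (z + w).
Proof.
move=> Cz Cw x; have [Rez Imz] := Cz x; have [Rew Imw] := Cw x; split.
  have -> : (fun y => complex.Re ((z + w) y)) = (fun y => complex.Re (z y) + complex.Re (w y)).
    by apply/funext => y; exact: ReD.
  exact: C1D.
have -> : (fun y => complex.Im ((z + w) y)) = (fun y => complex.Im (z y) + complex.Im (w y)).
  by apply/funext => y; exact: ImD.
exact: C1D.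
Qed.

Lemma C1_complexM z w : C1_complex z -> C1_complex w -> C1_complex (fun y => z y * w y).
Proof.
move=> Cz Cw x; have [Rez Imz] := Cz x; have [Rew Imw] := Cw x; split.
  have -> : (fun y => complex.Re (z y * w y)) = (fun y => complex.Re (z y) * complex.Re (w y) +
      -1 * (complex.Im (z y) * complex.Im (w y))).
    by apply/funext => y; rewrite ReM mulN1r.
  by apply: C1D; [exact: C1M|apply: C1M; [exact: C1_cst|exact: C1M]].
have -> : (fun y => complex.Im (z y * w y)) = (fun y => complex.Re (z y) * complex.Im (w y) +
    complex.Im (z y) * complex.Re (w y)).
  by apply/funext => y; exact: ImM.
by apply: C1D; exact: C1M.
Qed.

Lemma C1_complexJ z : C1_complex z -> C1_complex (fun y => conjc (z y)).
Proof.
move=> Cz x; have [Rez Imz] := Cz x; split.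
  by under eq_fun do rewrite ReJ.
have -> : (fun y => complex.Im (conjc (z y))) = (fun y => -1 * complex.Im (z y)).
  by apply/funext => y; rewrite ImJ mulN1r.
by apply: C1M; [exact: C1_cst|exact: Imz].
Qed.

Lemma C1_complexX k z : C1_complex z -> C1_complex (fun y => z y ^+ k).
Proof.
move=> Cz; elim: k => [|k IH]; first exact: C1_complex_cst.
have -> : (fun y => z y ^+ k.+1) = (fun y => z y * z y ^+ k) by apply/funext => y; exact: exprS.
exact: C1_complexM.
Qed.

Lemma C1_complex_sum (I : Type) (s : seq I) (f : I -> V -> C) :
  (forall i, C1_complex (f i)) -> C1_complex (fun y => \sum_(i <- s) f i y).
Proof.
move=> Cf; have -> : (fun y => \sum_(i <- s) f i y) = \sum_(i <- s) f i.
  by apply/funext => y; rewrite fct_sumE.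
elim/big_ind : _ => [|z w|i _]; [exact: C1_complex_cst|exact: C1_complexD|exact: Cf].
Qed.

Lemma C1_mp_eval F (x0 x1 x2 : V -> C) : C1_complex x0 -> C1_complex x1 -> C1_complex x2 ->
  C1_complex (fun y => mp_eval F (x0 y) (x1 y) (x2 y)).
Proof.
move=> Cx0 Cx1 Cx2; apply: C1_complex_sum => m.
have factor0 := C1_complexM (C1_complex_cst (mp_coef F m)) (C1_complexX m.1.1.1 Cx0).
have factor1 := C1_complexM factor0 (C1_complexX m.1.1.2 Cx1).
have factor2 := C1_complexM factor1 (C1_complexX m.1.2 Cx2).
have conj_factor0 := C1_complexM factor2 (C1_complexX m.2.1.1 (C1_complexJ Cx0)).
have conj_factor1 := C1_complexM conj_factor0 (C1_complexX m.2.1.2 (C1_complexJ Cx1)).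
exact: C1_complexM conj_factor1 (C1_complexX m.2.2 (C1_complexJ Cx2)).
Qed.

End ComplexC1.

Section Vec.
Variable R : realType.
Local Notation C := (R[i]).
Local Notation V := 'rV[R]_4.
Implicit Types (x : V) (z w : C).

Definition vec z w : V := \row_(j < 4)
  (if j == 0 :> nat then complex.Re z else if j == 1 :> nat then complex.Im z
   else if j == 2 :> nat then complex.Re w else complex.Im w).

Lemma z1_of_vec z w : z1_of (vec z w) = z.
Proof. by rewrite /z1_of !mxE; case: z. Qed.

Lemma z2_of_vec z w : z2_of (vec z w) = w.
Proof. by rewrite /z2_of !mxE; case: w. Qed.

Lemma vec_z1_z2 x : vec (z1_of x) (z2_of x) = x.
Proof.
apply/rowP => j; rewrite mxE.
by case: j => -[|[|[|[|//]]]] ij /=; congr (x _ _); apply/val_inj.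
Qed.

Lemma z1_ofZ (r : R) x : z1_of (r *: x) = r%:C * z1_of x.
Proof. by apply/complex_partsP; rewrite ReM ImM /z1_of !mxE /= !mul0r subr0 addr0. Qed.

Lemma z2_ofZ (r : R) x : z2_of (r *: x) = r%:C * z2_of x.
Proof. by apply/complex_partsP; rewrite ReM ImM /z2_of !mxE /= !mul0r subr0 addr0. Qed.

Lemma vecDZ (s t : R) z w z' w' :
  s *: vec z w + t *: vec z' w' = vec (s%:C * z + t%:C * z') (s%:C * w + t%:C * w').
Proof.
apply/rowP => j; rewrite !mxE !ReD !ImD !ReM !ImM /= !mul0r !subr0 !addr0.
by do 3?case: ifP.
Qed.

Lemma z1_ofD x (y : V) : z1_of (x + y) = z1_of x + z1_of y.
Proof. by rewrite /z1_of !mxE. Qed.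

Lemma z2_ofD x (y : V) : z2_of (x + y) = z2_of x + z2_of y.
Proof. by rewrite /z2_of !mxE. Qed.

Lemma vec00 : vec 0 0 = 0.
Proof. by apply/rowP => j; rewrite !mxE; do 3?case: ifP. Qed.

Lemma vec_eq0 z w : (vec z w == 0) = (z == 0) && (w == 0).
Proof.
apply/eqP/andP => [zw0|[/eqP-> /eqP->]]; last exact: vec00.
by rewrite -(z1_of_vec z w) -{2}(z2_of_vec z w) zw0 -vec00 z1_of_vec z2_of_vec eqxx.
Qed.

Definition mul_parts z w x : V := vec (z * z1_of x) (w * z2_of x).

Lemma mul_partsDZ z w (s t : R) x (y : V) :
  mul_parts z w (s *: x + t *: y) = s *: mul_parts z w x + t *: mul_parts z w y.
Proof.
rewrite vecDZ /mul_parts z1_ofD z2_ofD !z1_ofZ !z2_ofZ !mulrDr.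
by congr (vec (_ + _) (_ + _)); exact: mulrCA.
Qed.

Lemma mul_parts_eq0 z w x : z != 0 -> w != 0 -> (mul_parts z w x == 0) = (x == 0).
Proof.
move=> /negPf z0 /negPf w0.
by rewrite vec_eq0 !mulf_eq0 z0 w0 /= -vec_eq0 vec_z1_z2.
Qed.

Lemma cube_boundary_parts_neq0 (r : R) x : 0 < r -> cube_boundary r x ->
  (z1_of x, z2_of x) != (0, 0).
Proof.
move=> r0 xr; rewrite xpair_eqE -vec_eq0 vec_z1_z2 -normr_eq0.
by rewrite (xr : `|x| = r) gt_eqF.
Qed.

Lemma C1_vec (U : normedModType R) (f g : U -> C) (u : U) : C1_complex f -> C1_complex g ->
  C1 (fun y => vec (f y) (g y)) u.
Proof.
move=> Cf Cg; have [Ref Imf] := Cf u; have [Reg Img] := Cg u; apply: C1_rV => j.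
have -> : (fun y => vec (f y) (g y) ord0 j) = (fun y =>
    if j == 0 :> nat then complex.Re (f y) else if j == 1 :> nat then complex.Im (f y)
    else if j == 2 :> nat then complex.Re (g y) else complex.Im (g y)).
  by apply/funext => y; rewrite mxE.
case: (nat_of_ord j == 0%N); first exact: Ref.
case: (nat_of_ord j == 1%N); first exact: Imf.
by case: (nat_of_ord j == 2%N); [exact: Reg|exact: Img].
Qed.

Lemma continuous_vec (U : normedModType R) (f g : U -> C) : C1_complex f -> C1_complex g ->
  continuous (fun y => vec (f y) (g y)).
Proof. by move=> Cf Cg u; apply: C1_continuous; exact: C1_vec. Qed.

Lemma C1_z1_of : C1_complex (@z1_of R).
Proof. by move=> x; split; exact: C1_coord. Qed.

Lemma C1_z2_of : C1_complex (@z2_of R).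
Proof. by move=> x; split; exact: C1_coord. Qed.

Lemma has_degree_vec_segment (M : nat) (f g f' g' : V -> C) d :
  C1_complex f -> C1_complex g -> C1_complex f' -> C1_complex g' ->
  (forall x (t : R), cube_boundary M%:R x -> 0 <= t <= 1 ->
     (1 - t)%:C * f x + t%:C * f' x = 0 -> (1 - t)%:C * g x + t%:C * g' x <> 0) ->
  has_degree M (fun x => vec (f x) (g x)) d ->
  has_degree M (fun x => vec (f' x) (g' x)) d.
Proof.
move=> Cf Cg Cf' Cg' seg_neq0.
apply: (has_degree_segment (continuous_vec Cf Cg) (continuous_vec Cf' Cg')) => x t xM t01.
rewrite vecDZ vec_eq0; apply/negP => /andP[/eqP f_zero /eqP]; exact: seg_neq0 f_zero.
Qed.

End Vec.

Section MixedPower.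
Variable R : realType.
Local Notation C := (R[i]).
Implicit Types z w : C.

Definition mpow (p q : nat) z : C := z ^+ p * conjc z ^+ q.

Lemma mpowM p q z w : mpow p q (z * w) = mpow p q z * mpow p q w.
Proof. by rewrite /mpow rmorphM !exprMn mulrACA. Qed.

Lemma mpow_neq0 p q z : z != 0 -> mpow p q z != 0.
Proof. by move=> z0; rewrite mulf_neq0 // expf_neq0 // conjc_eq0. Qed.

Lemma C1_mpow (V : normedModType R) p q (z : V -> C) : C1_complex z ->
  C1_complex (fun y => mpow p q (z y)).
Proof.
move=> Cz; exact: C1_complexM (C1_complexX p Cz) (C1_complexX q (C1_complexJ Cz)).
Qed.

Definition bihomogeneous (F : mixed_poly R) (p q : nat) := forall l x0 x1 x2 : C,
  mp_eval F (l * x0) (l * x1) (l * x2) = mpow p q l * mp_eval F x0 x1 x2.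

Lemma strongly_polar_bihomogeneous (F : mixed_poly R) dr d :
  strongly_polar_homogeneous F dr d ->
  exists p q : nat, p%:Z - q%:Z = d /\ bihomogeneous F p q.
Proof.
move=> F_homog.
have [[k k_coef]|no_coef] := pselect (exists k, mp_coef F k != 0); last first.
  have F0 x0 x1 x2 : mp_eval F x0 x1 x2 = 0.
    rewrite /mp_eval big1 // => k _; have [->|k_coef] := eqVneq (mp_coef F k) 0.
      by rewrite !mul0r.
    by case: no_coef; exists k.
  case: d {F_homog} => e; [exists e, 0%N|exists 0%N, e.+1];
    by rewrite ?subr0 ?sub0r ?NegzE; split=> // l x0 x1 x2; rewrite !F0 mulr0.
have [k_radial k_polar] := F_homog k k_coef.
exists (nu_deg k), (mu_deg k); split => // l x0 x1 x2.
rewrite /mp_eval mulr_sumr; apply: eq_bigr => j _.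
have [->|j_coef] := eqVneq (mp_coef F j) 0; first by rewrite !mul0r mulr0.
have [j_radial j_polar] := F_homog j j_coef.
have -> : nu_deg k = nu_deg j by lia.
have -> : mu_deg k = mu_deg j by lia.
by rewrite /mpow !rmorphM /= !exprMn /nu_deg /mu_deg !exprD; ring.
Qed.

End MixedPower.

Section LeadingPart.
Variables (R : realType) (F G : mixed_poly R) (p q p' q' : nat).
Local Notation C := (R[i]).
Local Notation V := 'rV[R]_4.
Implicit Types (x u : V) (s t : R).
Hypothesis F_homog : bihomogeneous F p q.
Hypothesis G_homog : bihomogeneous G p' q'.
Hypothesis no_zero_at_infinity : forall x1 x2 : C, (x1, x2) != (0, 0) ->
  ~ (mp_eval F 0 x1 x2 = 0 /\ mp_eval G 0 x1 x2 = 0).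

(* [curve_pair 1] is the affine map [(f, g)] and [curve_pair 0] its leading part. *)
Definition curve_pair s x : V :=
  vec (mp_eval F s%:C (z1_of x) (z2_of x)) (mp_eval G s%:C (z1_of x) (z2_of x)).

Lemma C1_curve_pair s x : C1 (curve_pair s) x.
Proof.
have C1_slice Q : C1_complex (fun y : V => mp_eval Q s%:C (z1_of y) (z2_of y)).
  exact: C1_mp_eval (C1_complex_cst s%:C) (@C1_z1_of R) (@C1_z2_of R).
exact: C1_vec (C1_slice F) (C1_slice G).
Qed.

Lemma continuous_curve_pair : continuous (fun e : R * V => curve_pair e.1 e.2).
Proof.
have C1_fst (e : R * V) : C1 (@fst R V) e by apply: C1_linear => ?; exact: cvg_fst.
have C1_snd (e : R * V) : C1 (@snd R V) e by apply: C1_linear => ?; exact: cvg_snd.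
have C1_s : C1_complex (fun e : R * V => e.1%:C).
  by move=> e; split; [exact: C1_fst|exact: C1_cst].
have C1_coord_snd i (e : R * V) : C1 (fun e : R * V => e.2 ord0 i : R) e.
  exact: C1_comp (C1_snd e) (C1_coord e.2 i).
have C1_z1 : C1_complex (fun e : R * V => z1_of e.2) by move=> e; split; exact: C1_coord_snd.
have C1_z2 : C1_complex (fun e : R * V => z2_of e.2) by move=> e; split; exact: C1_coord_snd.
exact: continuous_vec (C1_mp_eval F C1_s C1_z1 C1_z2) (C1_mp_eval G C1_s C1_z1 C1_z2).
Qed.

Lemma leading_part_lbound : exists2 e : R, 0 < e &
  forall u, cube_boundary 1 u -> e <= `|curve_pair 0 u|.
Proof.
apply: compact_norm_lbound; first exact: compact_cube_boundary.
  by move=> u; apply: C1_continuous; exact: C1_curve_pair.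
move=> u u1; rewrite vec_eq0; apply/negP => /andP[/eqP F0 /eqP G0].
exact: no_zero_at_infinity (cube_boundary_parts_neq0 ltr01 u1) (conj F0 G0).
Qed.

Lemma near_leading_part (e : R) : 0 < e -> \forall N \near \oo, forall u,
  cube_boundary 1 u -> `|curve_pair N.+1%:R^-1 u - curve_pair 0 u| < e.
Proof.
move=> e0; have cX := compact_setX (@compact_set1 _ (0 : R)) (@compact_cube_boundary R 4 1).
apply: filterS (heine cX continuous_curve_pair e0) => N close u u1.
rewrite distrC; apply: (close (0, u) (N.+1%:R^-1, u)) => //.
rewrite prod_normE /= subr0 subrr normr0 ge_max invr_ge0 ler0n andbT.
by rewrite ger0_norm.
Qed.

Lemma curve_pair_dilation (r s : R) u :
  curve_pair (r * s) (r *: u) = mul_parts (mpow p q r%:C) (mpow p' q' r%:C) (curve_pair s u).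
Proof.
rewrite /mul_parts z1_of_vec z2_of_vec /curve_pair z1_ofZ z2_ofZ rmorphM.
by rewrite F_homog G_homog.
Qed.

Lemma near_infinity_segment_neq0 : \forall N \near \oo, forall x t,
  cube_boundary N.+1%:R x -> 0 <= t <= 1 ->
  (1 - t) *: curve_pair 1 x + t *: curve_pair 0 x != 0.
Proof.
have [e e0 leading_ge] := leading_part_lbound.
apply: filterS (near_leading_part e0) => N close x t xN /andP[t0 t1].
have N0 : N.+1%:R != 0 :> R by rewrite pnatr_eq0.
pose u : V := N.+1%:R^-1 *: x.
have u1 : cube_boundary 1 u.
  by rewrite /cube_boundary /= normrZ (xN : `|x| = _) ger0_norm ?invr_ge0 // mulVf.
have xE : x = N.+1%:R *: u by rewrite scalerA divff ?scale1r.
have -> : (1 - t) *: curve_pair 1 x + t *: curve_pair 0 x =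
    mul_parts (mpow p q N.+1%:R%:C) (mpow p' q' N.+1%:R%:C)
      ((1 - t) *: curve_pair N.+1%:R^-1 u + t *: curve_pair 0 u).
  rewrite mul_partsDZ; congr ((1 - t) *: _ + t *: _).
    by rewrite -curve_pair_dilation (divff N0) -xE.
  by rewrite -curve_pair_dilation mulr0 -xE.
rewrite mul_parts_eq0 ?mpow_neq0 ?realc_eq0 //.
rewrite addrC -{1}[t](subKr 1); apply: (segment_neq0 (l := 1)); last by lra.
by rewrite scale1r mul1r (lt_le_trans (close u u1)) // leading_ge.
Qed.

End LeadingPart.

Section GenericDeformation.
Variable R : realType.
Local Notation C := (R[i]).
Local Notation V := 'rV[R]_4.

Definition off_ray (c al : C) := forall t : R, 0 <= t -> al + t%:C * c != 0.

Lemma off_ray_segment (c al : C) (s t : R) : off_ray c al -> 0 <= s -> 0 < t ->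
  t%:C * al + s%:C * c != 0.
Proof.
move=> al_c s0 t0; have -> : t%:C * al + s%:C * c = t%:C * (al + (s / t)%:C * c).
  by rewrite mulrDr mulrA -rmorphM mulrCA divff ?gt_eqF // mulr1.
by apply: mulf_neq0; [rewrite realc_eq0 gt_eqF|apply: al_c; rewrite divr_ge0 // ltW].
Qed.

Lemma half_plane_off_ray (c : C) : exists2 s : R, `|s| = 1 &
  forall al : C, `|complex.Im al - s| < 1 -> off_ray c al /\ off_ray 1 al.
Proof.
have [s [s1 ss sc]] : exists s : R, [/\ `|s| = 1, s * s = 1 & 0 <= s * complex.Im c].
  have [c0|c0] := leP 0 (complex.Im c).
    by exists 1; rewrite normr1 !mul1r.
  by exists (-1); rewrite normrN1 mulrNN !mul1r mulN1r oppr_ge0 ltW.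
exists s => // al al_s; have al_pos : 0 < s * complex.Im al.
  have : `|s * (complex.Im al - s)| < 1 by rewrite normrM s1 mul1r.
  by rewrite mulrBr ss ltr_norml; lra.
have off c' : 0 <= s * complex.Im c' -> off_ray c' al.
  move=> c'_pos t t0; apply/eqP => /(congr1 (fun z => s * complex.Im z)) /eqP.
  rewrite ImD ImM /= mul0r addr0 mulrDr mulrCA mulr0 gt_eqF //.
  by rewrite ltr_pwDl // mulr_ge0.
by split; apply: off => //=; rewrite mulr0.
Qed.

Variables (F G : mixed_poly R) (p q p' q' : nat).
Hypothesis F_homog : bihomogeneous F p q.
Hypothesis G_homog : bihomogeneous G p' q'.
Hypothesis no_zero_at_infinity : forall x1 x2 : C, (x1, x2) != (0, 0) ->
  ~ (mp_eval F 0 x1 x2 = 0 /\ mp_eval G 0 x1 x2 = 0).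
Local Notation f0 := (mp_eval F 0).
Local Notation g0 := (mp_eval G 0).
Local Notation monomials al be :=
  (fun x : V => vec (al * mpow p q (z1_of x)) (be * mpow p' q' (z2_of x))).

(* The pairs [(al, be)] with [al = - t f0(1, w)] and [be k = - t g0(1, w)], where
   [k = mpow p' q' w] and [t = - s |k|^2], parametrized without division. *)
Definition exceptional_pair (x : V) : V :=
  let s := (x ord0 2)%:C in let k := mpow p' q' (z1_of x) in
  vec (s * k * conjc k * f0 1 (z1_of x)) (s * conjc k * g0 1 (z1_of x)).

Lemma exceptional_pair_surj (w al be : C) (t : R) : w != 0 ->
  al + t%:C * f0 1 w = 0 -> be * mpow p' q' w + t%:C * g0 1 w = 0 ->
  exists x, exceptional_pair x = vec al be.
Proof.
move=> w0 /eqP; rewrite addr_eq0 => /eqP-> /eqP.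
set k := mpow p' q' w; have k0 : k != 0 by exact: mpow_neq0.
have sqnorm_k : sqnorm k != 0 by rewrite sqnorm_eq0.
rewrite addr_eq0 => /eqP bk.
pose s := - t / sqnorm k.
have sk : s%:C * (sqnorm k)%:C = - t%:C by rewrite -rmorphM mulfVK ?rmorphN.
exists (vec w s%:C); rewrite /exceptional_pair z1_of_vec -/k mxE /=; congr vec.
  by rewrite -(mulrA s%:C) mul_conjc sk mulNr.
by apply: (mulIf k0); rewrite bk mulrAC -(mulrA s%:C) [conjc k * k]mulrC mul_conjc sk mulNr.
Qed.

Lemma C1_exceptional_pair x : C1 exceptional_pair x.
Proof.
have C1_s : C1_complex (fun x : V => (x ord0 2)%:C).
  by move=> y; split; [exact: C1_coord|exact: C1_cst].
have C1_k := C1_mpow p' q' (@C1_z1_of R); have C1_kJ := C1_complexJ C1_k.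
have C1_slice Q : C1_complex (fun y : V => mp_eval Q 0 1 (z1_of y)).
  exact: C1_mp_eval (C1_complex_cst 0) (C1_complex_cst 1) (@C1_z1_of R).
apply: C1_vec; first exact: C1_complexM (C1_complexM (C1_complexM C1_s C1_k) C1_kJ) (C1_slice F).
exact: C1_complexM (C1_complexM C1_s C1_kJ) (C1_slice G).
Qed.

Lemma exceptional_pair_avoids (c : V) : exists2 y, `|y - c| < 1 &
  forall x, exceptional_pair x <> y.
Proof.
apply: critical_image_avoids ltr01 => x; first exact: C1_exceptional_pair.
apply: (det_jacobian_invariant_direction (v := delta_mx ord0 3)).
- by apply/eqP => /rowP/(_ 3)/eqP; rewrite !mxE eqxx oner_eq0.
- exact: C1_differentiable (C1_exceptional_pair x).
move=> {}x t; have shiftE i : i != 3 -> (x + t *: delta_mx ord0 3) ord0 i = x ord0 i.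
  by move=> /negPf i3; rewrite !mxE i3 andbF mulr0 addr0.
by rewrite /exceptional_pair /z1_of !shiftE.
Qed.

Lemma generic_pair : exists al be : C, [/\ off_ray (f0 1 0) al /\ off_ray 1 al,
  off_ray (g0 0 1) be /\ off_ray 1 be &
  forall (w : C) (t : R), w != 0 -> al + t%:C * f0 1 w = 0 ->
    be * mpow p' q' w + t%:C * g0 1 w <> 0].
Proof.
have [s s1 s_off] := half_plane_off_ray (f0 1 0).
have [r r1 r_off] := half_plane_off_ray (g0 0 1).
pose c := vec (Complex 0 s) (Complex 0 r).
have [y y_near y_avoid] := exceptional_pair_avoids c.
exists (z1_of y), (z2_of y); split.
- by apply: s_off; apply: le_lt_trans y_near; have := coord_le_norm (y - c) 1; rewrite !mxE.
- by apply: r_off; apply: le_lt_trans y_near; have := coord_le_norm (y - c) 3; rewrite !mxE.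
move=> w t w0 al_eq be_eq; have [x] := exceptional_pair_surj w0 al_eq be_eq.
by rewrite vec_z1_z2; exact: y_avoid.
Qed.

Lemma bihomogeneous_infinity Q a b (l x1 x2 : C) : bihomogeneous Q a b ->
  mp_eval Q 0 (l * x1) (l * x2) = mpow a b l * mp_eval Q 0 x1 x2.
Proof. by move=> Q_homog; rewrite -Q_homog mulr0. Qed.

Lemma generic_segment : exists al be : C, [/\ off_ray 1 al, off_ray 1 be &
  forall (z1 z2 : C) (t : R), (z1, z2) != (0, 0) -> 0 <= t ->
    al * mpow p q z1 + t%:C * f0 z1 z2 = 0 -> be * mpow p' q' z2 + t%:C * g0 z1 z2 <> 0].
Proof.
have [al [be [[al_f al1] [be_g be1] al_be]]] := generic_pair.
exists al, be; split=> // z1 z2 t z0 t0.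
have [z10|z10] := eqVneq z1 0.
  have z20 : z2 != 0 by apply: contraNneq z0 => ->; rewrite z10.
  have -> : g0 z1 z2 = mpow p' q' z2 * g0 0 1.
    by rewrite -bihomogeneous_infinity // mulr0 mulr1 z10.
  move=> _ /eqP; rewrite [be * _]mulrC mulrCA -mulrDr mulf_eq0.
  by rewrite (negPf (mpow_neq0 _ _ z20)) (negPf (be_g t t0)).
have f0E : f0 z1 z2 = mpow p q z1 * f0 1 (z2 / z1).
  by rewrite -bihomogeneous_infinity // mulr1 mulrC divfK.
have g0E : g0 z1 z2 = mpow p' q' z1 * g0 1 (z2 / z1).
  by rewrite -bihomogeneous_infinity // mulr1 mulrC divfK.
rewrite f0E [al * _]mulrC mulrCA -mulrDr => /eqP.
rewrite mulf_eq0 (negPf (mpow_neq0 _ _ z10)) => /eqP al_eq.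
have [z20|z20] := eqVneq z2 0.
  by move: al_eq (al_f t t0); rewrite z20 mul0r => ->; rewrite eqxx.
have w0 : z2 / z1 != 0 by rewrite mulf_neq0 ?invr_eq0.
have z2E : mpow p' q' z2 = mpow p' q' z1 * mpow p' q' (z2 / z1) by rewrite -mpowM mulrC divfK.
rewrite z2E g0E mulrCA [t%:C * _]mulrCA -mulrDr => /eqP.
by rewrite mulf_eq0 (negPf (mpow_neq0 _ _ z10)) => /eqP; exact: al_be w0 al_eq.
Qed.

Lemma C1_monomial (z : V -> C) al a b : C1_complex z -> C1_complex (fun x => al * mpow a b (z x)).
Proof. by move=> Cz; exact: C1_complexM (C1_complex_cst al) (C1_mpow a b Cz). Qed.

Lemma deform_to_generic_monomials (M : nat) (d : int) (al be : C) : (0 < M)%N ->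
  (forall (z1 z2 : C) (t : R), (z1, z2) != (0, 0) -> 0 <= t ->
    al * mpow p q z1 + t%:C * f0 z1 z2 = 0 -> be * mpow p' q' z2 + t%:C * g0 z1 z2 <> 0) ->
  has_degree M (curve_pair F G 0) d -> has_degree M (monomials al be) d.
Proof.
move=> M0 al_be.
have C1_leading Q : C1_complex (fun x : V => mp_eval Q 0 (z1_of x) (z2_of x)).
  exact: C1_mp_eval (C1_complex_cst 0) (@C1_z1_of R) (@C1_z2_of R).
apply: (has_degree_vec_segment (C1_leading F) (C1_leading G) (C1_monomial al p q (@C1_z1_of R))
  (C1_monomial be p' q' (@C1_z2_of R))) => x t xM /andP[t0 t1].
have MR : 0 < M%:R :> R by rewrite ltr0n.
have z0 := cube_boundary_parts_neq0 MR xM.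
have [->|t_neq0] := eqVneq t 0.
  rewrite subr0 !mul1r !mul0r !addr0 => f_zero g_zero.
  exact: no_zero_at_infinity z0 (conj f_zero g_zero).
have tC : t%:C != 0 by rewrite realc_eq0.
have ratio (y k : C) : (1 - t)%:C * y + t%:C * k = t%:C * (k + ((1 - t) / t)%:C * y).
  by rewrite mulrDr mulrA -rmorphM [t * _]mulrC divfK // addrC.
rewrite !ratio => /eqP; rewrite mulf_eq0 (negPf tC) => /eqP f_zero /eqP.
rewrite mulf_eq0 (negPf tC) => /eqP; apply: al_be f_zero => //.
by rewrite divr_ge0 // subr_ge0.
Qed.

Lemma deform_generic_monomials (M : nat) (d : int) (al be : C) : (0 < M)%N ->
  off_ray 1 al -> off_ray 1 be ->
  has_degree M (monomials al be) d ->
  has_degree M (fun x : V => vec (mpow p q (z1_of x)) (mpow p' q' (z2_of x))) d.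
Proof.
move=> M0 al1 be1.
apply: (has_degree_vec_segment (C1_monomial al p q (@C1_z1_of R))
  (C1_monomial be p' q' (@C1_z2_of R)) (C1_mpow p q (@C1_z1_of R))
  (C1_mpow p' q' (@C1_z2_of R))) => x t xM /andP[t0 t1].
have MR : 0 < M%:R :> R by rewrite ltr0n.
have factor_neq0 c : off_ray 1 c -> (1 - t)%:C * c + t%:C != 0.
  move=> c1; have [->|t_neq1] := eqVneq t 1; first by rewrite subrr mul0r add0r oner_eq0.
  by rewrite -[t%:C]mulr1; apply: off_ray_segment; rewrite // subr_gt0 lt_neqAle t_neq1.
rewrite !(mulrA _ _ (mpow _ _ _)) -!mulrDl => /eqP.
rewrite mulf_eq0 (negPf (factor_neq0 _ al1)) => z1_zero /eqP.
rewrite mulf_eq0 (negPf (factor_neq0 _ be1)) => z2_zero.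
have := cube_boundary_parts_neq0 MR xM; rewrite xpair_eqE negb_and.
by case/orP => /mpow_neq0/negPf mpow0; [move: z1_zero|move: z2_zero]; rewrite mpow0.
Qed.

Lemma deform_to_monomials (M : nat) (d : int) : (0 < M)%N ->
  has_degree M (curve_pair F G 0) d ->
  has_degree M (fun x : V => vec (mpow p q (z1_of x)) (mpow p' q' (z2_of x))) d.
Proof.
move=> M0; have [al [be [al1 be1 al_be]]] := generic_segment.
by move=> /(deform_to_generic_monomials M0 al_be); exact: deform_generic_monomials.
Qed.

End GenericDeformation.

Section RootsOfConstants.
Variable C : closedFieldType.

Lemma separable_Xn_subC (c : C) e : c != 0 -> e%:R != 0 :> C ->
  separable_poly ('X^e - c%:P).
Proof.
case: e => [_ /eqP //|e c0 e0]; rewrite unlock derivB derivC subr0 derivXn -scaler_nat.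
rewrite coprimepZr // exprS coprimep_sym coprimep_addl_mul -polyCN -alg_polyC.
by rewrite coprimepZr ?coprimep1 ?oppr_eq0.
Qed.

Lemma roots_Xn_subC (c : C) e : c != 0 -> e%:R != 0 :> C -> exists us : seq C,
  [/\ uniq us, size us = e & forall u, (u ^+ e == c) = (u \in us)].
Proof.
move=> c0 e0; have e_gt0 : (0 < e)%N by case: e e0 => // /eqP.
have [us usP] := closed_field_poly_normal ('X^e - c%:P).
have /monicP lead1 : 'X^e - c%:P \is monic by rewrite monicXnsubC.
rewrite lead1 scale1r in usP; exists us; split=> [||u].
- by rewrite -separable_prod_XsubC -usP separable_Xn_subC.
- by apply/succn_inj; rewrite -(size_prod_XsubC us id) -usP size_XnsubC.
by rewrite -root_prod_XsubC -usP rootE !hornerE subr_eq0.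
Qed.

End RootsOfConstants.

Section BlockDeterminant.
Variable F : comNzRingType.

Lemma det_mx22 (A : 'M[F]_2) : \det A = A 0 0 * A 1 1 - A 0 1 * A 1 0.
Proof.
rewrite (expand_det_row _ ord0) !big_ord_recl big_ord0 /cofactor !det_mx11 !mxE.
rewrite /= addr0 expr0 mul1r expr1 mulN1r mulrN.
by congr (_ * _ - _ * _); congr (A _ _); apply/val_inj.
Qed.

Lemma det_lblock22 (A : 'M[F]_4) : A 0 2 = 0 -> A 0 3 = 0 -> A 1 2 = 0 -> A 1 3 = 0 ->
  \det A = (A 0 0 * A 1 1 - A 0 1 * A 1 0) * (A 2 2 * A 3 3 - A 2 3 * A 3 2).
Proof.
move=> A02 A03 A12 A13; pose B : 'M[F]_(2 + 2) := A.
have ur0 : ursubmx B = 0.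
  apply/matrixP => i j; rewrite !mxE.
  case: i => -[|[|//]] i2; case: j => -[|[|//]] j2.
  - by rewrite -A02; congr (A _ _); apply/val_inj.
  - by rewrite -A03; congr (A _ _); apply/val_inj.
  - by rewrite -A12; congr (A _ _); apply/val_inj.
  - by rewrite -A13; congr (A _ _); apply/val_inj.
rewrite -[\det A]/(\det B) -[B]submxK ur0 det_lblock !det_mx22 !mxE /B.
by congr ((_ * _ - _ * _) * (_ * _ - _ * _)); congr (A _ _); apply/val_inj.
Qed.

End BlockDeterminant.

Section ComplexDifferential.
Variables (R : realType) (V : normedModType R).
Local Notation C := (R[i]).
Implicit Types (z w dz dw : V -> C) (x : V).

Lemma eq_is_diff (W : normedModType R) (f g df dg : V -> W) x : (forall y, f y = g y) ->
  (forall v, df v = dg v) -> is_diff x f df -> is_diff x g dg.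
Proof. by move=> /funext-> /funext->. Qed.

Definition is_diff_complex x z dz :=
  is_diff x (fun y => complex.Re (z y)) (fun v => complex.Re (dz v)) /\
  is_diff x (fun y => complex.Im (z y)) (fun v => complex.Im (dz v)).

Lemma is_diff_complexJ x z dz : is_diff_complex x z dz ->
  is_diff_complex x (fun y => conjc (z y)) (fun v => conjc (dz v)).
Proof.
move=> [Re_z Im_z]; split.
  by apply: eq_is_diff Re_z => [y|v]; rewrite ReJ.
by apply: eq_is_diff (is_diffN Im_z) => [y|v]; rewrite ImJ.
Qed.

Lemma is_diff_complexM x z dz w dw : is_diff_complex x z dz -> is_diff_complex x w dw ->
  is_diff_complex x (fun y => z y * w y) (fun v => z x * dw v + dz v * w x).
Proof.
move=> [Re_z Im_z] [Re_w Im_w]; split.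
  apply: eq_is_diff (is_diffB (is_diffM Re_z Re_w) (is_diffM Im_z Im_w)) => [y|v].
    by rewrite ReM.
  rewrite ReD !ReM !fctE /GRing.scale /=; ring.
apply: eq_is_diff (is_diffD (is_diffM Re_z Im_w) (is_diffM Im_z Re_w)) => [y|v].
  by rewrite ImM.
rewrite ImD !ImM !fctE /GRing.scale /=; ring.
Qed.

Lemma is_diff_complexX x z dz e : is_diff_complex x z dz ->
  is_diff_complex x (fun y => z y ^+ e) (fun v => e%:R * z x ^+ e.-1 * dz v).
Proof.
move=> z_diff; elim: e => [|e [Re_ze Im_ze]].
  by split; apply: eq_is_diff (is_diff_cst _ x) => [y|v]; rewrite ?expr0 ?mulr0n ?mul0r.
have [Re_mul Im_mul] := is_diff_complexM z_diff (conj Re_ze Im_ze).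
have dE v : z x * (e%:R * z x ^+ e.-1 * dz v) + dz v * z x ^+ e =
    e.+1%:R * z x ^+ e * dz v.
  by case: e {Re_ze Im_ze Re_mul Im_mul} => [|e] /=; rewrite ?expr0 ?exprS -?natr1; ring.
split; first by apply: eq_is_diff Re_mul => [y|v]; rewrite ?exprS ?dE.
by apply: eq_is_diff Im_mul => [y|v]; rewrite ?exprS ?dE.
Qed.

Lemma is_diff_complex_subr x z dz c : is_diff_complex x z dz ->
  is_diff_complex x (fun y => z y - c) dz.
Proof.
move=> [Re_z Im_z]; split.
  apply: eq_is_diff (is_diffD Re_z (is_diff_cst (complex.Re (- c)) x)) => [y|v].
    by rewrite ReD.
  by rewrite !fctE addr0.
apply: eq_is_diff (is_diffD Im_z (is_diff_cst (complex.Im (- c)) x)) => [y|v].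
  by rewrite ImD.
by rewrite !fctE addr0.
Qed.

Lemma is_diff_vec x z dz w dw : is_diff_complex x z dz -> is_diff_complex x w dw ->
  is_diff x (fun y => vec (z y) (w y)) (fun v => vec (dz v) (dw v)).
Proof.
move=> [Re_z Im_z] [Re_w Im_w]; apply: is_diff_rV => j.
have coordE (a b : V -> C) : (fun y => vec (a y) (b y) ord0 j) = (fun y =>
    if j == 0 :> nat then complex.Re (a y) else if j == 1 :> nat then complex.Im (a y)
    else if j == 2 :> nat then complex.Re (b y) else complex.Im (b y)).
  by apply/funext => y; rewrite mxE.
rewrite !coordE.
case: (nat_of_ord j == 0%N); first exact: Re_z.
case: (nat_of_ord j == 1%N); first exact: Im_z.
by case: (nat_of_ord j == 2%N); [exact: Re_w|exact: Im_w].
Qed.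

End ComplexDifferential.

Section Flip.
Variable R : realType.
Local Notation C := (R[i]).
Local Notation V := 'rV[R]_4.
Implicit Types z : C.

Definition flip (b : bool) z : C := if b then conjc z else z.

Lemma flipK b : involutive (flip b).
Proof. by case: b => z //=; rewrite conjcK. Qed.

Lemma sqnorm_flip b z : sqnorm (flip b z) = sqnorm z.
Proof. by case: b => //; rewrite /sqnorm ReJ ImJ sqrrN. Qed.

Lemma C1_flip (U : normedModType R) b (z : U -> C) : C1_complex z ->
  C1_complex (fun y => flip b (z y)).
Proof. by move=> Cz; case: b; [exact: C1_complexJ|exact: Cz]. Qed.

Lemma C1_flip_power (U : normedModType R) b e c (z : U -> C) : C1_complex z ->
  C1_complex (fun y => flip b (z y) ^+ e - c).
Proof.
by move=> Cz; exact: C1_complexD (C1_complexX e (C1_flip b Cz)) (C1_complex_cst (- c)).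
Qed.

Lemma is_diff_complex_flip (U : normedModType R) (x : U) b (z dz : U -> C) :
  is_diff_complex x z dz -> is_diff_complex x (fun y => flip b (z y)) (fun v => flip b (dz v)).
Proof. by move=> z_diff; case: b; [exact: is_diff_complexJ|exact: z_diff]. Qed.

Lemma mpow_flip p q : exists k (b : bool) e, (-1) ^+ b * e%:Z = p%:Z - q%:Z /\
  forall z, mpow p q z = (sqnorm z ^+ k)%:C * flip b z ^+ e.
Proof.
have [qp|pq] := leqP q p.
  exists q, false, (p - q)%N; split=> [|z]; first by rewrite mul1r subzn.
  by rewrite rmorphXn /= -mul_conjc exprMn /mpow -{1}(subnKC qp) exprD; ring.
exists p, true, (q - p)%N; split=> [|z]; first by rewrite mulN1r -subzn ?opprB // ltnW.
by rewrite rmorphXn /= -mul_conjc exprMn /mpow -{1}(subnKC (ltnW pq)) exprD; ring.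
Qed.

Lemma norm_le1_parts (x : V) : sqnorm (z1_of x) <= 1 -> sqnorm (z2_of x) <= 1 -> `|x| <= 1.
Proof.
have norm_le1 (r s : R) : r ^+ 2 + s ^+ 2 <= 1 -> `|r| <= 1.
  move=> rs; rewrite -(expr_le1 (n := 2)) // real_normK ?num_real //.
  by apply: le_trans rs; rewrite lerDl sqr_ge0.
have parts_le1 z : sqnorm z <= 1 -> `|complex.Re z| <= 1 /\ `|complex.Im z| <= 1.
  by move=> z1; split; [apply: norm_le1 z1|apply: (norm_le1 _ (complex.Re z)); rewrite addrC].
move=> /parts_le1[Re1 Im1] /parts_le1[Re2 Im2]; apply/rV_norm_leP => // j.
by rewrite -(vec_z1_z2 x) mxE; do 3?case: ifP.
Qed.

Lemma half_roots e : exists us : seq C,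
  [/\ uniq us, size us = e & forall u, (u ^+ e == 2^-1) = (u \in us)].
Proof.
case: e => [|e]; last by apply: roots_Xn_subC; rewrite ?invr_eq0 pnatr_eq0.
exists [::]; split=> // u; rewrite expr0 in_nil -(inj_eq (mulfI (_ : 2 != 0 :> C))) ?pnatr_eq0 //.
by rewrite mulr1 divff ?pnatr_eq0 // (eqr_nat _ 2 1).
Qed.

Lemma sqnorm_half : sqnorm (2^-1 : C) = 4^-1.
Proof.
have -> : 2^-1 = (2^-1)%:C :> C by rewrite fmorphV rmorph_nat.
by rewrite sqnorm_real exprVn -natrX.
Qed.

Lemma half_root_sqnorm_le1 e z : z ^+ e = 2^-1 -> sqnorm z <= 1.
Proof.
move=> /(congr1 (@sqnorm R)); rewrite sqnormX sqnorm_half => z_e.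
rewrite leNgt; apply/negP => /ltW z_gt1; have := exprn_ege1 e z_gt1; rewrite z_e; lra.
Qed.

Lemma half_root_derivative_neq0 e z : z ^+ e = 2^-1 -> e%:R * z ^+ e.-1 != 0.
Proof.
have half_neq0 : 2^-1 != 0 :> C by rewrite invr_eq0 pnatr_eq0.
have half_neq1 : 2^-1 != 1 :> C by rewrite invr_eq1 (eqr_nat _ 2 1).
case: e => [|e] /= z_e; first by rewrite -z_e expr0 eqxx in half_neq1.
rewrite mulf_neq0 ?pnatr_eq0 // expf_neq0 //.
by apply: contraNneq half_neq0 => z0; rewrite -z_e z0 expr0n.
Qed.

Lemma det_flip_parts (A : 'M[R]_4) (c1 c2 : C) b1 b2 :
  (forall v, v *m A = vec (c1 * flip b1 (z1_of v)) (c2 * flip b2 (z2_of v))) ->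
  \det A = (-1) ^+ b1 * (-1) ^+ b2 * (sqnorm c1 * sqnorm c2).
Proof.
move=> A_mul; have AE i j : A i j =
    vec (c1 * flip b1 (z1_of (delta_mx ord0 i))) (c2 * flip b2 (z2_of (delta_mx ord0 i))) ord0 j.
  by rewrite -A_mul -rowE mxE.
have flip0 b : flip b (Complex 0 0) = 0 :> C by case: b; rewrite /flip /= ?oppr0.
rewrite det_lblock22 ?AE ?mxE /z1_of /z2_of ?mxE /= ?flip0 ?mulr0 //.
case: b1 {A_mul AE}; case: b2; rewrite /flip /= /sqnorm; case: c1; case: c2 => a b a' b' /=;
  ring.
Qed.

End Flip.

Section PowerMap.
Variables (R : realType) (b1 b2 : bool) (e1 e2 : nat).
Local Notation C := (R[i]).
Local Notation V := 'rV[R]_4.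
Implicit Types x v : V.

(* The constant [1/2] makes the map zero-free when [e1 = 0] or [e2 = 0]. *)
Definition power_map x : V :=
  vec (flip b1 (z1_of x) ^+ e1 - 2^-1) (flip b2 (z2_of x) ^+ e2 - 2^-1).

Lemma power_map_eq0 x : (power_map x == 0) =
  (flip b1 (z1_of x) ^+ e1 == 2^-1) && (flip b2 (z2_of x) ^+ e2 == 2^-1).
Proof. by rewrite vec_eq0 !subr_eq0. Qed.

Lemma power_map_zeros : exists ps : seq V,
  [/\ uniq ps, size ps = (e1 * e2)%N & forall x, (power_map x == 0) = (x \in ps)].
Proof.
have [us [us_uniq us_size usP]] := half_roots R e1.
have [ws [ws_uniq ws_size wsP]] := half_roots R e2.
exists [seq vec (flip b1 u) (flip b2 w) | u <- us, w <- ws]; split=> [||x].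
- apply: allpairs_uniq => // -[u w] [u' w'] _ _ /= uw.
  have := congr1 (@z2_of R) uw; have := congr1 (@z1_of R) uw; rewrite !z1_of_vec !z2_of_vec.
  by move=> /(can_inj (flipK b1))-> /(can_inj (flipK b2))->.
- by rewrite size_allpairs us_size ws_size.
rewrite power_map_eq0 usP wsP; apply/andP/allpairsP => [[z1_us z2_ws]|[[u w] [/= u_us w_ws ->]]].
  exists (flip b1 (z1_of x), flip b2 (z2_of x)) => /=.
  by rewrite !flipK vec_z1_z2.
by rewrite z1_of_vec z2_of_vec !flipK.
Qed.

Lemma det_jacobian_power_map x : \det ('J power_map x) = (-1) ^+ b1 * (-1) ^+ b2 *
  (sqnorm (e1%:R * flip b1 (z1_of x) ^+ e1.-1) * sqnorm (e2%:R * flip b2 (z2_of x) ^+ e2.-1)).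
Proof.
have power_diff b e (z : V -> C) : is_diff_complex x z z -> is_diff_complex x
    (fun y => flip b (z y) ^+ e - 2^-1) (fun v => e%:R * flip b (z x) ^+ e.-1 * flip b (z v)).
  move=> z_diff; apply: is_diff_complex_subr.
  exact: is_diff_complexX e (is_diff_complex_flip b z_diff).
have z1_diff : is_diff_complex x (@z1_of R) (@z1_of R) by split; exact: is_diff_entry.
have z2_diff : is_diff_complex x (@z2_of R) (@z2_of R) by split; exact: is_diff_entry.
have map_diff := is_diff_vec (power_diff b1 e1 _ z1_diff) (power_diff b2 e2 _ z2_diff).
by apply: det_flip_parts => v; exact: mul_jacobian map_diff.
Qed.

Lemma C1_power_map x : C1 power_map x.
Proof.
exact: C1_vec (C1_flip_power b1 e1 _ (@C1_z1_of R)) (C1_flip_power b2 e2 _ (@C1_z2_of R)).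
Qed.

Lemma sgz_det_jacobian_power_map x : power_map x = 0 ->
  sgz (\det ('J power_map x)) = (-1) ^+ b1 * (-1) ^+ b2.
Proof.
move=> /eqP; rewrite power_map_eq0 => /andP[/eqP z1_root /eqP z2_root].
rewrite det_jacobian_power_map sgzM [sgz (sqnorm _ * _)]gtr0_sgz; last first.
  by rewrite mulr_gt0 // sqnorm_gt0 // half_root_derivative_neq0.
by rewrite mulr1 sgzM; case: b1; case: b2; rewrite ?expr1 ?expr0 ?sgzN1 ?sgz1.
Qed.

Lemma has_degree_power_map (M : nat) : (1 < M)%N ->
  has_degree M power_map ((-1) ^+ b1 * e1%:Z * ((-1) ^+ b2 * e2%:Z)).
Proof.
move=> M1; have [ps [ps_uniq ps_size psP]] := power_map_zeros.
have zero_ps x : x \in ps -> power_map x = 0 by rewrite -psP => /eqP.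
have -> : (-1) ^+ b1 * e1%:Z * ((-1) ^+ b2 * e2%:Z) =
    \sum_(x <- ps) sgz (\det ('J power_map x)).
  rewrite (eq_big_seq (fun=> (-1) ^+ b1 * (-1) ^+ b2)) => [|x /zero_ps]; last first.
    exact: sgz_det_jacobian_power_map.
  by rewrite big_const_seq count_predT iter_addr_0 ps_size -mulr_natr natrM !natz mulrACA.
apply: has_degree_regular => [x||x _ /eqP|x x_ps]; first exact: C1_continuous (C1_power_map x).
- exact: ps_uniq.
- by rewrite psP.
have x0 := zero_ps x x_ps; split=> //.
- have := x0 => /eqP; rewrite power_map_eq0 => /andP[/eqP z1_root /eqP z2_root].
  apply: (@le_lt_trans _ _ 1); last by rewrite ltr1n.
  apply: norm_le1_parts; first by rewrite -(sqnorm_flip b1) (half_root_sqnorm_le1 z1_root).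
  by rewrite -(sqnorm_flip b2) (half_root_sqnorm_le1 z2_root).
- exact: C1_differentiable (C1_power_map x).
- by rewrite -sgz_eq0 sgz_det_jacobian_power_map // mulf_neq0 // signr_eq0.
Qed.

End PowerMap.

Lemma segment_flip_power_neq0 (R : realType) (b : bool) (k e : nat) (z : R[i]) (t : R) :
  1 <= sqnorm z -> 0 <= t <= 1 ->
  (1 - t)%:C * (flip b z ^+ e - 2^-1) + t%:C * ((sqnorm z ^+ k)%:C * flip b z ^+ e) != 0.
Proof.
move=> z1 /andP[t0 t1]; pose r := (1 - t) + t * sqnorm z ^+ k.
have -> : (1 - t)%:C * (flip b z ^+ e - 2^-1) + t%:C * ((sqnorm z ^+ k)%:C * flip b z ^+ e) =
    r%:C * flip b z ^+ e - (1 - t)%:C * 2^-1.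
  by rewrite /r !rmorphD rmorphM /=; ring.
rewrite subr_eq0; apply/negP => /eqP/(congr1 (@sqnorm R)).
rewrite !sqnormM sqnormX sqnorm_flip sqnorm_half !sqnorm_real => norm_eq.
have z_k := exprn_ege1 k z1; have z_e := exprn_ege1 e z1.
have r1 : 1 <= r ^+ 2 by rewrite exprn_ege1 // /r; nra.
have : 1 <= r ^+ 2 * sqnorm z ^+ e by rewrite mulr_ege1.
have : (1 - t) ^+ 2 <= 1 by rewrite exprn_ile1 //; lra.
by rewrite norm_eq; lra.
Qed.

Lemma has_degree_monomials (R : realType) (M p q p' q' : nat) : (1 < M)%N ->
  has_degree M (fun x : 'rV[R]_4 => vec (mpow p q (z1_of x)) (mpow p' q' (z2_of x)))
    ((p%:Z - q%:Z) * (p'%:Z - q'%:Z)).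
Proof.
move=> M1; have [k1 [b1 [e1 [<- mpow1]]]] := mpow_flip R p q.
have [k2 [b2 [e2 [<- mpow2]]]] := mpow_flip R p' q'.
apply: (has_degree_vec_segment (C1_flip_power b1 e1 2^-1 (@C1_z1_of R))
  (C1_flip_power b2 e2 2^-1 (@C1_z2_of R)) (C1_mpow p q (@C1_z1_of R))
  (C1_mpow p' q' (@C1_z2_of R)) _ (has_degree_power_map _ _ _ _ _ M1)).
move=> x t xM t01; rewrite mpow1 mpow2 => z1_zero z2_zero.
have [|z1] := leP (sqnorm (z1_of x)) 1; last first.
  by have := segment_flip_power_neq0 b1 k1 e1 (ltW z1) t01; rewrite z1_zero eqxx.
have [z2 /norm_le1_parts/(_ z2)|z2 _] := leP (sqnorm (z2_of x)) 1.
  by rewrite (xM : `|x| = _) leNgt ltr1n M1.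
by have := segment_flip_power_neq0 b2 k2 e2 (ltW z2) t01; rewrite z2_zero eqxx.
Qed.

Lemma Itop_sum_has_degree (R : realType) (F G : mixed_poly R) (Ps : seq 'rV[R]_4)
    (n : 'rV[R]_4 -> int) : uniq Ps -> (forall v, phi_map F G v = 0 <-> v \in Ps) ->
  (forall p, p \in Ps -> Itop F G p (n p)) ->
  \forall N \near \oo, has_degree N.+1 (curve_pair F G 1) (\sum_(p <- Ps) n p).
Proof.
move=> Ps_uniq Ps_zeros Ps_Itop.
have /choice[eps epsP] : forall p, exists e : R, p \in Ps -> [/\ 0 < e,
    forall v, enorm (v - p) <= e -> curve_pair F G 1 v = 0 -> v = p &
    sphere_map_degree (fun v => (enorm (curve_pair F G 1 v))^-1 *: curve_pair F G 1 v) p e (n p)].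
  move=> p; have [/Ps_Itop[e e0 [p_zero p_deg]]|] := boolP (p \in Ps); last by exists 1.
  by exists e.
have large : \forall N \near \oo, forall p, p \in Ps -> `|p| + eps p < N.+1%:R.
  apply: near_seq => p _; near=> N; apply: (@lt_trans _ _ N%:R); last by rewrite ltr_nat.
  by near: N; exact: nbhs_infty_gtr.
apply: filterS large => N ball_N.
apply: (has_degree_sum_local (C1_curve_pair F G 1) (eps := eps)) => [|x _|p p_Ps] //.
  by move/Ps_zeros.
by have [e0 p_zero p_deg] := epsP p p_Ps; split=> //; exact: ball_N.
Unshelve. all: by end_near. Qed.

Theorem theorem6 (R : realType) (F G : mixed_poly R) (dr dr' : nat) (d d' : int)
  (Ps : seq 'rV[R]_4) (n : 'rV[R]_4 -> int) :
  strongly_polar_homogeneous F dr d ->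
  strongly_polar_homogeneous G dr' d' ->
  isolated_mixed_singularities F ->
  isolated_mixed_singularities G ->
  (* C /\ C' /\ {X0 = 0} is empty *)
  (forall x1 x2 : R[i], (x1, x2) != (0, 0) ->
     ~ (mp_eval F 0 x1 x2 = 0 /\ mp_eval G 0 x1 x2 = 0)) ->
  (* C /\ C' = {P_1, ..., P_mu} (all in the chart X0 <> 0) *)
  uniq Ps ->
  (forall v, phi_map F G v = 0 <-> v \in Ps) ->
  (forall p, p \in Ps -> Itop F G p (n p)) ->
  \sum_(p <- Ps) n p = d * d'.
Proof.
move=> /strongly_polar_bihomogeneous[p [q [<- F_homog]]].
move=> /strongly_polar_bihomogeneous[p' [q' [<- G_homog]]] _ _ no_zero Ps_uniq Ps_zeros Ps_Itop.
have affine_deg := Itop_sum_has_degree Ps_uniq Ps_zeros Ps_Itop.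
have segment_neq0 := near_infinity_segment_neq0 F_homog G_homog no_zero.
have [N [[N_affine N_segment] N_gt0]] :=
  filter_ex (filterI (filterI affine_deg segment_neq0) (nbhs_infty_gt 0)).
have leading_deg : has_degree N.+1 (curve_pair F G 0) (\sum_(x <- Ps) n x).
  apply: has_degree_segment N_segment N_affine => x; exact: C1_continuous (C1_curve_pair F G _ x).
have monomial_deg := deform_to_monomials F_homog G_homog no_zero (ltn0Sn N) leading_deg.
exact: has_degree_unique monomial_deg (has_degree_monomials R p q p' q' (N_gt0 : 1 < N.+1)%N).
Qed.
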